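(* Let $n\ge1$. There is a constant $C>0$ such that for every $f\in\widetilde{L^2}(\mathbb R_+;\mathrm{BMO}(\mathbb R^n))$, $$\sup_{B=B(x_B,r_B)}\Big(r_B^{-n}\int_0^{r_B^2}\int_B|\mathcal M_\Delta(f)(x,t)|^2\,dx\,dt\Big)^{1/2}\le C\|f\|_{\widetilde{L^2}(\mathbb R_+;\mathrm{BMO}(\mathbb R^n))}$$ and $$\sup_{B=B(x_B,r_B)}\Big(r_B^{-n}\int_0^{r_B^2}\int_B|\mathcal T_\Delta(f)(x,t)|^2\,\frac{dx\,dt}{t}\Big)^{1/2}\le C\|f\|_{\widetilde{L^2}(\mathbb R_+;\mathrm{BMO}(\mathbb R^n))},$$ where the suprema are over all balls $B(x_B,r_B)\subset\mathbb R^n$.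
   Context: $\mathbb R_+=(0,\infty)$; functions $f=f(x,t):\mathbb R^n\times\mathbb R_+\to\mathbb R$ are measurable. For a ball $B=B(x_B,r_B)$, $g_B=|B|^{-1}\int_Bg$. The space $\widetilde{L^2}(\mathbb R_+;\mathrm{BMO}(\mathbb R^n))$ consists of those $f$ with $$\|f\|^2_{\widetilde{L^2}(\mathbb R_+;\mathrm{BMO})}=\sup_{B}\int_0^{r_B^2}\frac1{|B|^2}\int_{B\times B}|f(x,t)-f(y,t)|^2\,dx\,dy\,dt<\infty;$$ equivalently (with comparable quasi-norm), $\sup_Br_B^{-n}\int_0^{r_B^2}\int_B|f(x,t)-(f(\cdot,t))_B|^2dx\,dt<\infty$. With $e^{t\Delta}$ the heat semigroup on $\mathbb R^n$, $$\mathcal M_\Delta(f)(x,t)=\int_0^t\partial_te^{(t-s)\Delta}f(\cdot,s)(x)\,ds,\qquad\mathcal T_\Delta(f)(x,t)=\int_0^t\nabla_xe^{(t-s)\Delta}f(\cdot,s)(x)\,ds.$$ *)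

(* Defs.v *)
From HB Require Import structures.
From mathcomp Require Import all_boot all_order all_algebra.
From mathcomp Require Import all_classical all_reals all_analysis.

Set Implicit Arguments.
Unset Strict Implicit.
Unset Printing Implicit Defensive.

Import Order.TTheory GRing.Theory Num.Theory.
Import numFieldNormedType.Exports.

Local Open Scope classical_set_scope.
Local Open Scope ring_scope.

Definition measure_rV_display : measure_display -> measure_display.
Proof. exact. Qed.

Section measurable_rV.
Context {d} {T : measurableType d} {n : nat}.

Let coord (i : 'I_n) (x : 'rV[T]_n) : T := x ord0 i.

Let rV_set0 : g_sigma_preimage coord set0.
Proof. exact: sigma_algebra0. Qed.

Let rV_setC A : g_sigma_preimage coord A -> g_sigma_preimage coord (~` A).
Proof. exact: sigma_algebraC. Qed.

Let rV_bigcup (F : _^nat) : (forall i, g_sigma_preimage coord (F i)) ->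
  g_sigma_preimage coord (\bigcup_i (F i)).
Proof. exact: sigma_algebra_bigcup. Qed.

HB.instance Definition _ := @isMeasurable.Build (measure_rV_display d)
  'rV[T]_n (g_sigma_preimage coord) rV_set0 rV_setC rV_bigcup.

End measurable_rV.


Lemma measurable_fun_rVP {d1 d2} {T1 : measurableType d1}
    {T2 : measurableType d2} n (f : T1 -> 'rV[T2]_n) :
  (forall i, measurable_fun [set: T1] (fun x => f x ord0 i)) ->
  measurable_fun [set: T1] f.
Proof.
move=> mf.
have H : @g_sigma_preimage _ T2 T1 n (fun i x => f x ord0 i) `<=` measurable.
  apply: smallest_sub; first exact: sigma_algebra_measurable.
  case: n => [|n] in f mf *; first by rewrite big_ord0.
  rewrite -bigcup_mkord_ord; apply: bigcup_sub => i Ii.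
  by move=> A [B mB <-]; exact: mf.
move: H; rewrite (@g_sigma_preimage_comp _ T2 n _
  (fun i (x : 'rV[T2]_n) => x ord0 i) T1 f) => prefS.
by move=> _ A mA; apply: prefS; exists A.
Qed.

Lemma measurable_coord {d} {T : measurableType d} n (i : 'I_n) :
  measurable_fun [set: 'rV[T]_n] (fun x => x ord0 i).
Proof.
move=> _ Y mY; rewrite setTI; apply: sub_sigma_algebra => /=.
rewrite -bigcup_seq/=; exists i => /=; first by rewrite mem_index_enum.
by exists Y => //; rewrite setTI.
Qed.

Section lebesgue_rV.
Context {R : realType}.

Definition rV_cons n (p : measurableTypeR R * 'rV[R]_n) : 'rV[R]_n.+1 :=
  @row_mx R 1 1 n (const_mx p.1) p.2.

Lemma measurable_rV_cons n : measurable_fun setT (@rV_cons n).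
Proof.
apply: measurable_fun_rVP => i; rewrite /rV_cons.
case: (@splitP 1 n i) => j ij.
- rewrite (_ : (fun _ => _) = fst); first exact: measurable_fst.
  apply/funext => p; rewrite (_ : i = lshift n j); last exact/val_inj.
  by rewrite (@row_mxEl R 1 1 n) mxE.
- rewrite (_ : (fun _ => _) =
    (fun x : 'rV[R]_n => x ord0 j) \o snd); last first.
    apply/funext => p; rewrite (_ : i = rshift 1 j); last exact/val_inj.
    by rewrite (@row_mxEr R 1 1 n).
  apply: measurableT_comp; first exact: measurable_coord.
  exact: measurable_snd.
Qed.

Fixpoint lebesgue_rV n : set 'rV[R]_n -> \bar R :=
  match n with
  | 0 => @dirac _ 'rV[R]_0 0 R
  | m.+1 => pushforward (@lebesgue_measure R \x^ lebesgue_rV (n := m))%E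
                        (@rV_cons m)
  end.
Arguments lebesgue_rV : clear implicits.

Lemma lebesgue_rV_measure n :
  exists mu : {measure set 'rV[R]_n -> \bar R}, mu = lebesgue_rV n :> (set _ -> _).
Proof.
elim: n => [|n [mu muE]]; first by exists (@dirac _ 'rV[R]_0 0 R).
pose m1 : {sigma_finite_measure set (measurableTypeR R) -> \bar R} :=
  @lebesgue_measure R.
pose m : {measure set (measurableTypeR R * 'rV[R]_n) -> \bar R} :=
  (m1 \x^ mu)%E.
exists (measure_function_pushforward__canonical__measure_function_Measure
         m (@measurable_rV_cons n)).
by rewrite /= -muE.
Qed.

Let lebesgue_rV0 n : lebesgue_rV n set0 = 0%E.
Proof. by have [mu <-] := lebesgue_rV_measure n; rewrite measure0. Qed.

Let lebesgue_rV_ge0 n A : (0 <= lebesgue_rV n A)%E.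
Proof. by have [mu <-] := lebesgue_rV_measure n. Qed.

Let lebesgue_rV_sigma_additive n : semi_sigma_additive (lebesgue_rV n).
Proof.
by have [mu <-] := lebesgue_rV_measure n; exact: measure_semi_sigma_additive.
Qed.

HB.instance Definition _ n := isMeasure.Build _ _ _ (lebesgue_rV n)
  (@lebesgue_rV0 n) (@lebesgue_rV_ge0 n) (@lebesgue_rV_sigma_additive n).

Lemma measurable_box n (A : 'I_n -> set R) : (forall i, measurable (A i)) ->
  measurable [set x : 'rV[R]_n | forall i, A i (x ord0 i)].
Proof.
move=> mA; rewrite [X in measurable X](_ : _ =
    \bigcap_(i in [set: 'I_n]) ((fun x : 'rV[R]_n => x ord0 i) @^-1` A i)).
  apply: fin_bigcap_measurable => [|i _]; first exact: finite_finset.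
  by rewrite -[X in measurable X]setTI; exact: measurable_coord.
by apply/seteqP; split => x /= Ax i; [move=> _; exact: Ax|exact: Ax].
Qed.

Lemma lebesgue_rV_box n (A : 'I_n -> set R) : (forall i, measurable (A i)) ->
  lebesgue_rV n [set x | forall i, A i (x ord0 i)] =
  (\prod_(i < n) lebesgue_measure (A i))%E.
Proof.
elim: n A => [|n IHn] A mA.
  by rewrite big_ord0 /= diracE mem_set//= => -[].
rewrite big_ord_recl -IHn//= /pushforward.
rewrite -[RHS](@product_measure2E _ _ _ _ R (@lebesgue_measure R)
  (lebesgue_rV n) _ _ (mA ord0) (measurable_box (fun i => mA (lift ord0 i)))).
congr ((_ \x^ _)%E _); apply/seteqP; split => -[a x] /=.
- move=> Aax; split => [|i]; [have := Aax ord0|have := Aax (lift ord0 i)].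
  + rewrite /rV_cons (_ : ord0 = lshift n (ord0 : 'I_1)); last exact/val_inj.
    by rewrite (@row_mxEl R 1 1 n) mxE.
  + rewrite /rV_cons (_ : lift ord0 i = rshift 1 i); last exact/val_inj.
    by rewrite (@row_mxEr R 1 1 n).
- move=> [Aa Ax] i; rewrite /rV_cons; case: (unliftP ord0 i) => [j ->|->].
  + have := Ax j; rewrite (_ : lift ord0 j = rshift 1 j); last exact/val_inj.
    by rewrite (@row_mxEr R 1 1 n).
  + move: Aa; rewrite (_ : ord0 = lshift n (ord0 : 'I_1)); last exact/val_inj.
    by rewrite (@row_mxEl R 1 1 n) mxE.
Qed.

Let lebesgue_rV_sigma_finite n : sigma_finite setT (lebesgue_rV n).
Proof.
exists (fun k => [set x : 'rV[R]_n |
    forall i, `[- k%:R : R, k%:R]%classic (x ord0 i)]).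
  apply/esym; rewrite -subTset => x _.
  exists (Num.bound (\sum_i `|x ord0 i|)) => //= i.
  rewrite in_itv/= -ler_norml.
  apply: le_trans (ltW (archi_boundP _)); last exact: sumr_ge0.
  by rewrite (bigD1 i)//= lerDl sumr_ge0.
move=> k; have mk (i : 'I_n) := measurable_itv `[- k%:R : R, k%:R].
split; first exact: (measurable_box mk).
rewrite (lebesgue_rV_box mk) ltey_eq; apply/orP; left.
elim/big_ind : _ => //=; first exact: fin_numM.
by move=> i _; rewrite lebesgue_measure_itv/=; case: ifPn.
Qed.

HB.instance Definition _ n := @Measure_isSigmaFinite.Build _ _ _
  (lebesgue_rV n) (@lebesgue_rV_sigma_finite n).

End lebesgue_rV.
Arguments lebesgue_rV {R} n.

Section heat.
Context {R : realType} {n : nat}.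
Implicit Types (x y : 'rV[R]_n) (r s t eps : R) (f g : 'rV[R]_n -> R -> R).

(* The norm of the library on 'rV[R]_n is the sup norm. *)
Definition enorm x : R := Num.sqrt (\sum_i x ord0 i ^+ 2).

Definition eball x r : set 'rV[R]_n := [set y | enorm (y - x) < r].

Definition sup_eball (F : 'rV[R]_n -> R -> \bar R) : \bar R :=
  ereal_sup [set F b.1 b.2 | b in [set b : 'rV[R]_n * R | 0 < b.2]].

Definition measurable_upper f : Prop :=
  measurable_fun ([set: 'rV[R]_n] `*` [set t : R | 0 < t])
    (fun z => f z.1 z.2).

Definition L2BMO_norm f : \bar R :=
  sqrte (sup_eball (fun xB r =>
    \int[lebesgue_measure]_(t in `]0%R, (r ^+ 2)%R[)
      ((fine (lebesgue_rV n (eball xB r)) ^- 2)%:E *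
       \int[lebesgue_rV n \x lebesgue_rV n]_(z in eball xB r `*` eball xB r)
         (`|f z.1 t - f z.2 t| ^+ 2)%:E)))%E.

Definition L2BMO f : Prop := measurable_upper f /\ (L2BMO_norm f < +oo)%E.

Definition heat_kernel t x : R :=
  Num.sqrt (4 * pi * t) ^- n * expR (- (enorm x ^+ 2 / (4 * t))).

Definition heat t (g : 'rV[R]_n -> R) x : R :=
  \int[lebesgue_rV n]_y (heat_kernel t (x - y) * g y).

Definition M_heat_trunc eps f x t : R :=
  \int[lebesgue_measure]_(s in `]0, t - eps[)
    ((fun u => heat (u - s) (f^~ s) x)^`())%classic t.

(* The kernel of M has a singularity of order (t - s)^-1 at s = t, so that
   the integral defining M f over ]0, t[ is not absolutely convergent in
   general; it is understood, as in the L^2 theory of maximal regularity, as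
   the limit in L^2_loc of the integrals over ]0, t - eps[. This determines
   M f up to equality almost everywhere. *)
Definition is_M_heat f g : Prop :=
  measurable_upper g /\
  forall xB r, 0 < r ->
    (\int[lebesgue_measure]_(t in `]0%R, (r ^+ 2)%R[)
       \int[lebesgue_rV n]_(x in eball xB r)
         (`|M_heat_trunc eps f x t - g x t| ^+ 2)%:E)%E
    @[eps --> 0^'+] --> 0%E.

(* The i-th component of T f, for which the integral is absolutely convergent
   at almost every (x, t). It is extended-real valued so that points where
   the integral diverges are not silently given a finite value. *)
Definition T_heat f x t (i : 'I_n) : \bar R :=
  (\int[lebesgue_measure]_(s in `]0%R, t[)
     ('D_(delta_mx ord0 i) (heat (t - s) (f^~ s)) x)%:E)%E.

Definition T_heat_sqnorm f x t : \bar R := (\sum_(i < n) T_heat f x t i ^+ 2)%E.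

End heat.

(* Main.v *)
Require Import Defs.
From HB Require Import structures.
From mathcomp Require Import all_boot all_order all_algebra.
From mathcomp Require Import all_classical all_reals all_analysis.
From mathcomp Require Import measurable_realfun ring lra zify.

(* Fix a ball B of radius r. As heat_dt and the gradient of the heat kernel have
   mean zero in space, f may be replaced on the time interval (0, r^2) by F(y, t) = f(y, t) - f(z, t)
   for a point z of B. Summing the oscillations of f over the balls 2^k B, which cover the longer
   time intervals (0, 4^k r^2), one finds z such that the integral of |F|^2 over (0, r^2) x R^n
   against a Gaussian weight centered at B is at most C r^n |f|^2.

   For T, the kernel is bounded by (t - s)^(-1/2) times a Gaussian, and the Schwarz inequality with
   the beta integral of (s (t - s))^(-1/2) turns dt/t into a bounded factor (Hardy's inequality).

   For M, write F as the sum of its restriction to 2B and of a far part. On the far part the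
   kernel is bounded by r^(-2) times a Gaussian. On 2B one needs the L^2 bound for M, obtained
   without Fourier analysis: let K_a be the kernel of M delayed by a > 0. The semigroup law gives
   K_a^* K_b = - (K_(a+b) + K_(a+b)^* ) / 2, so that N(a) = |K_a f|^2 satisfies
   <K_a f, K_b f> = N((a + b) / 2). Hence N is midpoint convex and bounded on every [a, oo), so it is
   nonincreasing; then N(a) = - <f, K_(2a) f> gives N(a) <= |f|^2, and
   |K_a f - K_b f|^2 = N(a) + N(b) - 2 N((a + b) / 2) gives convergence as a tends to 0. *)

Set Implicit Arguments.
Unset Strict Implicit.
Unset Printing Implicit Defensive.

Import Order.TTheory GRing.Theory Num.Theory.
Import numFieldNormedType.Exports.

Local Open Scope classical_set_scope.
Local Open Scope ring_scope.

(** * Gaussian bounds for the heat kernel *)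

(** The delay makes the composition law exact. Convolving two first time derivatives in space gives
    the second derivative at time [2 t - s - s' + a + b], and its integral over [t >= max(s, s')] is
    read off at the lower end, where the time is [|s - s'| + a + b]. A cut at [s < t - a] would
    produce a time that is not a function of [a + b]. The price is a translation in time, controlled
    only for a fixed positive delay because its constants blow up as the delay tends to 0.

    The second obstacle is that [f] is controlled only through its oscillation: [heat] and its
    derivatives have their usual meaning at times [s] where [f^~ s] is integrable against every
    Gaussian, that is for almost every [s]. Integrands are therefore compared off null sets of
    times, and without measurability.

    The weight must not depend on time. It is a Gaussian of scale [r], so wide that half of the
    exponent of any kernel occurring on the box produces it. The majorants for T and for the far
    part of M then share one form, a factor in time multiplied by a heat kernel, and one Schwarz
    argument serves both. *)

Section lebesgue_rV_integral.
Context {R : realType}.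
Local Open Scope ereal_scope.

Lemma ge0_integral_lebesgue_rVS n (F : 'rV[R]_n.+1 -> \bar R) :
  measurable_fun [set: 'rV[R]_n.+1] F -> (forall x, 0 <= F x) ->
  \int[lebesgue_rV n.+1]_x F x =
  \int[lebesgue_rV n]_v \int[@lebesgue_measure R]_a F (rV_cons (a, v)).
Proof.
move=> mF F0.
pose m1 : {sigma_finite_measure set (measurableTypeR R) -> \bar R} :=
  @lebesgue_measure R.
transitivity (\int[pushforward (m1 \x^ lebesgue_rV n) (@rV_cons R n)]_x F x).
  by [].
rewrite (ge0_integral_pushforward (@measurable_rV_cons R n))//.
rewrite preimage_setT.
transitivity (\int[m1 \x lebesgue_rV n]_x (F \o @rV_cons R n) x).
  (* [lebesgue_rV] is built with [\x^], while Tonelli is stated for [\x]; the two agree by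
     uniqueness of the product measure. *)
  apply: eq_measure_integral => A mA _.
  apply/esym.
  by apply: product_measure_unique => //= *; rewrite product_measure2E.
rewrite fubini_tonelli2//; last first.
  by move=> x; exact: F0.
apply: measurableT_comp => //; exact: measurable_rV_cons.
Qed.

Lemma integral_prod_coord n (phi : 'I_n -> R -> R) (c : 'I_n -> R) :
  (forall i, measurable_fun setT (phi i)) -> (forall i a, 0 <= phi i a)%R ->
  (forall i, \int[@lebesgue_measure R]_a (phi i a)%:E = (c i)%:E) ->
  \int[lebesgue_rV n]_x (\prod_(i < n) phi i (x ord0 i))%:E =
  (\prod_(i < n) c i)%:E.
Proof.
elim: n phi c => [|n IHn] phi c mphi phi0 intphi.
  rewrite big_ord0; under eq_integral do rewrite big_ord0.
  by rewrite integral_cst//= diracE mem_set//= mule1.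
have mprod m (psi : 'I_m -> R -> R) : (forall i, measurable_fun setT (psi i)) ->
    measurable_fun [set: 'rV[R]_m] (fun x : 'rV[R]_m => (\prod_(i < m) psi i (x ord0 i))%:E).
  move=> mpsi; apply/measurable_EFinP; apply: measurable_prod => i _.
  by apply: measurableT_comp => //; exact: measurable_coord.
rewrite ge0_integral_lebesgue_rVS; last 2 first.
  exact: mprod.
  by move=> x; rewrite lee_fin prodr_ge0.
rewrite big_ord_recl EFinM -(IHn (fun i => phi (lift ord0 i)))//.
rewrite -ge0_integralZl//=; last 3 first.
  exact: (mprod n (fun i => phi (lift ord0 i))).

  by move=> x _; rewrite lee_fin prodr_ge0.
  by rewrite -intphi; apply: integral_ge0 => x _; rewrite lee_fin.
apply: eq_integral => v _.
rewrite -intphi -ge0_integralZr//=; last 3 first.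
  apply/(@measurable_EFinP _ (measurableTypeR R)); exact: mphi.
  by move=> x _; rewrite lee_fin.
  by rewrite lee_fin prodr_ge0.
apply: eq_integral => a _.
rewrite big_ord_recl -EFinM; congr ((_ * _)%:E).
  congr phi; rewrite /rV_cons (_ : ord0 = lshift n (ord0 : 'I_1)); last exact/val_inj.
  by rewrite (@row_mxEl R 1 1 n) mxE.
apply: eq_bigr => i _; congr (phi _ _).
rewrite /rV_cons (_ : lift ord0 i = rshift 1 i); last exact/val_inj.
by rewrite (@row_mxEr R 1 1 n).
Qed.

End lebesgue_rV_integral.
Section measurable_real.
Context {R : realType}.

Lemma measurable_funV d (T : measurableType d) (D : set T) (f : T -> R) :
  measurable_fun D f -> measurable_fun D (fun x => (f x)^-1).
Proof.
move=> mf.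
(* Inversion is discontinuous at 0, but real powers are measurable; at 0 both sides vanish. *)
have -> : (fun x => (f x)^-1) = (fun x => f x * (f x ^+ 2) `^ (-1)).
  apply/funext => x; rewrite powR_inv1 ?sqr_ge0//.
  have [->|fx0] := eqVneq (f x) 0; first by rewrite invr0 mul0r.
  by field.
apply: measurable_funM => //.
have := @measurable_powR R (-1).
move=> /measurableT_comp; apply.
exact: measurable_funX.
Qed.

Lemma measurable_fun_sqrt d (T : measurableType d) (D : set T) (f : T -> R) :
  measurable_fun D f -> measurable_fun D (fun x => Num.sqrt (f x)).
Proof.
move=> mf; have ms : measurable_fun [set: R] (Num.sqrt : R -> R).
  by apply: continuous_measurable_fun => x; exact: sqrt_continuous.
exact: (measurableT_comp ms mf).
Qed.

End measurable_real.

Section heat_kernel.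
Context {R : realType} {n : nat}.
Implicit Types (x y z : 'rV[R]_n) (s t u : R).

Definition sqn x : R := \sum_i x ord0 i ^+ 2.

Lemma sqn_ge0 x : 0 <= sqn x.
Proof. by apply: sumr_ge0 => i _; rewrite sqr_ge0. Qed.

Lemma enorm_sqr x : enorm x ^+ 2 = sqn x.
Proof. by rewrite sqr_sqrtr// sqn_ge0. Qed.

Lemma sqnN x : sqn (- x) = sqn x.
Proof. by apply: eq_bigr => i _; rewrite mxE sqrrN. Qed.

Lemma sqnB x y : sqn (x - y) = sqn (y - x).
Proof. by rewrite -sqnN opprB. Qed.

Lemma sqn_coord x i : x ord0 i ^+ 2 <= sqn x.
Proof.
by rewrite /sqn (bigD1 i)//= lerDl sumr_ge0// => j _; rewrite sqr_ge0.
Qed.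

Lemma sqnD x y : sqn (x + y) <= 2 * sqn x + 2 * sqn y.
Proof.
rewrite /sqn !mulr_sumr -big_split/=; apply: ler_sum => i _.
rewrite mxE -subr_ge0.
have -> : 2 * x ord0 i ^+ 2 + 2 * y ord0 i ^+ 2 - (x ord0 i + y ord0 i) ^+ 2
  = (x ord0 i - y ord0 i) ^+ 2 by ring.
exact: sqr_ge0.
Qed.

Definition heat_dt t x :=
  heat_kernel t x * (sqn x / (4 * t ^+ 2) - n%:R / (2 * t)).

(** If the first time derivative is [heat_kernel * q], the bracket is [q ^+ 2] plus the time
    derivative of [q]. *)
Definition heat_dtt t x :=
  heat_kernel t x * ((sqn x / (4 * t ^+ 2) - n%:R / (2 * t)) ^+ 2 -
    sqn x / (2 * t ^+ 3) + n%:R / (2 * t ^+ 2)).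

Definition heat_dx (i : 'I_n) t x :=
  - heat_kernel t x * (x ord0 i / (2 * t)).

Lemma heat_kernelE t x : heat_kernel t x =
  Num.sqrt (4 * pi * t) ^- n * expR (- (sqn x / (4 * t))).
Proof. by rewrite /heat_kernel enorm_sqr. Qed.

Lemma heat_kernel_ge0 t x : 0 <= heat_kernel t x.
Proof. by rewrite mulr_ge0// ?expR_ge0// invr_ge0 exprn_ge0 ?sqrtr_ge0. Qed.

Lemma heat_kernelN t x : heat_kernel t (- x) = heat_kernel t x.
Proof. by rewrite !heat_kernelE sqnN. Qed.

Lemma heat_kernelB t x y : heat_kernel t (x - y) = heat_kernel t (y - x).
Proof. by rewrite -heat_kernelN opprB. Qed.

Lemma heat_dtB t x y : heat_dt t (x - y) = heat_dt t (y - x).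
Proof. by rewrite /heat_dt heat_kernelB sqnB. Qed.

Lemma measurable_sqn d (T : measurableType d) (g : T -> 'rV[R]_n) :
  measurable_fun setT g -> measurable_fun setT (fun w => sqn (g w)).
Proof.
move=> mg; apply: measurable_sum => i; apply: measurable_funX.
by apply: (measurableT_comp (measurable_coord i)).
Qed.

Lemma measurable_heat_kernel d (T : measurableType d) (f : T -> R)
    (g : T -> 'rV[R]_n) :
  measurable_fun setT f -> measurable_fun setT g ->
  measurable_fun setT (fun w => heat_kernel (f w) (g w)).
Proof.
move=> mf mg; under eq_fun do rewrite heat_kernelE.
apply: measurable_funM.
  apply: measurable_funV; apply: measurable_funX; apply: measurable_fun_sqrt.
  exact: measurable_funM.
apply: measurableT_comp => //; apply: measurableT_comp => //.
apply: measurable_funM; first exact: measurable_sqn.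
by apply: measurable_funV; exact: measurable_funM.
Qed.

Lemma measurable_heat_dt d (T : measurableType d) (f : T -> R)
    (g : T -> 'rV[R]_n) :
  measurable_fun setT f -> measurable_fun setT g ->
  measurable_fun setT (fun w => heat_dt (f w) (g w)).
Proof.
move=> mf mg; apply: measurable_funM; first exact: measurable_heat_kernel.
apply: measurable_funB; apply: measurable_funM => //; first exact: measurable_sqn.
  by apply: measurable_funV; apply: measurable_funM => //; exact: measurable_funX.
by apply: measurable_funV; apply: measurable_funM.
Qed.

Lemma measurable_heat_dx i d (T : measurableType d) (f : T -> R)
    (g : T -> 'rV[R]_n) :
  measurable_fun setT f -> measurable_fun setT g ->
  measurable_fun setT (fun w => heat_dx i (f w) (g w)).
Proof.
move=> mf mg; apply: measurable_funM.
  by apply: measurableT_comp => //; exact: measurable_heat_kernel.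
apply: measurable_funM.
  by apply: (measurableT_comp (measurable_coord i)).
by apply: measurable_funV; exact: measurable_funM.
Qed.

End heat_kernel.
Section heat_kernel_bounds.
Context {R : realType} {n : nat}.
Implicit Types (x y z : 'rV[R]_n) (s t u : R).

Lemma mul_expRN_le1 (x : R) : 0 <= x -> x * expR (- x) <= 1.
Proof.
move=> x0; rewrite expRN -ler_pdivlMr ?invr_gt0 ?expR_gt0// invrK mul1r.
by apply: le_trans (expR_ge1Dx x); rewrite lerDr.
Qed.

Lemma sqr_mul_expRN_le (x : R) : 0 <= x -> x ^+ 2 * expR (- x) <= 4.
Proof.
move=> x0; have := @mul_expRN_le1 (x / 2) (divr_ge0 x0 (ler0n _ _)).
move=> h; have -> : x ^+ 2 * expR (- x) = 4 * (x / 2 * expR (- (x / 2))) ^+ 2.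
  rewrite exprMn -expRM_natl.
  have -> : 2%:R * - (x / 2) = - x by field.
  by field.
rewrite -[leRHS]mulr1 ler_wpM2l// expr_le1// mulr_ge0 ?expR_ge0//.
by rewrite divr_ge0.
Qed.

Lemma norm_mul_expRN_le1 (x : R) : `|x| * expR (- x ^+ 2) <= 1.
Proof.
have [x1|x1] := lerP `|x| 1.
  by rewrite mulr_ile1// ?expR_ge0// -expR0 ler_expR oppr_le0 sqr_ge0.
apply: le_trans (mul_expRN_le1 (sqr_ge0 x)).
rewrite ler_wpM2r ?expR_ge0// -real_normK ?num_real// expr2.
by rewrite ler_peMr// ltW.
Qed.

Definition sqrt2n : R := Num.sqrt 2 ^+ n.

Lemma sqrt2n_ge1 : 1 <= sqrt2n.
Proof. by rewrite exprn_ege1// -[leLHS](@sqrtr1 R) ler_wsqrtr// ler1n. Qed.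

Lemma sqrt2n_gt0 : 0 < sqrt2n.
Proof. exact: lt_le_trans sqrt2n_ge1. Qed.

(** Doubling the time frees half of the exponent, which absorbs the polynomial factors of all
    derivatives; [sqrt2n] is the ratio of the two normalizations. *)
Lemma heat_kernel_double t x : 0 < t ->
  heat_kernel t x = sqrt2n * expR (- (sqn x / (8 * t))) * heat_kernel (2 * t) x.
Proof.
move=> t0; rewrite !heat_kernelE.
have -> : - (sqn x / (4 * t)) = - (sqn x / (8 * t)) - (sqn x / (4 * (2 * t))).
  by field; rewrite ?lt0r_neq0.
have -> : 4 * pi * (2 * t) = 2 * (4 * pi * t) by ring.
rewrite expRD; move: (4 * pi * t) => b.
rewrite sqrtrM// exprMn [(_ * Num.sqrt b ^+ n)^-1]invfM /sqrt2n.
have a0 : Num.sqrt 2 ^+ n != 0 :> R by rewrite expf_neq0// sqrtr_eq0 -ltNge.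
move: (Num.sqrt b ^- n) => c.
by field.
Qed.

Lemma heat_kernel_le t x : 0 < t -> heat_kernel t x <= Num.sqrt (4 * pi * t) ^- n.
Proof.
move=> t0; rewrite heat_kernelE -[leRHS]mulr1 ler_wpM2l ?invr_ge0 ?exprn_ge0//.
by rewrite expR_le1 oppr_le0 divr_ge0 ?sqn_ge0// mulr_ge0// ltW.
Qed.

(** With [v = sqn x / (8 t)], the number [2 + n] bounds [expR (- v) * |2 v - n / 2|]. *)
Definition heat_dt_cst : R := sqrt2n * (2 + n%:R).

Lemma heat_dt_cst_gt0 : 0 < heat_dt_cst.
Proof. by rewrite mulr_gt0 ?sqrt2n_gt0// ltr_wpDr. Qed.

Lemma heat_dt_bound t x : 0 < t ->
  `|heat_dt t x| <= heat_dt_cst / t * heat_kernel (2 * t) x.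
Proof.
move=> t0; rewrite /heat_dt heat_kernel_double//.
set v := sqn x / (8 * t); set h := heat_kernel _ _.
have v0 : 0 <= v by rewrite divr_ge0 ?sqn_ge0// mulr_ge0// ltW.
have -> : sqn x / (4 * t ^+ 2) = 2 * v / t by rewrite /v; field; rewrite lt0r_neq0.
have -> : sqrt2n * expR (- v) * h * (2 * v / t - n%:R / (2 * t)) =
  sqrt2n / t * h * (expR (- v) * (2 * v - n%:R / 2)).
  by field; rewrite lt0r_neq0.
rewrite normrM ger0_norm; last first.
  by rewrite !mulr_ge0 ?heat_kernel_ge0// ?invr_ge0 ltW// sqrt2n_gt0.
have -> : heat_dt_cst / t * h = sqrt2n / t * h * (2 + n%:R).
  by rewrite /heat_dt_cst; field; rewrite lt0r_neq0.
apply: ler_wpM2l.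
  by rewrite !mulr_ge0 ?heat_kernel_ge0// ?invr_ge0 ltW// sqrt2n_gt0.
have := mul_expRN_le1 v0.
have : expR (- v) <= 1 by rewrite expR_le1 oppr_le0.
have := expR_gt0 (- v); move: (expR _) => e e0 e1 ve.
have n0 : 0 <= n%:R :> R by [].
rewrite ler_norml; apply/andP; split; nra.
Qed.

(** [36 = 8 * 4 + 4]: with [v = sqn x / (8 t)] one has [(2 v - n / 2)^2 <= 8 v^2 + n^2 / 2], where
    [v^2 expR (- v) <= 4], and [4 v expR (- v) <= 4]. *)
Definition heat_dtt_cst : R := sqrt2n * (36 + n%:R ^+ 2 + n%:R).

Lemma heat_dtt_cst_gt0 : 0 < heat_dtt_cst.
Proof. by rewrite mulr_gt0 ?sqrt2n_gt0// !ltr_wpDr// exprn_ge0. Qed.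

Lemma heat_dtt_bound t x : 0 < t ->
  `|heat_dtt t x| <= heat_dtt_cst / t ^+ 2 * heat_kernel (2 * t) x.
Proof.
move=> t0; rewrite /heat_dtt heat_kernel_double//.
set v := sqn x / (8 * t); set h := heat_kernel _ _.
have v0 : 0 <= v by rewrite divr_ge0 ?sqn_ge0// mulr_ge0// ltW.
have sE : sqn x = 8 * t * v by rewrite /v; field; rewrite lt0r_neq0.
have -> : sqrt2n * expR (- v) * h * ((sqn x / (4 * t ^+ 2) - n%:R / (2 * t)) ^+ 2
    - sqn x / (2 * t ^+ 3) + n%:R / (2 * t ^+ 2)) =
  sqrt2n / t ^+ 2 * h * (expR (- v) * ((2 * v - n%:R / 2) ^+ 2 - 4 * v + n%:R / 2)).
  by rewrite sE; field; rewrite lt0r_neq0.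
rewrite normrM ger0_norm; last first.
  by rewrite !mulr_ge0 ?heat_kernel_ge0 ?invr_ge0 ?sqr_ge0// ltW// sqrt2n_gt0.
have -> : heat_dtt_cst / t ^+ 2 * h = sqrt2n / t ^+ 2 * h * (36 + n%:R ^+ 2 + n%:R).
  by rewrite /heat_dtt_cst; field; rewrite lt0r_neq0.
apply: ler_wpM2l.
  by rewrite !mulr_ge0 ?heat_kernel_ge0 ?invr_ge0 ?sqr_ge0// ltW// sqrt2n_gt0.
have := mul_expRN_le1 v0; have := sqr_mul_expRN_le v0.
have : expR (- v) <= 1 by rewrite expR_le1 oppr_le0.
have := expR_gt0 (- v); move: (expR _) => e e0 e1 vve ve.
have n0 : 0 <= n%:R :> R by [].
move: (n%:R) n0 => m m0.
have me : m * e <= m by nra.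
have mme : m ^+ 2 * e <= m ^+ 2 by nra.
have me0 : 0 <= m * e by nra.
have {}e0 := ltW e0; clearbody v.
have vme0 : 0 <= v * m * e by rewrite !mulr_ge0.
have ve0 : 0 <= v * e by apply: mulr_ge0.
have vve0 : 0 <= v ^+ 2 * e by apply: mulr_ge0 => //; exact: sqr_ge0.
have mme0 : 0 <= m ^+ 2 * e by apply: mulr_ge0 => //; exact: sqr_ge0.
(* The two squares add up to [8 v^2 + m^2 / 2], which makes the goal linear in the products at
   hand. *)
have sq : 0 <= (2 * v + m / 2) ^+ 2 * e by apply: mulr_ge0 => //; exact: sqr_ge0.
have sq' : 0 <= (2 * v - m / 2) ^+ 2 * e by apply: mulr_ge0 => //; exact: sqr_ge0.
rewrite ler_norml; apply/andP; split; lra.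
Qed.

Lemma heat_dx_bound i t x : 0 < t ->
  `|heat_dx i t x| <= sqrt2n * 2 / Num.sqrt t * heat_kernel (2 * t) x.
Proof.
move=> t0; rewrite /heat_dx heat_kernel_double//.
set h := heat_kernel _ _.
(* The freed half of the exponent is at least [w ^+ 2], and [|w| expR (- w ^+ 2) <= 1]; the constant
   2 bounds the leftover [Num.sqrt 8 / 2]. *)
pose w := x ord0 i / Num.sqrt (8 * t).
have st0 : 0 < Num.sqrt t by rewrite sqrtr_gt0.
have s8 : 0 < Num.sqrt 8 :> R by rewrite sqrtr_gt0.
have h0 : 0 <= h by exact: heat_kernel_ge0.
have wE : w ^+ 2 <= sqn x / (8 * t).
  rewrite /w expr_div_n sqr_sqrtr ?mulr_ge0 ?(ltW t0)//.
  by rewrite ler_wpM2r ?sqn_coord// invr_ge0 mulr_ge0// ltW.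
have we : `|w| * expR (- (sqn x / (8 * t))) <= 1.
  apply: le_trans (norm_mul_expRN_le1 w).
  by rewrite ler_wpM2l// ler_expR lerN2.
have s84 : Num.sqrt 8 <= 4 :> R.
  by rewrite -(@ler_pXn2r _ 2)// ?nnegrE ?sqrtr_ge0// sqr_sqrtr//; lra.
have tE : t = Num.sqrt t ^+ 2 by rewrite sqr_sqrtr// ltW.
have -> : x ord0 i / (2 * t) = w * (Num.sqrt 8 / (2 * Num.sqrt t)).
  rewrite /w sqrtrM// [in LHS]tE; field; rewrite ?lt0r_neq0//.
rewrite normrM normrN (@ger0_norm _ (sqrt2n * _ * _)); last first.
  by rewrite !mulr_ge0 ?expR_ge0 ?(ltW sqrt2n_gt0).
rewrite normrM (@ger0_norm _ (Num.sqrt 8 / _)); last first.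
  by rewrite divr_ge0 ?mulr_ge0 ?sqrtr_ge0.
clearbody w h.
have -> : sqrt2n * expR (- (sqn x / (8 * t))) * h *
    (`|w| * (Num.sqrt 8 / (2 * Num.sqrt t))) =
  sqrt2n / Num.sqrt t * h * ((`|w| * expR (- (sqn x / (8 * t)))) * (Num.sqrt 8 / 2)).
  by field; rewrite lt0r_neq0.
have -> : sqrt2n * 2 / Num.sqrt t * h = sqrt2n / Num.sqrt t * h * 2.
  by field; rewrite lt0r_neq0.
apply: ler_wpM2l.
  by rewrite !mulr_ge0 ?invr_ge0 ?sqrtr_ge0// (ltW sqrt2n_gt0).
have we0 : 0 <= `|w| * expR (- (sqn x / (8 * t))) by rewrite mulr_ge0// expR_ge0.
nra.
Qed.

Definition far_cst : R := 16 * heat_dt_cst * sqrt2n.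

(** Away from the origin the singular factor [1 / t] costs only [1 / r ^+ 2]: a second doubling of
    the time frees [expR (- (sqn x / (16 t)))], which is at most [16 t / sqn x]. *)
Lemma heat_dt_far r t x : 0 < r -> 0 < t -> r ^+ 2 <= sqn x ->
  `|heat_dt t x| <= far_cst / r ^+ 2 * heat_kernel (4 * t) x.
Proof.
move=> r0 t0 rx; apply: le_trans (heat_dt_bound _ t0) _.
rewrite heat_kernel_double ?mulr_gt0//.
have -> : 2 * (2 * t) = 4 * t by ring.
have -> : 8 * (2 * t) = 16 * t by ring.
rewrite /far_cst; set h := heat_kernel _ _.
set v := sqn x / (16 * t).
have v0 : 0 <= v by rewrite divr_ge0 ?sqn_ge0// mulr_ge0// ltW.
have r2 : 0 < r ^+ 2 by rewrite exprn_gt0.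
have : t^-1 * expR (- v) <= 16 / r ^+ 2.
  rewrite ler_pdivlMr// -mulrA mulrC ler_pdivrMr//.
  apply: (@le_trans _ _ (expR (- v) * (16 * t * v))).
    rewrite ler_wpM2l ?expR_ge0// /v.
    by rewrite [_ * (_ / _)]mulrC divfK// lt0r_neq0// mulr_gt0.
  rewrite mulrCA -mulrA; rewrite [leLHS](_ : _ = 16 * t * (v * expR (- v))); last by ring.
  rewrite -[leRHS]mulr1 ler_wpM2l ?mul_expRN_le1//.
  by rewrite mulr_ge0// ltW.
move=> H.
have -> : heat_dt_cst / t * (sqrt2n * expR (- v) * h) =
   heat_dt_cst * sqrt2n * h * (t^-1 * expR (- v)) by ring.
have -> : 16 * heat_dt_cst * sqrt2n / r ^+ 2 * h =
   heat_dt_cst * sqrt2n * h * (16 / r ^+ 2) by ring.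
apply: ler_wpM2l => //.
by rewrite !mulr_ge0 ?heat_kernel_ge0// ltW ?heat_dt_cst_gt0 ?sqrt2n_gt0.
Qed.

Definition gauss_weight r x : R := expR (- (sqn x / (64 * r ^+ 2))).

(** The freed exponent is at least [|x - y|^2 / (32 r^2)], and [|y - c|^2 <= 2 |x - y|^2 + 2 r^2]
    moves its center from [x] to [c]; hence the 64 in the weight and a loss of [expR (1 / 32)], at
    most 2. *)
Lemma heat_kernel_weight r t x y c : 0 < r -> 0 < t -> t <= 4 * r ^+ 2 ->
  sqn (x - c) <= r ^+ 2 ->
  heat_kernel t (x - y) <=
  2 * sqrt2n * gauss_weight r (y - c) * heat_kernel (2 * t) (x - y).
Proof.
move=> r0 t0 tr xc; rewrite heat_kernel_double// ler_wpM2r ?heat_kernel_ge0//.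
rewrite (mulrC 2) -mulrA ler_wpM2l ?(ltW sqrt2n_gt0)//.
have r2 : 0 < r ^+ 2 by rewrite exprn_gt0.
have yc : sqn (y - c) <= 2 * sqn (x - y) + 2 * r ^+ 2.
  have -> : y - c = (y - x) + (x - c) by rewrite addrA subrK.
  apply: le_trans (sqnD _ _) _.
  by rewrite (sqnB x y) lerD2l ler_wpM2l.
apply: (@le_trans _ _ (expR (1 / 32) * gauss_weight r (y - c))).
  rewrite -expRD ler_expR.
  have -> : 1 / 32 - sqn (y - c) / (64 * r ^+ 2) =
    (2 * r ^+ 2 - sqn (y - c)) / (64 * r ^+ 2) by field; rewrite lt0r_neq0.
  rewrite -mulNr ler_pdivrMr ?mulr_gt0// mulrAC ler_pdivlMr ?mulr_gt0//.
  have := sqn_ge0 (x - y); nra.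
rewrite ler_wpM2r ?expR_ge0//.
have h : expR (1 / 32 : R) * expR (- (1 / 32)) = 1 by rewrite expRN mulfV// gt_eqF ?expR_gt0.
have := expR_ge1Dx (- (1 / 32) : R); have := expR_gt0 (1 / 32 : R).
move: (expR _) (expR _) h => a b; nra.
Qed.

End heat_kernel_bounds.

(** * Gaussian integrals and the semigroup law *)

Section gauss.
Context {R : realType}.
Local Notation mu := (@lebesgue_measure R).

Definition heat1 (t a : R) : R :=
  (Num.sqrt (4 * pi * t))^-1 * expR (- (a ^+ 2 / (4 * t))).

Lemma heat1_normal_pdf t a x : 0 < t ->
  heat1 t (x - a) = normal_pdf a (Num.sqrt (2 * t)) x.
Proof.
move=> t0; rewrite normal_pdfE ?gt_eqF ?sqrtr_gt0 ?mulr_gt0//.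
rewrite /normal_peak /normal_fun sqr_sqrtr ?mulr_ge0 ?(ltW t0)//.
congr ((Num.sqrt _)^-1 * expR _); last by field; rewrite lt0r_neq0.
by ring.
Qed.

Lemma integral_heat1 t a : 0 < t ->
  (\int[mu]_x (heat1 t (x - a))%:E = 1)%E.
Proof.
move=> t0; under eq_integral do rewrite heat1_normal_pdf//.
exact: integral_normal_pdf.
Qed.

Lemma heat1_ge0 (t a : R) : 0 <= heat1 t a.
Proof. by rewrite mulr_ge0// ?expR_ge0// invr_ge0 sqrtr_ge0. Qed.

Lemma measurable_heat1 (t a : R) : measurable_fun setT (fun x : R => heat1 t (x - a)).
Proof.
apply: measurable_funM => //; apply: measurableT_comp => //.
apply: measurableT_comp => //; apply: measurable_funM => //.
by apply: measurable_funX; apply: measurable_funB.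
Qed.

(** Completing the square: as a function of [x], the product of two Gaussians is a Gaussian about
    the weighted mean of their centers. *)
Lemma heat1_mul s t a b x : 0 < s -> 0 < t ->
  heat1 s (x - a) * heat1 t (x - b) =
  heat1 (s + t) (a - b) * heat1 (s * t / (s + t)) (x - (t * a + s * b) / (s + t)).
Proof.
move=> s0 t0; have st0 : 0 < s + t by rewrite addr_gt0.
rewrite /heat1 mulrACA [RHS]mulrACA -!expRD -!invfM -!sqrtrM; last 2 first.
  by rewrite !mulr_ge0 ?pi_ge0// ltW.
  by rewrite !mulr_ge0 ?pi_ge0// ltW.
congr (_^-1 * expR _).
  by congr Num.sqrt; field; rewrite lt0r_neq0.
by field; rewrite ?lt0r_neq0.
Qed.

Lemma integral_heat1_mul s t a b : 0 < s -> 0 < t ->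
  (\int[mu]_x (heat1 s (x - a) * heat1 t (x - b))%:E = (heat1 (s + t) (a - b))%:E)%E.
Proof.
move=> s0 t0; under eq_integral do rewrite heat1_mul// EFinM.
rewrite ge0_integralZl//.
- by rewrite integral_heat1 ?mule1// divr_gt0 ?mulr_gt0 ?addr_gt0.
- apply/(@measurable_EFinP _ (measurableTypeR R)); exact: measurable_heat1.
- by move=> x _; rewrite lee_fin heat1_ge0.
- by rewrite lee_fin heat1_ge0.
Qed.

Context {n : nat}.
Implicit Types (x y z : 'rV[R]_n).

Lemma heat_kernel_prod t x : heat_kernel t x = \prod_i heat1 t (x ord0 i).
Proof.
rewrite heat_kernelE big_split/= prodr_const card_ord -exprVn; congr (_ * _).
by rewrite -expR_sum /sqn mulr_suml -sumrN.
Qed.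

Lemma integral_heat_kernel t y : 0 < t ->
  (\int[lebesgue_rV n]_x (heat_kernel t (x - y))%:E = 1)%E.
Proof.
move=> t0; have := @integral_prod_coord R n (fun i a => heat1 t (a - y ord0 i))
  (fun=> 1) (fun i => measurable_heat1 _ _) (fun i a => heat1_ge0 _ _)
  (fun i => integral_heat1 _ t0).
rewrite big1// => <-; apply: eq_integral => x _; rewrite heat_kernel_prod.
by congr _%:E; apply: eq_bigr => i _; rewrite !mxE.
Qed.

(** The semigroup law; the convolution identities for the derivatives come from it by
    differentiation in time. *)
Lemma integral_heat_kernel_mul s t y z : 0 < s -> 0 < t ->
  (\int[lebesgue_rV n]_x (heat_kernel s (x - y) * heat_kernel t (x - z))%:E =
   (heat_kernel (s + t) (y - z))%:E)%E.
Proof.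
move=> s0 t0; have := @integral_prod_coord R n
  (fun i a => heat1 s (a - y ord0 i) * heat1 t (a - z ord0 i))
  (fun i => heat1 (s + t) (y ord0 i - z ord0 i))
  (fun i => measurable_funM (measurable_heat1 _ _) (measurable_heat1 _ _))
  (fun i a => mulr_ge0 (heat1_ge0 _ _) (heat1_ge0 _ _))
  (fun i => integral_heat1_mul _ _ s0 t0).
have -> : heat_kernel (s + t) (y - z) =
    \prod_(i < n) heat1 (s + t) (y ord0 i - z ord0 i).
  by rewrite heat_kernel_prod; apply: eq_bigr => i _; rewrite !mxE.
move=> <-; apply: eq_integral => x _; rewrite !heat_kernel_prod -big_split/=.
by congr _%:E; apply: eq_bigr => i _; rewrite !mxE.
Qed.

End gauss.

(** * Time derivatives of the heat kernel *)

Section heat_kernel_derivatives.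
Context {R : realType}.

Lemma is_derive_inv (f : R -> R) (t df : R) : f t != 0 ->
  is_derive t 1 f df -> is_derive t 1 (fun s => (f s)^-1) (- (f t) ^- 2 * df).
Proof. by move=> f0 fd; exact: (is_deriveV f0 fd). Qed.

Lemma is_derive_exp (f : R -> R) (k : nat) (t df : R) :
  is_derive t 1 f df -> is_derive t 1 (fun s => f s ^+ k) (k%:R * f t ^+ k.-1 * df).
Proof.
move=> fd; have := is_deriveX k fd.
rewrite (_ : f ^+ k = (fun s => f s ^+ k))//.
by apply/funext => s; rewrite exprfctE.
Qed.

Lemma is_derive_scaled (c t : R) : is_derive t 1 (fun s => c * s) c.
Proof.
have -> : (fun s => c * s) = c \*: (id : R -> R) by [].
by apply: (is_derive_eq (is_deriveZ _ _)); rewrite /GRing.scale/= mulr1.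
Qed.

Lemma is_derive_expR_inv (c e t : R) : t != 0 -> c != 0 ->
  is_derive t 1 (fun s => expR (- (e / (c * s)))) (expR (- (e / (c * t))) * (e / (c * t ^+ 2))).
Proof.
move=> t0 c0.
have ct0 : c * t != 0 by rewrite mulf_neq0.
have H1 : is_derive t 1 (fun s => (c * s)^-1) (- (c * t) ^- 2 *: c).
  exact: (is_deriveV ct0 (is_derive_scaled c t)).
have H2 : is_derive t 1 (fun s => - (e / (c * s))) (e / (c * t ^+ 2)).
  have -> : (fun s => - (e / (c * s))) = - (e \*: (fun s => (c * s)^-1)) by [].
  apply: (is_derive_eq (is_deriveN (is_deriveZ e H1))).
  by rewrite /GRing.scale/=; field; rewrite t0 c0.
exact: (is_derive1_comp (is_derive_expR _) H2).
Qed.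

Lemma is_derive_sqrt_expN (n : nat) (c t : R) : 0 < t -> 0 < c ->
  is_derive t 1 (fun s => Num.sqrt (c * s) ^- n)
    (- (n%:R / (2 * t)) * Num.sqrt (c * t) ^- n).
Proof.
move=> t0 c0; have ct0 : 0 < c * t by rewrite mulr_gt0.
have s0 : Num.sqrt (c * t) != 0 by rewrite gt_eqF ?sqrtr_gt0.
have H1 : is_derive t 1 (fun s => Num.sqrt (c * s)) ((2 * Num.sqrt (c * t))^-1 * c).
  exact: (is_derive1_comp (is_derive1_sqrt ct0) (is_derive_scaled c t)).
have H3 : Num.sqrt (c * t) ^+ n != 0 by rewrite expf_neq0.
apply: (is_derive_eq (@is_derive_inv (fun s => Num.sqrt (c * s) ^+ n) _ _ H3
  (is_derive_exp n H1))).
(* Eliminating [c] leaves a rational identity in the root, within reach of [field]. *)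
have : c = Num.sqrt (c * t) ^+ 2 / t.
  by rewrite sqr_sqrtr ?(ltW ct0)// mulfK// gt_eqF.
move: (Num.sqrt _) s0 H3 => r r0 _ ->; clear - t0 r0.
case: n => [|n]; first by rewrite !(mul0r, mulr0, oppr0).
have := expf_neq0 n r0; rewrite succnK (exprS r n); move: (r ^+ n) (n.+1%:R) => a m a0.
by field; rewrite r0 a0 gt_eqF.
Qed.

Lemma is_derive_sub (f g : R -> R) (t df dg : R) :
  is_derive t 1 f df -> is_derive t 1 g dg ->
  is_derive t 1 (fun s => f s - g s) (df - dg).
Proof. by move=> H1 H2; exact: (is_deriveB H1 H2). Qed.

Lemma is_derive_mul (f g : R -> R) (t df dg : R) :
  is_derive t 1 f df -> is_derive t 1 g dg ->
  is_derive t 1 (fun s => f s * g s) (f t * dg + df * g t).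
Proof.
move=> H1 H2; have := is_deriveM H1 H2.
by move=> /is_derive_eq; apply; rewrite /GRing.scale/= [_ * df]mulrC.
Qed.

Context {n : nat}.
Implicit Types (x y z : 'rV[R]_n).

Lemma is_derive_heat_kernel (t : R) x : 0 < t ->
  is_derive t 1 (fun s => heat_kernel s x) (heat_dt t x).
Proof.
move=> t0.
have c0 : 0 < 4 * pi :> R by rewrite mulr_gt0// pi_gt0.
have c4 : 4 != 0 :> R by [].
have := is_derive_mul (is_derive_sqrt_expN n t0 c0)
  (is_derive_expR_inv (sqn x) (lt0r_neq0 t0) c4).
rewrite (_ : (fun s => _) = (fun s => heat_kernel s x)); last first.
  by apply/funext => s; rewrite heat_kernelE.
by move=> /is_derive_eq; apply; rewrite /heat_dt heat_kernelE; ring.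
Qed.

Lemma is_derive_divr_exp (k : nat) (c e t : R) : t != 0 ->
  is_derive t 1 (fun s => e / (c * s ^+ k)) (- (k%:R * e / (c * t ^+ k.+1))).
Proof.
move=> t0.
have [->|c0] := eqVneq c 0.
  rewrite !mul0r invr0 mulr0 oppr0.
  rewrite (_ : (fun s => _) = cst 0); first exact: is_derive_cst.
  by apply/funext => s; rewrite mul0r invr0 mulr0.
have tk : t ^+ k != 0 by rewrite expf_neq0.
have := is_deriveZ (e / c) (@is_derive_inv (fun s => s ^+ k) _ _ tk
  (@is_derive_exp id k _ _ (is_derive_id t 1))).
rewrite (_ : _ \*: _ = (fun s => e / (c * s ^+ k))); last first.
  by apply/funext => s; rewrite /= /GRing.scale/= invfM mulrA.
move=> /is_derive_eq; apply; rewrite /GRing.scale/=.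
clear - t0 c0; case: k => [|k]; first by rewrite !(mul0r, mulr0, oppr0).
have := expf_neq0 k t0; rewrite succnK (exprS t k.+1) (exprS t k); move: (t ^+ k) (k.+1%:R) => a m a0.
by field; rewrite c0 t0 a0.
Qed.

Lemma is_derive_heat_dt (t : R) x : 0 < t ->
  is_derive t 1 (fun s => heat_dt s x) (heat_dtt t x).
Proof.
move=> t0; have tn0 := lt0r_neq0 t0.
have H1 := is_derive_divr_exp 2 4 (sqn x) tn0.
have H2 := is_derive_divr_exp 1 2 n%:R tn0.
have := is_derive_mul (is_derive_heat_kernel x t0) (is_derive_sub H1 H2).
move=> /is_derive_eq; apply; rewrite /heat_dtt /heat_dt.
by field.
Qed.

End heat_kernel_derivatives.

(** * Differentiation of the heat semigroup under the integral sign *)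

Section differentiation_heat.
Context {R : realType} {n : nat}.
Implicit Types (x y z : 'rV[R]_n) (h : 'rV[R]_n -> R).
Local Notation lam := (@lebesgue_rV R n).

(** A growth class on which [heat t] acts for all [t > 0]: a later time needs a smaller [c], so
    every [c] is included. It contains the functions [f^~ s] for almost every [s], which need not be
    integrable. *)
Definition gauss_integrable h := measurable_fun setT h /\
  forall c : R, 0 < c ->
    (\int[lam]_y (expR (- (c * sqn y)) * `|h y|)%:E < +oo)%E.

(** A single Gaussian centered at 0 dominates the kernels of all times in [[a, b]], as
    differentiation under the integral requires. *)
Lemma heat_kernel_gauss (a u b : R) x y : 0 < a -> a <= u -> u <= b ->
  heat_kernel u (x - y) <= Num.sqrt (4 * pi * a) ^- n *
    expR (sqn x / (4 * b)) * expR (- ((8 * b)^-1 * sqn y)).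
Proof.
move=> a0 au ub; have u0 := lt_le_trans a0 au; have b0 := lt_le_trans u0 ub.
rewrite heat_kernelE -[leRHS]mulrA; apply: ler_pM.
- by rewrite invr_ge0 exprn_ge0.
- exact: expR_ge0.
- have sa : 0 < Num.sqrt (4 * pi * a) by rewrite sqrtr_gt0 !mulr_gt0 ?pi_gt0.
  have su : 0 < Num.sqrt (4 * pi * u) by rewrite sqrtr_gt0 !mulr_gt0 ?pi_gt0.
  rewrite lef_pV2 ?posrE ?exprn_gt0// lerXn2r ?nnegrE ?sqrtr_ge0//.
  by rewrite ler_wsqrtr// ler_wpM2l// mulr_ge0 ?pi_ge0.
rewrite -expRD ler_expR.
have yx : sqn y <= 2 * sqn (x - y) + 2 * sqn x.
  by have := sqnD (y - x) x; rewrite subrK sqnB.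
apply: (@le_trans _ _ (- (sqn (x - y) / (4 * b)))).
  by rewrite lerN2 ler_wpM2l ?sqn_ge0// lef_pV2 ?posrE ?mulr_gt0// ler_wpM2l.
have -> : sqn x / (4 * b) - (8 * b)^-1 * sqn y = (2 * sqn x - sqn y) / (8 * b).
  by field; rewrite gt_eqF.
rewrite -mulNr (_ : - sqn (x - y) / (4 * b) = (- 2 * sqn (x - y)) / (8 * b)); last first.
  by field; rewrite gt_eqF.
by rewrite ler_wpM2r ?invr_ge0 ?mulr_ge0 ?(ltW b0)//; lra.
Qed.

Lemma measurable_shift_rV x : measurable_fun setT (fun y : 'rV[R]_n => x - y).
Proof.
apply: measurable_fun_rVP => i; under eq_fun do rewrite !mxE.
by apply: measurable_funB => //; exact: measurable_coord.
Qed.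

Lemma measurable_expR_sqn (c : R) :
  measurable_fun setT (fun y : 'rV[R]_n => expR (- (c * sqn y))).
Proof.
apply: measurableT_comp => //; apply: measurableT_comp => //.
by apply: measurable_funM => //; exact: measurable_sqn.
Qed.

Lemma integrable_gauss_norm h (c C : R) : gauss_integrable h -> 0 < c ->
  lam.-integrable setT (EFin \o (fun y => C * expR (- (c * sqn y)) * `|h y|)).
Proof.
move=> [mh hoo] c0; rewrite (_ : EFin \o _ =
    (fun y => C%:E * (expR (- (c * sqn y)) * `|h y|)%:E)%E); last first.
  by apply/funext => y; rewrite -EFinM mulrA.
apply: integrableZl => //; apply/integrableP; split.
  apply/measurable_EFinP; apply: measurable_funM; last exact: measurableT_comp.
  exact: measurable_expR_sqn.
by under eq_integral do rewrite gee0_abs ?lee_fin ?mulr_ge0 ?expR_ge0 ?hoo//; exact: hoo.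
Qed.

Lemma integrable_gauss h (g : 'rV[R]_n -> R) (c C : R) :
  gauss_integrable h -> 0 < c -> measurable_fun setT g ->
  (forall y, `|g y| <= C * expR (- (c * sqn y))) ->
  lam.-integrable setT (EFin \o (fun y => g y * h y)).
Proof.
move=> gh c0 mg gC.
apply: le_integrable (integrable_gauss_norm C gh c0) => //.
- by apply/measurable_EFinP; apply: measurable_funM => //; case: gh.
- move=> y _; rewrite /= lee_fin (le_trans _ (ler_norm _))//.
  by rewrite normrM ler_wpM2r.
Qed.

Lemma integrable_heat_kernel_mul h t x : gauss_integrable h -> 0 < t ->
  lam.-integrable setT (EFin \o (fun y => heat_kernel t (x - y) * h y)).
Proof.
move=> gh t0; apply: (integrable_gauss gh (c := (8 * t)^-1)
  (C := Num.sqrt (4 * pi * t) ^- n * expR (sqn x / (4 * t)))).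
- by rewrite invr_gt0 mulr_gt0.
- by apply: measurable_heat_kernel => //; exact: measurable_shift_rV.
- move=> y; rewrite ger0_norm ?heat_kernel_ge0//.
  exact: heat_kernel_gauss.
Qed.

Lemma is_derive_heat h (t : R) x : gauss_integrable h -> 0 < t ->
  is_derive t 1 (fun u : R => heat u h x) (\int[lam]_y (heat_dt t (x - y) * h y)).
Proof.
move=> gh t0; have [mh hoo] := gh.
pose f := fun (u : R) y => heat_kernel u (x - y) * h y.
have df (u : R) y : 0 < u -> is_derive u 1 (f ^~ y) (heat_dt u (x - y) * h y).
  move=> u0; rewrite /f.
  have -> : (fun u => heat_kernel u (x - y) * h y) =
      h y \*: (fun u => heat_kernel u (x - y)).
    by apply/funext => u' /=; rewrite /GRing.scale/= mulrC.
  apply: (is_derive_eq (is_deriveZ _ (is_derive_heat_kernel (x - y) u0))).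
  by rewrite /GRing.scale/= mulrC.
(* For [u] in the window, [heat_dt_bound] brings in the kernel at time [2 u], which lies between [t]
   and [4 t]. *)
pose c := (8 * (4 * t))^-1.
pose C := heat_dt_cst (n := n) / (t / 2) *
  (Num.sqrt (4 * pi * t) ^- n * expR (sqn x / (4 * (4 * t)))).
pose G := fun y => C * expR (- (c * sqn y)) * `|h y|.
have I0 (u : R) : `]t / 2, (2 * t)[%classic u -> [/\ 0 < u, t / 2 <= u & u <= 2 * t].
  rewrite /= in_itv/= => /andP[tu ut]; split; try exact: ltW.
  by apply: le_lt_trans tu; rewrite divr_ge0// ltW.
have It : `]t / 2, (2 * t)[%classic t.
  by rewrite /= in_itv/=; apply/andP; split; lra.
have C0 : 0 <= C.
  apply: mulr_ge0.
    by apply: divr_ge0; [exact/ltW/heat_dt_cst_gt0|exact: divr_ge0 (ltW t0) _].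
  by apply: mulr_ge0; rewrite ?expR_ge0// invr_ge0 exprn_ge0 ?sqrtr_ge0.
have intf (u : R) : `]t / 2, (2 * t)[%classic u -> lam.-integrable setT (EFin \o f u).
  by move=> /I0[u0 _ _]; exact: integrable_heat_kernel_mul.
have G0 y : 0 <= G y.
  by apply: mulr_ge0 => //; apply: mulr_ge0 => //; exact: expR_ge0.
have derf (u : R) y : `]t / 2, (2 * t)[%classic u -> setT y -> derivable (f ^~ y) u 1.
  by move=> /I0[u0 _ _] _; exact: (@ex_derive _ _ _ _ _ _ _ (df u y u0)).
have intG : lam.-integrable setT (EFin \o G).
  by apply: integrable_gauss_norm => //; rewrite invr_gt0 !mulr_gt0.
have dfE u y : 0 < u -> partial1of2 f u y = heat_dt u (x - y) * h y.
  by move=> u0; rewrite partial1of2E; exact: (@derive_val _ _ _ _ _ _ _ (df u y u0)).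
have G_ub (u : R) y : `]t / 2, (2 * t)[%classic u -> setT y -> `|partial1of2 f u y| <= G y.
  move=> /I0[u0 tu ut] _; rewrite dfE// normrM ler_wpM2r//.
  apply: (le_trans (heat_dt_bound _ u0)); rewrite /C -[leRHS]mulrA; apply: ler_pM.
  - exact: (divr_ge0 (ltW heat_dt_cst_gt0) (ltW u0)).
  - exact: heat_kernel_ge0.
  - by rewrite ler_wpM2l ?(ltW heat_dt_cst_gt0)// lef_pV2 ?posrE// divr_gt0.
  - by apply: heat_kernel_gauss => //; lra.
apply: DeriveDef.
  exact: (derivable_under_integral measurableT It intf derf G0 intG G_ub).
rewrite -derive1E (differentiation_under_integral measurableT It intf derf G0 intG G_ub).
by apply: eq_Rintegral => y _; rewrite dfE.
Qed.

Lemma sqn_shift z i (a : R) :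
  sqn (z + a *: delta_mx ord0 i) = sqn z + 2 * z ord0 i * a + a ^+ 2.
Proof.
rewrite /sqn (bigD1 i)//= [in RHS](bigD1 i)//= !mxE !eqxx mulr1.
rewrite (eq_bigr (fun j => z ord0 j ^+ 2)); last first.
  by move=> j ji; rewrite !mxE eqxx (negPf ji) mulr0 addr0.
ring.
Qed.

Lemma is_derive_heat_shift t x i (a : R) : 0 < t -> 
  is_derive a 1 (fun b : R => heat_kernel t (x + b *: delta_mx ord0 i))
    (heat_dx i t (x + a *: delta_mx ord0 i)).
Proof.
move=> t0.
have H1 : is_derive a 1 (fun b : R => - (4 * t)^-1 * (b ^+ 2) - (4 * t)^-1 * (sqn x + 2 * x ord0 i * b))
   (- ((2 * t)^-1 * (x ord0 i + a))).
  have H2 := is_deriveZ (- (4 * t)^-1) (is_derive_exp 2 (is_derive_id a 1)).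
  have H3 := is_deriveZ (4 * t)^-1 (is_deriveD (is_derive_cst (sqn x) a 1)
    (is_derive_scaled (2 * x ord0 i) a)).
  apply: (is_derive_eq (is_derive_sub H2 H3)); rewrite /GRing.scale/= add0r.
  by field; rewrite gt_eqF.
have := is_deriveZ (Num.sqrt (4 * pi * t) ^- n) (is_derive1_comp (is_derive_expR _) H1).
rewrite (_ : _ \*: _ = (fun b => heat_kernel t (x + b *: delta_mx ord0 i))); last first.
  apply/funext => b; rewrite heat_kernelE sqn_shift /= /GRing.scale/=.
  by congr (_ * expR _); field; rewrite gt_eqF.
move=> /is_derive_eq; apply; rewrite /heat_dx heat_kernelE /= /GRing.scale/=.
rewrite sqn_shift !mxE !eqxx mulr1.
have -> : - (4 * t)^-1 * a ^+ 2 - (4 * t)^-1 * (sqn x + 2 * x ord0 i * a) =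
  - ((sqn x + 2 * x ord0 i * a + a ^+ 2) / (4 * t)) by field; rewrite gt_eqF.
by move: (_ ^- n) => K; field; rewrite gt_eqF.
Qed.

Lemma derive_heat h t x i : gauss_integrable h -> 0 < t ->
  'D_(delta_mx ord0 i) (heat t h) x = \int[lam]_y (heat_dx i t (x - y) * h y).
Proof.
move=> gh t0; have [mh hoo] := gh.
pose e : 'rV[R]_n := delta_mx ord0 i.
pose f := fun (b : R) y => heat_kernel t (x - y + b *: e) * h y.
have st0 : 0 < Num.sqrt t by rewrite sqrtr_gt0.
have df (b : R) y : is_derive b 1 (f ^~ y) (heat_dx i t (x - y + b *: e) * h y).
  rewrite /f.
  have -> : (fun b => heat_kernel t (x - y + b *: e) * h y) =
      h y \*: (fun b => heat_kernel t (x - y + b *: e)).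
    by apply/funext => u' /=; rewrite /GRing.scale/= mulrC.
  apply: (is_derive_eq (is_deriveZ _ (is_derive_heat_shift (x - y) i b t0))).
  by rewrite /GRing.scale/= mulrC.
have shiftE b y : x - y + b *: e = x + b *: e - y by rewrite addrAC.
pose c := (8 * (2 * t))^-1.
(* Uniformity in [b] keeps the dominating Gaussian independent of the increment. *)
have sxb (b : R) : `]-1, 1[%classic b -> sqn (x + b *: e) <= 2 * sqn x + 2.
  rewrite /= in_itv/= => /andP[b1 b2]; apply: (le_trans (sqnD _ _)).
  rewrite lerD2l -[leRHS]mulr1 ler_wpM2l//.
  rewrite -[b *: e]add0r sqn_shift mxE mulr0 mul0r addr0.
  rewrite /sqn big1 ?add0r; first by nra.
  by move=> j _; rewrite mxE expr0n.
pose C := sqrt2n (n := n) * 2 / Num.sqrt t *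
  (Num.sqrt (4 * pi * (2 * t)) ^- n * expR ((2 * sqn x + 2) / (4 * (2 * t)))).
pose G := fun y => C * expR (- (c * sqn y)) * `|h y|.
have I0 : `]-1, 1[%classic (0 : R) by rewrite /= in_itv/= ltrN10 ltr01.
have C0 : 0 <= C.
  apply: mulr_ge0.
    by apply: divr_ge0; [apply: mulr_ge0 => //; exact/ltW/sqrt2n_gt0|exact: ltW].
  by apply: mulr_ge0; rewrite ?expR_ge0// invr_ge0 exprn_ge0 ?sqrtr_ge0.
have intf (b : R) : `]-1, 1[%classic b -> lam.-integrable setT (EFin \o f b).
  move=> _; rewrite (_ : f b = (fun y => heat_kernel t (x + b *: e - y) * h y)).
    exact: integrable_heat_kernel_mul.
  by apply/funext => y; rewrite /f shiftE.
have G0 y : 0 <= G y.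
  by apply: mulr_ge0 => //; apply: mulr_ge0 => //; exact: expR_ge0.
have derf (b : R) y : `]-1, 1[%classic b -> setT y -> derivable (f ^~ y) b 1.
  by move=> _ _; exact: (@ex_derive _ _ _ _ _ _ _ (df b y)).
have intG : lam.-integrable setT (EFin \o G).
  by apply: integrable_gauss_norm => //; rewrite invr_gt0 !mulr_gt0.
have dfE (b : R) y : partial1of2 f b y = heat_dx i t (x - y + b *: e) * h y.
  by rewrite partial1of2E; exact: (@derive_val _ _ _ _ _ _ _ (df b y)).
have G_ub (b : R) y : `]-1, 1[%classic b -> setT y -> `|partial1of2 f b y| <= G y.
  move=> Ib _; rewrite dfE// normrM ler_wpM2r//.
  apply: (le_trans (heat_dx_bound _ _ t0)); rewrite /C -[leRHS]mulrA.
  apply: ler_wpM2l.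
    by apply: divr_ge0; [apply: mulr_ge0 => //; exact/ltW/sqrt2n_gt0|exact: ltW].
  have t20 : 0 < 2 * t by rewrite mulr_gt0.
  rewrite shiftE; apply: (le_trans (heat_kernel_gauss _ _ t20 (lexx _) (lexx _))).
  apply: ler_wpM2r; first exact: expR_ge0.
  apply: ler_wpM2l; first by rewrite invr_ge0 exprn_ge0 ?sqrtr_ge0.
  by rewrite ler_expR ler_wpM2r ?sxb// invr_ge0 !mulr_ge0// ltW.
have := cvg_differentiation_under_integral measurableT I0 intf derf G0 intG G_ub.
rewrite (_ : (\int[lam]_y (partial1of2 f 0 y)) =
    \int[lam]_y (heat_dx i t (x - y) * h y)); last first.
  by apply: eq_Rintegral => y _; rewrite dfE scale0r addr0.
pose F (b : R) := \int[lam]_y f b y.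
have FE b : F b = heat t h (x + b *: e).
  by apply: eq_Rintegral => y _; rewrite /f shiftE.
rewrite -/(F 0) (_ : (fun b : R => _) = (fun b : R => b^-1 *: (F (b + 0) - F 0)))//.
move=> H; rewrite /derive (_ : (fun b : R => _) =
    (fun b : R => b^-1 *: (F (b + 0) - F 0))); last first.
  apply/funext => b; rewrite /comp /shift /= !FE addr0 scale0r addr0.
  by rewrite [x + _]addrC.
exact: (cvg_lim _ H).
Qed.

End differentiation_heat.

(** * Integration tools *)

Section integral_tools.
Context d (T : measurableType d) (R : realType) (mu : {measure set T -> \bar R}).
Local Open Scope ereal_scope.
Import HBNNSimple.

(** The integral of a nonnegative function is a supremum over the simple functions below it, so
    monotonicity holds without measurability. This serves integrands such as [T_heat_sqnorm]. *)
Lemma ge0_le_integral_nomeas (D : set T) (f g : T -> \bar R) :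
  (forall x, D x -> 0 <= f x) -> (forall x, D x -> f x <= g x) ->
  \int[mu]_(x in D) f x <= \int[mu]_(x in D) g x.
Proof.
move=> f0 fg; have g0 x : D x -> 0 <= g x by move=> Dx; rewrite (le_trans (f0 _ Dx)) ?fg.
rewrite !ge0_integralE//; apply: le_ereal_sup => _ /= [h hf <-]; exists h => // x.
apply: le_trans (hf x) _.
by rewrite /patch; case: ifPn => // /set_mem Dx; exact: fg.
Qed.

(** A simple function below [f], once set to 0 on [N], lies below [g] and keeps its integral. *)
Lemma ge0_integral_null_le (N : set T) (f g : T -> \bar R) :
  measurable N -> mu N = 0 ->
  (forall x, 0 <= f x) -> (forall x, 0 <= g x) -> (forall x, ~ N x -> f x <= g x) ->
  \int[mu]_x f x <= \int[mu]_x g x.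
Proof.
move=> mN N0 f0 g0 fg.
rewrite !ge0_integralTE//; apply: ge_ereal_sup => _ /= [h hf <-].
have mNC : measurable (~` N) by exact: measurableC.
pose h' : {nnsfun T >-> R} := proj_nnsfun h mNC.
have h'E x : (h' x = if x \in N then 0 else h x)%R.
  rewrite /h' /= /mindic indicE in_setC; case: (x \in N) => /=.
    by rewrite mulr0.
  by rewrite mulr1.
apply: (@le_trans _ _ (sintegral mu h')); last first.
  apply: ereal_sup_ubound; exists h' => // x; rewrite h'E; case: ifPn => [_//|xN].
  apply: le_trans (hf x) _; apply: fg => Nx.
  by move/negP: xN; apply; exact/mem_set.
rewrite -!integralT_nnsfun.
have mh : measurable_fun setT (EFin \o h) by apply/measurable_EFinP.
have mh' : measurable_fun setT (EFin \o h') by apply/measurable_EFinP.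
rewrite (@ge0_ae_eq_integral _ _ _ mu setT (EFin \o h) (EFin \o h'))//.
- by move=> x _; rewrite lee_fin.
- by move=> x _; rewrite lee_fin.
- exists N; split => // x; apply: contra_notP => Nx _; rewrite /comp h'E.
  by case: ifPn => // /set_mem.
Qed.

(** With no measurability required, derivatives of [heat] may be replaced by kernel integrals at
    almost every time. *)
Lemma integral_null_eq (D N : set T) (f g : T -> \bar R) :
  measurable N -> mu N = 0 ->
  (forall x, D x -> ~ N x -> f x = g x) ->
  \int[mu]_(x in D) f x = \int[mu]_(x in D) g x.
Proof.
move=> mN N0 fg.
have H f1 g1 : (forall x, ~ N x -> f1 x = g1 x) -> \int[mu]_x f1 x = \int[mu]_x g1 x.
  move=> H; rewrite [LHS]integralE [RHS]integralE; congr (_ - _).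
  - apply/eqP; rewrite eq_le !(ge0_integral_null_le mN N0)//.
      by move=> x Nx; rewrite !(funeposE, funenegE) H.
      by move=> x Nx; rewrite !(funeposE, funenegE) H.
  - apply/eqP; rewrite eq_le !(ge0_integral_null_le mN N0)//.
      by move=> x Nx; rewrite !(funeposE, funenegE) H.
      by move=> x Nx; rewrite !(funeposE, funenegE) H.
rewrite integral_mkcond [RHS]integral_mkcond; apply: H => x Nx.
by rewrite /patch; case: ifPn => // /set_mem Dx; exact: fg.
Qed.

Lemma Rintegral_null_eq (D N : set T) (f g : T -> R) :
  measurable N -> mu N = 0 ->
  (forall x, D x -> ~ N x -> f x = g x) ->
  (\int[mu]_(x in D) f x = \int[mu]_(x in D) g x)%R.
Proof.
move=> mN N0 fg; congr fine; apply: (integral_null_eq mN N0) => x Dx Nx.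
by rewrite fg.
Qed.

(** Integrate [2 g <= c + g^2 / c] against [k] and optimize in [c > 0]; infinite integrals are
    thereby allowed. *)
Lemma ge0_cauchy_schwarz (k g : T -> R) (a : R) :
  measurable_fun setT k -> measurable_fun setT g ->
  (forall x, 0 <= k x)%R -> (forall x, 0 <= g x)%R -> (0 < a)%R ->
  \int[mu]_x (k x)%:E <= a%:E ->
  (\int[mu]_x (k x * g x)%:E) ^+ 2 <= a%:E * \int[mu]_x (k x * g x ^+ 2)%:E.
Proof.
move=> mk mg k0 g0 a0 ka.
set B := \int[mu]_x (k x * g x ^+ 2)%:E; set I := \int[mu]_x (k x * g x)%:E.
have B0 : 0 <= B by apply: integral_ge0 => x _; rewrite lee_fin mulr_ge0// sqr_ge0.
have I0 : 0 <= I by apply: integral_ge0 => x _; rewrite lee_fin mulr_ge0.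
have mkg2 : measurable_fun setT (fun x => (k x * g x ^+ 2)%R).
  by apply: measurable_funM => //; exact: measurable_funX.
have H (c : R) : (0 < c)%R -> (2%:E * I) <= c%:E * a%:E + (c^-1)%:E * B.
  move=> c0; rewrite -ge0_integralZl//; last 2 first.
    by apply/measurable_EFinP; exact: measurable_funM.
    by move=> x _; rewrite lee_fin mulr_ge0.
  apply: (@le_trans _ _ (\int[mu]_x (c%:E * (k x)%:E + (c^-1)%:E * (k x * g x ^+ 2)%:E))).
    apply: ge0_le_integral_nomeas => x _; rewrite -!EFinM ?lee_fin ?mulr_ge0//.
    rewrite -subr_ge0 (_ : _ - _ = k x * c^-1 * (c - g x) ^+ 2)%R; last first.
      by field; rewrite gt_eqF.
    by rewrite mulr_ge0 ?sqr_ge0 ?mulr_ge0 ?invr_ge0 ?(ltW c0).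
  rewrite ge0_integralD//; last 4 first.
    by move=> x _; rewrite -EFinM lee_fin mulr_ge0 ?(ltW c0).
    by apply: measurable_funeM; exact/measurable_EFinP.
    by move=> x _; rewrite -EFinM lee_fin mulr_ge0 ?invr_ge0 ?(ltW c0)// mulr_ge0 ?sqr_ge0.
    by apply: measurable_funeM; exact/measurable_EFinP.
  rewrite ge0_integralZl//; last 3 first.
    exact/measurable_EFinP.
    by move=> x _; rewrite lee_fin.
    by rewrite lee_fin ltW.
  rewrite ge0_integralZl//; last 3 first.
    exact/measurable_EFinP.
    by move=> x _; rewrite lee_fin mulr_ge0// sqr_ge0.
    by rewrite lee_fin invr_ge0 ltW.
  by rewrite leeD2r// lee_wpmul2l// lee_fin ltW.
have [->|Boo] := eqVneq B +oo; first by rewrite gt0_muley ?lte_fin// leey.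
have Bfin : B \is a fin_num by rewrite ge0_fin_numE// lt_neqAle Boo leey.
have Ifin : I \is a fin_num.
  rewrite ge0_fin_numE//; have := H 1%R ltr01; rewrite mul1e invr1 mul1e => H1.
  have : 2%:E * I < +oo by rewrite (le_lt_trans H1)// -(fineK Bfin) -EFinD ltry.
  by case: (I) I0 => [r _ _| |]//; rewrite ?ltry// gt0_muley ?lte_fin.
rewrite -(fineK Bfin) -(fineK Ifin) in H *; move: H; set b := fine B; set i := fine I.
move=> {}H; have i0 : (0 <= i)%R by rewrite fine_ge0.
rewrite -EFin_expe -EFinM lee_fin.
move: i0; rewrite le_eqVlt => /predU1P[<-|i0].
  by rewrite expr0n/= mulr_ge0 ?(ltW a0)// fine_ge0.
(* This [c] makes the first term [c a] equal to [i], half of the left-hand side. *)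
have := H (i / a)%R (divr_gt0 i0 a0).
rewrite -!EFinM -EFinD lee_fin invf_div divfK ?gt_eqF// => h.
have : (i <= a * b / i)%R by rewrite (_ : _ / i = a / i * b)%R; [lra|ring].
by rewrite ler_pdivlMr.
Qed.

End integral_tools.

(** * Improper integrals in one variable *)

Section one_dimensional_integrals.
Context {R : realType}.
Local Notation mu := (@lebesgue_measure R).

Lemma derivable_cvg_within (F : R -> R) (x : R) : derivable F x 1 ->
  F @ x --> F x.
Proof. by move=> /derivable1_diffP/differentiable_continuous. Qed.

(** Monotone convergence along compact intervals exhausting [D]: bounding the increments of the
    antiderivative replaces the computation of its limits at the ends. *)
Lemma integral_ub_FTC (f F : R -> R) (D : set R) (u v : nat -> R) (M : R) :
  (forall i, u i < v i) ->
  nondecreasing_seq (fun i => `[u i, v i]%classic) ->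
  D = \bigcup_i `[u i, v i]%classic ->
  (forall x, D x -> 0 <= f x) ->
  (forall x, D x -> is_derive x 1 F (f x)) ->
  (forall x, D x -> {for x, continuous f}) ->
  (forall x y, D x -> D y -> F y - F x <= M) ->
  (\int[mu]_(x in D) (f x)%:E <= M%:E)%E.
Proof.
move=> uv nd DE f0 dF cf FM.
have sub i x : `[u i, v i]%classic x -> D x by rewrite DE => ?; exists i.
have Du i : D (u i) by apply: (sub i); rewrite /= in_itv/= lexx ltW.
have Dv i : D (v i) by apply: (sub i); rewrite /= in_itv/= lexx ltW.
have mf i : measurable_fun `[u i, v i]%classic (EFin \o f).
  apply/measurable_EFinP; apply: subspace_continuous_measurable_fun => //.
  by apply: continuous_in_subspaceT => x /set_mem /sub; exact: cf.
have f0' i x : `[u i, v i]%classic x -> (0 <= (EFin \o f) x)%E.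
  by move=> /sub Dx; rewrite lee_fin f0.
have cvgI := ge0_nondecreasing_set_cvg_integral (mu := mu) nd
  (fun i => measurable_itv _) mf f0'.
rewrite DE -(cvg_lim _ cvgI)//; apply: lime_le.
  by apply/cvg_ex; eexists; exact: cvgI.
apply: nearW => i.
rewrite (@continuous_FTC2 _ f F _ _ (uv i)).
- by rewrite -EFinB lee_fin FM.
- by apply: continuous_in_subspaceT => x /set_mem /sub; exact: cf.
- split.
  + by move=> x /subset_itv_oo_cc /sub /dF /@ex_derive.
  + by apply: cvg_at_right_filter; apply: derivable_cvg_within; have /@ex_derive := dF _ (Du i).
  + by apply: cvg_at_left_filter; apply: derivable_cvg_within; have /@ex_derive := dF _ (Dv i).
- by move=> x /subset_itv_oo_cc /sub /dF /@derive_val; rewrite derive1E.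
Qed.

Lemma integral_ub_FTCy (f F : R -> R) (a M : R) :
  (forall x, a < x -> 0 <= f x) ->
  (forall x, a < x -> is_derive x 1 F (f x)) ->
  (forall x, a < x -> {for x, continuous f}) ->
  (forall x y, a < x -> a < y -> F y - F x <= M) ->
  (\int[mu]_(x in `]a, +oo[) (f x)%:E <= M%:E)%E.
Proof.
move=> f0 dF cf FM.
(* The shift to [i.+2] makes [u i < v i] already at [i = 0], where [u 0 = a + 1]. *)
pose u i : R := a + i.+1%:R^-1; pose v i : R := a + i.+2%:R.
have Sx (x : R) : `]a, +oo[%classic x -> a < x by rewrite /= in_itv/= andbT.
have i0 i : 0 < i.+1%:R^-1 :> R by rewrite invr_gt0.
apply: (@integral_ub_FTC f F _ u v).
- move=> i; rewrite /u /v ltrD2l (@le_lt_trans _ _ 1)// ?ltr1n//.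
  by rewrite invf_le1// ler1n.
- move=> i j ij; apply/subsetPset/subset_itv; rewrite bnd_simp lerD2l.
    by rewrite lef_pV2 ?posrE// ler_nat.
  by rewrite ler_nat.
- apply/seteqP; split => [x /Sx ax|x [i _]].
    have xa : 0 < x - a by rewrite subr_gt0.
    pose k := (Num.bound (x - a)^-1 + Num.bound (x - a))%N.
    have k1 := archi_boundP (ltW xa).
    have k2 : (x - a)^-1 < (Num.bound (x - a)^-1)%:R.
      by apply: archi_boundP; rewrite invr_ge0 ltW.
    exists k => //=; rewrite in_itv/= /u /v -!lerBrDl; apply/andP; split.
      rewrite -[leRHS]invrK lef_pV2 ?posrE ?invr_gt0//.
      by rewrite (le_trans (ltW k2))// ler_nat /k; lia.
    by rewrite -lerBlDl (le_trans (ltW k1))// ler_nat /k; lia.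
  rewrite /= !in_itv/= andbT => /andP[+ _]; apply: lt_le_trans.
  by rewrite ltrDl.
- by move=> x /Sx; exact: f0.
- by move=> x /Sx; exact: dF.
- by move=> x /Sx; exact: cf.
- by move=> x y /Sx ax /Sx ay; exact: FM.
Qed.

Lemma integral_ub_FTCoo (f F : R -> R) (b M : R) : 0 < b ->
  (forall x, 0 < x < b -> 0 <= f x) ->
  (forall x, 0 < x < b -> is_derive x 1 F (f x)) ->
  (forall x, 0 < x < b -> {for x, continuous f}) ->
  (forall x y, 0 < x < b -> 0 < y < b -> F y - F x <= M) ->
  (\int[mu]_(x in `]0%R, b[) (f x)%:E <= M%:E)%E.
Proof.
move=> b0 f0 dF cf FM.
(* Starting from a third of the interval ensures [u 0 < v 0]. *)
pose u i : R := b / i.+3%:R; pose v i : R := b - b / i.+3%:R.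
have Sx (x : R) : `]0, b[%classic x -> 0 < x < b by rewrite /= in_itv.
have i0 i : 0 < b / i.+3%:R by rewrite divr_gt0.
apply: (@integral_ub_FTC f F _ u v).
- move=> i; rewrite /u /v ltrBrDr.
  have : b / i.+3%:R <= b / 3.
    by rewrite ler_wpM2l ?(ltW b0)// lef_pV2 ?posrE// ler_nat.
  by move: (b / _) => c h; lra.
- move=> i j ij; have : b / j.+3%:R <= b / i.+3%:R.
    by rewrite ler_wpM2l ?(ltW b0)// lef_pV2 ?posrE// ler_nat.
  by move=> h; apply/subsetPset/subset_itv; rewrite bnd_simp// /v lerB.
- apply/seteqP; split => [x /Sx /andP[x0 xb]|x [i _]].
    have bx : 0 < b - x by rewrite subr_gt0.
    pose k := (Num.bound (b / x) + Num.bound (b / (b - x)))%N.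
    have k1 : b / x < (Num.bound (b / x))%:R.
      by apply: archi_boundP; rewrite divr_ge0// ltW.
    have k2 : b / (b - x) < (Num.bound (b / (b - x)))%:R.
      by apply: archi_boundP; rewrite divr_ge0// ltW.
    exists k => //=; rewrite in_itv/= /u /v; apply/andP; split.
      rewrite ler_pdivrMr// mulrC -ler_pdivrMr// (le_trans (ltW k1))//.
      by rewrite ler_nat /k; lia.
    rewrite lerBrDl -lerBrDr ler_pdivrMr// mulrC -ler_pdivrMr//.
    by rewrite (le_trans (ltW k2))// ler_nat /k; lia.
  rewrite /= !in_itv/= => /andP[h1 h2]; apply/andP; split.
    exact: (lt_le_trans (i0 i) h1).
  by rewrite (le_lt_trans h2)// /v ltrBlDr ltrDl.
- by move=> x /Sx; exact: f0.
- by move=> x /Sx; exact: cf.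
- by move=> x y /Sx ax /Sx ay; exact: FM.
Qed.

Lemma integral_inv_sqr_le (s a : R) : 0 < a ->
  (\int[mu]_(t in `]s, +oo[) ((t - s + a) ^- 2)%:E <= (a^-1)%:E)%E.
Proof.
move=> a0; have pos (x : R) : s < x -> 0 < x - s + a by move=> sx; lra.
apply: (@integral_ub_FTCy _ (fun t => - (t - s + a)^-1)).
- by move=> x sx; rewrite invr_ge0 sqr_ge0.
- move=> x /pos x0; have H : is_derive x 1 (fun t => t - s + a) 1.
    rewrite (_ : (fun t => _) = (fun t => t + (a - s))); last first.
      by apply/funext => t; ring.
    apply: (is_derive_eq (is_deriveD (is_derive_id x 1) (is_derive_cst (a - s) x 1))).
    by rewrite addr0.
  have := is_deriveN (@is_derive_inv _ (fun t => t - s + a) _ _ (lt0r_neq0 x0) H).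
  by move=> /is_derive_eq; apply; rewrite mulr1 opprK.
- move=> x /pos x0; apply: cvgV; first by rewrite expf_neq0// lt0r_neq0.
  apply: (@cvg_comp _ _ _ (fun t => t - s + a) (fun u => u ^+ 2)); last exact: exprn_continuous.
  by apply: cvgD; [apply: cvgB; [exact: cvg_id|exact: cvg_cst]|exact: cvg_cst].
- move=> x y sx sy; have x0 := pos _ sx; have y0 := pos _ sy.
  have : (x - s + a)^-1 <= a^-1 + (y - s + a)^-1.
    rewrite (@le_trans _ _ a^-1)// ?lerDl ?invr_ge0 ?(ltW y0)//.
    by rewrite lef_pV2 ?posrE//; lra.
  by move=> h; lra.
Qed.

(** The beta integral B(1/2, 1/2), with antiderivative [2 atan (sqrt (x / (b - x)))], of total
    increment [pi]. *)
Lemma integral_beta_le (b : R) : 0 < b ->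
  (\int[mu]_(s in `]0%R, b[) ((Num.sqrt s * Num.sqrt (b - s))^-1)%:E <= pi%:E)%E.
Proof.
move=> b0.
have pos (x : R) : 0 < x < b -> 0 < x /\ 0 < b - x.
  by move=> /andP[x0 xb]; split => //; rewrite subr_gt0.
pose G (x : R) := x / (b - x).
apply: (@integral_ub_FTCoo _ (fun x => 2 * atan (Num.sqrt (G x)))) => //.
- move=> x /pos[x0 bx]; have G0 : 0 < G x by rewrite divr_gt0.
  have HG : is_derive x 1 G (b / (b - x) ^+ 2).
    have H1 : is_derive x 1 (fun s => b - s) (- 1).
      apply: (is_derive_eq (is_derive_sub (is_derive_cst b x 1) (is_derive_id x 1))).
      by rewrite sub0r.
    apply: (is_derive_eq (is_derive_mul (is_derive_id x 1)
      (@is_derive_inv _ (fun s => b - s) _ _ (lt0r_neq0 bx) H1))).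
    by field; rewrite gt_eqF.
  have HS := is_derive1_comp (is_derive1_sqrt G0) HG.
  have HA := is_deriveZ 2 (is_derive1_comp (is_derive1_atan _) HS).
  apply: (is_derive_eq HA); rewrite /GRing.scale/= sqr_sqrtr ?(ltW G0)//.
  rewrite /G sqrtrM ?(ltW x0)// sqrtrV ?(ltW bx)//.
  have sx : 0 < Num.sqrt x by rewrite sqrtr_gt0.
  have sbx : 0 < Num.sqrt (b - x) by rewrite sqrtr_gt0.
  have xE : x = Num.sqrt x ^+ 2 by rewrite sqr_sqrtr// ltW.
  have bxE : b - x = Num.sqrt (b - x) ^+ 2 by rewrite sqr_sqrtr// ltW.
  have bE : b = Num.sqrt x ^+ 2 + Num.sqrt (b - x) ^+ 2 by rewrite -xE -bxE; ring.
  move: (Num.sqrt x) (Num.sqrt (b - x)) sx sbx xE bxE bE => p q p0 q0 xE bxE bE.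
  rewrite bxE xE bE; field.
  by rewrite !gt_eqF//= addr_gt0// exprn_gt0.
- move=> x /pos[x0 bx]; apply: cvgV.
    by rewrite mulf_neq0// gt_eqF// sqrtr_gt0.
  apply: cvgM; first exact: sqrt_continuous.
  apply: (@cvg_comp _ _ _ (fun t => b - t) Num.sqrt); last exact: sqrt_continuous.
  by apply: cvgB; [exact: cvg_cst|exact: cvg_id].
- move=> x y /pos[x0 bx] /pos[y0 by0].
  have := atan_ltpi2 (Num.sqrt (G y)).
  have : 0 <= atan (Num.sqrt (G x)).
    by rewrite -(@atan0 R) le_atan.
  lra.
Qed.

(** The dual integral in Hardy's inequality, with antiderivative [2 atan (sqrt ((t - s) / s))]. *)
Lemma integral_hardy_le (s : R) : 0 < s ->
  (\int[mu]_(t in `]s, +oo[) (Num.sqrt s / (t * Num.sqrt (t - s)))%:E <= pi%:E)%E.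
Proof.
move=> s0.
have pos (x : R) : s < x -> 0 < x /\ 0 < x - s.
  by move=> sx; split; [exact: lt_trans sx|rewrite subr_gt0].
pose G (x : R) := (x - s) / s.
apply: (@integral_ub_FTCy _ (fun x => 2 * atan (Num.sqrt (G x)))) => //.
- by move=> x /pos[x0 _]; rewrite divr_ge0 ?mulr_ge0// ltW.
- move=> x /pos[x0 xs]; have G0 : 0 < G x by rewrite divr_gt0.
  have HG : is_derive x 1 G s^-1.
    have H1 : is_derive x 1 (fun t => t - s) 1.
      apply: (is_derive_eq (is_derive_sub (is_derive_id x 1) (is_derive_cst s x 1))).
      by rewrite subr0.
    apply: (is_derive_eq (is_derive_mul H1 (is_derive_cst s^-1 x 1))).
    by rewrite mulr0 add0r mul1r.
  have HS := is_derive1_comp (is_derive1_sqrt G0) HG.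
  have HA := is_deriveZ 2 (is_derive1_comp (is_derive1_atan _) HS).
  apply: (is_derive_eq HA); rewrite /GRing.scale/= sqr_sqrtr ?(ltW G0)//.
  rewrite /G sqrtrM ?(ltW xs)// sqrtrV ?(ltW s0)//.
  have ss : 0 < Num.sqrt s by rewrite sqrtr_gt0.
  have sxs : 0 < Num.sqrt (x - s) by rewrite sqrtr_gt0.
  have sE : s = Num.sqrt s ^+ 2 by rewrite sqr_sqrtr// ltW.
  have xsE : x - s = Num.sqrt (x - s) ^+ 2 by rewrite sqr_sqrtr// ltW.
  have xE : x = Num.sqrt s ^+ 2 + Num.sqrt (x - s) ^+ 2 by rewrite -sE -xsE; ring.
  move: (Num.sqrt s) (Num.sqrt (x - s)) ss sxs sE xsE xE => p q p0 q0 sE xsE xE.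
  rewrite xsE xE sE; field.
  by rewrite !gt_eqF//= addr_gt0// exprn_gt0.
- move=> x /pos[x0 xs]; apply: cvgM; first exact: cvg_cst.
  apply: cvgV; first by rewrite mulf_neq0// gt_eqF// sqrtr_gt0.
  apply: cvgM; first exact: cvg_id.
  apply: (@cvg_comp _ _ _ (fun t => t - s) Num.sqrt); last exact: sqrt_continuous.
  by apply: cvgB; [exact: cvg_id|exact: cvg_cst].
- move=> x y /pos[x0 xs] /pos[y0 ys].
  have := atan_ltpi2 (Num.sqrt (G y)).
  have : 0 <= atan (Num.sqrt (G x)).
    by rewrite -(@atan0 R) le_atan.
  lra.
Qed.


End one_dimensional_integrals.

(** * Translation invariance in time *)

Section translation.
Context {R : realType}.
Local Notation mu := (@lebesgue_measure R).
Local Open Scope ereal_scope.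

Lemma measurable_translate (h : R) :
  measurable_fun setT ((fun t => t - h)%R : measurableTypeR R -> measurableTypeR R).
Proof.
have : measurable_fun [set: R] (fun t : R => t - h)%R by apply: measurable_funB.
by [].
Qed.

Lemma lebesgue_measure_translate (h : R) (A : set R) : measurable A ->
  pushforward mu ((fun t => t - h)%R : measurableTypeR R -> measurableTypeR R) A = mu A.
Proof.
move=> mA; pose nu : {measure set (measurableTypeR R) -> \bar R} :=
  measure_function_pushforward__canonical__measure_function_Measure mu (measurable_translate h).
apply/esym; apply: (@lebesgue_measure_unique R nu) => // _ [[a b]] _ <-.
rewrite /nu /= /pushforward.
rewrite (_ : _ @^-1` _ = `](a + h)%R, (b + h)%R]%classic); last first.
  by apply/seteqP; split => x /=; rewrite !in_itv/= ltrBrDr lerBlDr.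
rewrite !lebesgue_measure_itv/= !lte_fin ltrD2r.
by case: ifP => // _; rewrite -!EFinD; congr _%:E; ring.
Qed.

Lemma ge0_integral_translate (h : R) (F : R -> \bar R) :
  measurable_fun setT F -> (forall t, 0 <= F t) ->
  \int[mu]_t F (t - h)%R = \int[mu]_t F t.
Proof.
move=> mF F0.
transitivity (\int[pushforward mu ((fun t => t - h)%R : measurableTypeR R -> measurableTypeR R)]_t F t).
  rewrite (ge0_integral_pushforward (measurable_translate h))//.
apply: eq_measure_integral => [|? A mA _]; first exact: measurable_translate.
exact: lebesgue_measure_translate.
Qed.

End translation.

(** * Integration of the second time derivative over a half-line *)

Section time_integral.
Context {R : realType} {n : nat}.
Local Notation mu := (@lebesgue_measure R).
Implicit Types (z : 'rV[R]_n).

Lemma sqrt_exp_le (t0 t : R) : 0 < t0 -> t0 <= t ->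
  Num.sqrt (4 * pi * t) ^- n <= Num.sqrt (4 * pi * t0) ^- n :> R.
Proof.
move=> t00 t0t; have t1 := lt_le_trans t00 t0t.
rewrite lef_pV2 ?posrE ?exprn_gt0 ?sqrtr_gt0 ?mulr_gt0 ?pi_gt0//.
rewrite lerXn2r ?nnegrE ?sqrtr_ge0// ler_wsqrtr// ler_wpM2l// mulr_ge0 ?pi_ge0//.
Qed.

Lemma heat_kernel2_le (t0 t : R) z : 0 < t0 -> t0 <= t ->
  heat_kernel (2 * t) z <= Num.sqrt (4 * pi * t0) ^- n.
Proof.
move=> t00 t0t; have t1 := lt_le_trans t00 t0t.
apply: (le_trans (heat_kernel_le _ _)); first by rewrite mulr_gt0.
by apply: sqrt_exp_le => //; lra.
Qed.

Lemma heat_dt_le (t0 t : R) z : 0 < t0 -> t0 <= t ->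
  `|heat_dt t z| <= heat_dt_cst (n := n) * Num.sqrt (4 * pi * t0) ^- n / t.
Proof.
move=> t00 t0t; have t1 := lt_le_trans t00 t0t.
apply: (le_trans (heat_dt_bound _ t1)); rewrite [leRHS]mulrAC.
apply: ler_wpM2l; last exact: heat_kernel2_le.
by rewrite divr_ge0 ?(ltW heat_dt_cst_gt0)// ltW.
Qed.

Lemma heat_dtt_le (t0 t : R) z : 0 < t0 -> t0 <= t ->
  `|heat_dtt t z| <= heat_dtt_cst (n := n) * Num.sqrt (4 * pi * t0) ^- n / t ^+ 2.
Proof.
move=> t00 t0t; have t1 := lt_le_trans t00 t0t.
apply: (le_trans (heat_dtt_bound _ t1)); rewrite [leRHS]mulrAC.
apply: ler_wpM2l; last exact: heat_kernel2_le.
by rewrite divr_ge0 ?(ltW heat_dtt_cst_gt0)// sqr_ge0.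
Qed.

Lemma cvg_invy (a c : R) : 0 < a -> (a * t - c)^-1 @[t --> +oo] --> (0 : R).
Proof.
move=> a0; apply/cvgrPdist_le => e e0; near=> t.
have h : a * t - c >= e^-1.
  rewrite lerBrDr -ler_pdivrMl//; near: t; apply: nbhs_pinfty_ge; exact: num_real.
have ac0 : 0 < a * t - c by rewrite (lt_le_trans _ h)// invr_gt0.
rewrite sub0r normrN ger0_norm ?invr_ge0 ?(ltW ac0)//.
by rewrite -[leRHS]invrK lef_pV2 ?posrE// invr_gt0.
Unshelve. all: end_near. Qed.

Lemma is_derive_add (f g : R -> R) (t df dg : R) :
  is_derive t 1 f df -> is_derive t 1 g dg ->
  is_derive t 1 (fun s => f s + g s) (df + dg).
Proof. by move=> H1 H2; exact: (is_deriveD H1 H2). Qed.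

Lemma is_derive_affine (a c t : R) : is_derive t 1 (fun t => a * t - c) a.
Proof.
apply: (is_derive_eq (is_derive_sub (is_derive_scaled a t) (is_derive_cst c t 1))).
by rewrite subr0.
Qed.

Lemma continuous_affine (a c : R) : continuous (fun t : R => a * t - c).
Proof.
move=> t; apply: cvgB; last exact: cvg_cst.
by apply: cvgM; [exact: cvg_cst|exact: cvg_id].
Qed.

Lemma continuous_heat_dtt (t : R) z : 0 < t -> {for t, continuous (fun s => heat_dtt s z)}.
Proof.
move=> t0; have tn0 := lt0r_neq0 t0.
have cont (f : R -> R) (df : R) : is_derive t 1 f df -> f @ t --> f t.
  by move=> /@ex_derive; exact: derivable_cvg_within.
rewrite /heat_dtt; apply: cvgM; first exact: (cont _ _ (is_derive_heat_kernel z t0)).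
have H1 := cont _ _ (is_derive_divr_exp 2 4 (sqn z) tn0).
have H2 := cont _ _ (is_derive_divr_exp 1 2 n%:R tn0).
have H3 := cont _ _ (is_derive_divr_exp 3 2 (sqn z) tn0).
have H4 := cont _ _ (is_derive_divr_exp 2 2 n%:R tn0).
apply: cvgD => //; apply: cvgB => //.
apply: (@cvg_comp _ _ _ (fun s => sqn z / (4 * s ^+ 2) - n%:R / (2 * s)) (fun u => u ^+ 2)); last exact: exprn_continuous.
exact: cvgB.
Qed.

(** [heat_dtt] changes sign, whereas the fundamental theorem on a half-line concerns nonnegative
    integrands; it is applied to an explicit majorant [f2] of [|f|] and to [f + f2]. The slope of
    [2 t - c] gives the 1/2 that appears in the composition law. *)
Lemma integral_heat_dtt (m c : R) z : 0 < 2 * m - c ->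
  mu.-integrable `[m, +oo[ (EFin \o (fun t => heat_dtt (2 * t - c) z)) /\
  \int[mu]_(t in `[m, +oo[) heat_dtt (2 * t - c) z = - heat_dt (2 * m - c) z / 2.
Proof.
move=> mc; set t0 := 2 * m - c in mc *.
pose A := heat_dtt_cst (n := n) * Num.sqrt (4 * pi * t0) ^- n.
pose B := heat_dt_cst (n := n) * Num.sqrt (4 * pi * t0) ^- n.
have A0 : 0 <= A by rewrite mulr_ge0 ?(ltW heat_dtt_cst_gt0)// invr_ge0 exprn_ge0.
pose f (t : R) : R := heat_dtt (2 * t - c) z.
pose f2 (t : R) : R := A * (2 * t - c) ^- 2.
pose F2 (t : R) : R := - (A / 2) * (2 * t - c)^-1.
pose F1 (t : R) : R := heat_dt (2 * t - c) z / 2 + F2 t.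
have pos t : m <= t -> t0 <= 2 * t - c by rewrite /t0; lra.
have pos0 t : m <= t -> 0 < 2 * t - c by move=> /pos; exact: lt_le_trans.
have f2_ge0 t : m <= t -> 0 <= f2 t by move=> mt; rewrite mulr_ge0// invr_ge0 sqr_ge0.
have ff2 t : m <= t -> `|f t| <= f2 t by move=> /pos /(heat_dtt_le z mc).
have dF2 t : m <= t -> is_derive t 1 F2 (f2 t).
  move=> /pos0 p.
  apply: (is_derive_eq (is_deriveZ _ (@is_derive_inv _ (fun t => 2 * t - c) _ _ (lt0r_neq0 p) (is_derive_affine 2 c t)))).
  by rewrite /GRing.scale/= /f2; field; rewrite gt_eqF.
have dF1 t : m <= t -> is_derive t 1 F1 (f t + f2 t).
  move=> mt; have p := pos0 _ mt.
  have H := @is_derive1_comp _ (fun s => heat_dt s z) (fun t => 2 * t - c) t _ _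
    (is_derive_heat_dt z p) (is_derive_affine 2 c t).
  have H2 := @is_derive_mul _ (fun t => heat_dt (2 * t - c) z) (fun=> 2^-1) t _ _
    H (is_derive_cst (2^-1 : R) t (1 : R)).
  have H3 := @is_derive_add (fun t => heat_dt (2 * t - c) z / 2) F2 t _ _ H2 (dF2 _ mt).
  apply: (is_derive_eq H3).
  by rewrite mulr0 add0r mulfK.
have cf2 t : m <= t -> {for t, continuous f2}.
  move=> /pos0 p; apply: cvgM; first exact: cvg_cst.
  apply: cvgV; first by rewrite expf_neq0// gt_eqF.
  apply: (@cvg_comp _ _ _ (fun t => 2 * t - c) (fun u => u ^+ 2)).
    exact: continuous_affine.
  exact: exprn_continuous.
have cf t : m <= t -> {for t, continuous f}.
  move=> /pos0 p; apply: (@cvg_comp _ _ _ (fun t => 2 * t - c) (fun s => heat_dtt s z)).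
    exact: continuous_affine.
  exact: continuous_heat_dtt.
have F2y : F2 t @[t --> +oo] --> (0 : R).
  by rewrite -(mulr0 (- (A / 2))); apply: cvgM; [exact: cvg_cst|exact: cvg_invy].
have F1y : F1 t @[t --> +oo] --> (0 : R).
  rewrite -(addr0 0); apply: cvgD => //.
  apply: (@squeeze_cvgr _ _ _ _ (fun t => - (B * (2 * t - c)^-1)) (fun t => B * (2 * t - c)^-1)).
  - near=> t; have mt : m <= t by near: t; apply: nbhs_pinfty_ge; exact: num_real.
    have := heat_dt_le z mc (pos _ mt); rewrite -/B ler_norml => /andP[h1 h2].
    have Bp : 0 <= B * (2 * t - c)^-1.
      by rewrite mulr_ge0 ?invr_ge0 ?(ltW (pos0 _ mt))// mulr_ge0 ?(ltW heat_dt_cst_gt0)// invr_ge0 exprn_ge0.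
    by apply/andP; split; lra.
  - rewrite -[X in _ --> X]oppr0 -(mulr0 B); apply: cvgN; apply: cvgM; [exact: cvg_cst|exact: cvg_invy].
  - rewrite -(mulr0 B); apply: cvgM; [exact: cvg_cst|exact: cvg_invy].
have fin (h H : R -> R) : (forall t, m <= t -> 0 <= h t) ->
    (forall t, m <= t -> is_derive t 1 H (h t)) ->
    (forall t, m <= t -> {for t, continuous h}) ->
    H t @[t --> +oo] --> (0 : R) ->
    mu.-integrable `[m, +oo[ (EFin \o h) /\ \int[mu]_(t in `[m, +oo[) h t = - H m.
  move=> h0 dH ch Hy.
  have E : (\int[mu]_(t in `[m, +oo[) (h t)%:E = (- H m)%:E)%E.
    rewrite (@ge0_continuous_FTC2y _ h H m 0)//.
    - by rewrite -EFinB sub0r.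
    - apply: continuous_in_subspaceT => x; rewrite inE/= in_itv/= andbT; exact: ch.
    - by move=> x /ltW /dH /@ex_derive.
    - by apply: cvg_at_right_filter; apply: derivable_cvg_within; have /@ex_derive := dH _ (lexx m).
    - by move=> x; rewrite in_itv/= andbT => /ltW /dH /@derive_val; rewrite derive1E.
  split; last by rewrite /Rintegral E.
  apply/integrableP; split.
    apply/measurable_EFinP; apply: subspace_continuous_measurable_fun => //.
    by apply: continuous_in_subspaceT => x; rewrite inE/= in_itv/= andbT; exact: ch.
  rewrite (eq_integral (fun t : measurableTypeR R => (h t)%:E)) ?E ?ltry// => t.
  by rewrite inE/= in_itv/= andbT => mt; rewrite ger0_norm// h0.
have [i2 E2] := fin f2 F2 f2_ge0 dF2 cf2 F2y.
have [i1 E1] : mu.-integrable `[m, +oo[ (EFin \o (fun t => f t + f2 t)) /\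
    \int[mu]_(t in `[m, +oo[) (f t + f2 t) = - F1 m.
  apply: fin => //.
    by move=> t mt; have := ff2 _ mt; rewrite ler_norml => /andP[]; lra.
  by move=> t mt; apply: cvgD; [exact: cf|exact: cf2].
have iff : mu.-integrable `[m, +oo[ (EFin \o (fun t => f t + f2 t - f2 t)).
  rewrite (_ : EFin \o _ = ((EFin \o (fun t => (f t + f2 t)%R)) \- (EFin \o f2))%E)//.
  exact: integrableB.
have fE : (fun t => f t + f2 t - f2 t) = f by apply/funext => t; rewrite addrK.
rewrite fE in iff; split => //.
transitivity (\int[mu]_(t in `[m, +oo[) (f t + f2 t - f2 t)).
  by apply: eq_Rintegral => t _; rewrite addrK.
by rewrite RintegralB// E1 E2 /F1 -/t0; lra.
Unshelve. all: end_near. Qed.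

End time_integral.

(** * Completeness of L^2 *)

Section L2_completeness.
Context d (T : measurableType d) (R : realType) (mu : {measure set T -> \bar R}).

Lemma limn_einf_le (u : (\bar R)^nat) (e : \bar R) : (forall n, (u n <= e)%E) ->
  (limn_einf u <= e)%E.
Proof.
move=> ue; rewrite limn_einf_lim; apply: lime_le; first exact: is_cvg_einfs.
apply: nearW => n; apply: le_trans (ue n).
by apply: ereal_inf_lbound; exists n => //=.
Qed.

Lemma cvg_geometric_increments (w : nat -> R) (C : R) :
  (forall k, `|w k.+1 - w k| <= C * 2^-1 ^+ k) -> cvgn w.
Proof.
move=> wC.
have C0 : 0 <= C by have := wC 0%N; rewrite expr0 mulr1; exact: le_trans.
have cs : cvgn [normed series (fun k => w k.+1 - w k)].
  apply: (@series_le_cvg _ _ (geometric C 2^-1)) => //=.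
  - by move=> k; apply: mulr_ge0 => //; exact: exprn_ge0.
  - by apply: is_cvg_geometric_series; rewrite ger0_norm// invf_lt1// ltr1n.
have := normed_cvg cs => cs'.
have -> : w = (fun n => w 0%N + series (fun k => w k.+1 - w k) n).
  by apply/funext => n; rewrite seriesEnat /= telescope_sumr// addrC subrK.
by apply: is_cvgD => //; exact: is_cvg_cst.
Qed.

(** Riesz-Fischer for a parameter tending to 0; only the differences [u a - u b] have to be square
    integrable. *)
Lemma L2_complete (u : R -> T -> R) :
  (forall a, measurable_fun setT (u a)) ->
  (forall e : R, 0 < e -> exists2 del : R, 0 < del &
    forall a b, 0 < a < del -> 0 < b < del ->
      (\int[mu]_x (`|u a x - u b x| ^+ 2)%:E <= e%:E)%E) ->
  exists2 g : T -> R, measurable_fun setT g &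
    forall e : R, 0 < e -> exists2 del : R, 0 < del &
      forall a, 0 < a < del -> (\int[mu]_x (`|u a x - g x| ^+ 2)%:E <= e%:E)%E.
Proof.
move=> mu_ cauchy.
(* With these tolerances the integrals of [4^k |v_(k+1) - v_k|^2] sum to at most 1. *)
pose ek k : R := 4 ^- k / (2 ^ k.+1)%:R.
have ek0 k : 0 < ek k by rewrite divr_gt0 ?invr_gt0 ?exprn_gt0 ?ltr0n ?expn_gt0.
have /choice[del delP] : forall k, exists dk : R, 0 < dk /\
    forall a b, 0 < a < dk -> 0 < b < dk ->
      (\int[mu]_x (`|u a x - u b x| ^+ 2)%:E <= (ek k)%:E)%E.
  by move=> k; have [dk dk0 H] := cauchy _ (ek0 k); exists dk.
(* Both [al k] and [al k.+1] lie below [del k], so consecutive terms satisfy the k-th tolerance, and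
   the halving forces [al] to tend to 0. *)
pose fix al k : R := match k with 0 => Num.min (del 0%N) 1 / 2 | j.+1 => Num.min (del j.+1) (al j) / 2 end.
have del0 k : 0 < del k by case: (delP k).
have al0 k : 0 < al k.
  by elim: k => [|k IH] /=; rewrite divr_gt0// lt_min del0 ?ltr01 ?IH.
have half_lt (a b : R) : 0 < a -> Num.min a b / 2 < a.
  move=> a0; rewrite ltr_pdivrMr// mulrDr mulr1.
  by rewrite (@le_lt_trans _ _ a) ?ge_min ?lexx// ltrDl.
have aldel k : al k < del k by case: k => [|k] /=; exact: half_lt.
have alS k : al k.+1 <= al k / 2 by rewrite /= ler_wpM2r// ge_min lexx orbT.
have al2 k : al k <= 2^-1 ^+ k.
  elim: k => [|k IH]; first by rewrite /= ler_pdivrMr// expr0 mul1r (@le_trans _ _ 1) ?ge_min ?lexx ?orbT// ler1n.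
  by rewrite (le_trans (alS k))// exprSr ler_wpM2r.
have v0 k : 0 < al k < del k by rewrite al0 aldel.
have v1 k : 0 < al k.+1 < del k.
  by rewrite al0/= (le_lt_trans (alS k))// (lt_trans _ (aldel k))// ltr_pdivrMr// ltr_pMr ?al0// ltr1n.
pose v k := u (al k).
pose h k x : \bar R := (4 ^+ k * `|v k.+1 x - v k x| ^+ 2)%:E.
have h0 k x : (0 <= h k x)%E by rewrite lee_fin mulr_ge0 ?exprn_ge0// sqr_ge0.
have mvv k l : measurable_fun setT (fun x => `|v k x - v l x| ^+ 2).
  by apply: measurable_funX; apply: measurableT_comp => //; apply: measurable_funB; exact: mu_.
have mh k : measurable_fun setT (h k).
  by apply/measurable_EFinP; apply: measurable_funM.
pose S x := (\sum_(0 <= k <oo) h k x)%E.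
have mS : measurable_fun setT S.
  have := @ge0_emeasurable_sum _ T R setT h xpredT; apply => //.
have S0 x : (0 <= S x)%E by apply: nneseries_ge0.
have iS : mu.-integrable setT S.
  apply/integrableP; split => //.
  rewrite (eq_integral S) => [|x _]; last by rewrite gee0_abs.
  rewrite /S integral_nneseries//.
  apply: (@le_lt_trans _ _ (\sum_(0 <= k <oo) (1 / (2 ^ k.+1)%:R)%:E)%E); last first.
    by rewrite (le_lt_trans (epsilon_trick0 xpredT ler01))// ltry.
  apply: lee_nneseries => k _.
    by move=> _; apply: integral_ge0.
  rewrite /h; under eq_integral do rewrite EFinM.
  rewrite ge0_integralZl//; last exact/measurable_EFinP.
  have := (delP k).2 _ _ (v1 k) (v0 k) => H.
  apply: (le_trans (lee_wpmul2l _ H)); first by rewrite lee_fin exprn_ge0.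
  by rewrite -EFinM lee_fin /ek mulrA mulfV ?expf_neq0//.
have [N [mN N0 SN]] := integrable_ae measurableT iS.
have Nfin x : ~ N x -> S x \is a fin_num.
  by move=> Nx; apply: contrapT => Sx; apply: Nx; apply: SN => /= /(_ Logic.I).
(* Setting the sequence to 0 on [N] makes it converge everywhere, so that its limit is
   measurable. *)
pose w k x := if x \in N then 0 else v k x.
have cw x : cvgn (w ^~ x).
  rewrite /w; case: (boolP (x \in N)) => [_|/negP xN]; first exact: is_cvg_cst.
  have Sx : S x \is a fin_num by apply: Nfin => /mem_set.
  (* Adding 1 gives [S x <= C ^+ 2]; the increments of [v] are then at most [C / 2^k]. *)
  pose C := fine (S x) + 1.
  have C1 : 1 <= C by rewrite lerDr fine_ge0.
  apply: (@cvg_geometric_increments _ C) => k.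
  have hS : (h k x <= S x)%E.
    apply: le_trans (nneseries_lim_ge k.+1 _) => //.
    by rewrite big_nat_recr//= leeDr// sume_ge0.
  rewrite -(fineK Sx) lee_fin in hS.
  have : 4 ^+ k * `|v k.+1 x - v k x| ^+ 2 <= C ^+ 2.
    by apply: (le_trans hS); rewrite /C in C1 *; nra.
  have -> : 4 ^+ k = (2 ^+ k) ^+ 2 :> R by rewrite -exprM mulnC exprM; congr (_ ^+ k); ring.
  rewrite -exprMn ler_pXn2r ?nnegrE ?mulr_ge0 ?exprn_ge0//; last exact: le_trans C1.
  by rewrite -ler_pdivlMl ?exprn_gt0// exprVn mulrC.
pose g x := limn (w ^~ x).
exists g.
  apply: (@measurable_fun_cvg _ T R setT w) => [k|x _]; last exact: cw.
  rewrite /w; apply: measurable_fun_ifT => //; last exact: mu_.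
  apply: (measurable_fun_bool true); rewrite setTI.
  by rewrite (_ : _ @^-1` _ = N)//; apply/seteqP; split => x /=; [exact: set_mem|exact: mem_set].
move=> e e0; have [dl dl0 H] := cauchy _ e0; exists dl => // a a0.
have [K HK] : exists K, forall k, al (k + K)%N < dl.
  have : (2^-1 ^+ k : R) @[k --> \oo] --> (0 : R).
    by apply: cvg_expr; rewrite ger0_norm// invf_lt1// ltr1n.
  move=> /cvgrPdist_lt /(_ _ dl0) [K _ HK]; exists K => k.
  apply: (le_lt_trans (al2 _)).
  by have := HK (k + K)%N (leq_addl _ _); rewrite sub0r normrN ger0_norm// exprn_ge0.
(* Off [N] the distance to [g] is a lower limit of distances within the family, to which Fatou's
   lemma applies. *)
rewrite (@integral_null_eq _ T R mu setT N _
  (fun x => limn_einf (fun k => (`|u a x - v (k + K)%N x| ^+ 2)%:E)))//; last first.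
  move=> x _ Nx; apply/esym.
  have : (`|u a x - v (k + K)%N x| ^+ 2)%:E @[k --> \oo] --> (`|u a x - g x| ^+ 2)%:E.
    apply: cvg_EFin; first exact: nearW.
    apply: (@cvg_comp _ _ _ (fun k => `|u a x - v (k + K)%N x|) (fun z => z ^+ 2)); last exact: exprn_continuous.
    apply: cvg_norm; apply: cvgB; first exact: cvg_cst.
    have wv : w ^~ x = v ^~ x.
      by apply/funext => k; rewrite /w memNset.
    by rewrite (cvg_shiftn K (v ^~ x)) -wv; exact: cw.
  by move=> /cvg_limn_einf_sup[].
apply: le_trans (fatou mu measurableT _ _) _.
- move=> k; apply/measurable_EFinP; apply: measurable_funX; apply: measurableT_comp => //.
  by apply: measurable_funB; exact: mu_.
- by move=> k x _; rewrite lee_fin sqr_ge0.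
- by apply: limn_einf_le => k; apply: H => //; rewrite al0 HK.
Qed.

End L2_completeness.

(** * Product measures and real-valued integrals *)

Section product_integrals.
Context d1 d2 (T1 : measurableType d1) (T2 : measurableType d2) (R : realType).
Variables (m1 : {sigma_finite_measure set T1 -> \bar R})
          (m2 : {sigma_finite_measure set T2 -> \bar R}).

(** Tonelli applies to the positive and negative parts; this covers sections that are not
    integrable, where [fine] gives a default value. *)
Lemma measurable_Rintegral2 (F : T1 * T2 -> R) : measurable_fun setT F ->
  measurable_fun setT (fun x => \int[m2]_y F (x, y)).
Proof.
move=> mF; have mEF : measurable_fun setT (EFin \o F) by exact/measurable_EFinP.
rewrite /Rintegral.
have -> : (fun x => fine (\int[m2]_y (F (x, y))%:E)) =
    fine \o (fun x => \int[m2]_y ((EFin \o F)^\+ (x, y)) -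
                      \int[m2]_y ((EFin \o F)^\- (x, y)))%E.
  apply/funext => x; rewrite /= integralE; congr (fine (_ - _)).
    by apply: eq_integral => y _; rewrite !funeposE.
  by apply: eq_integral => y _; rewrite !funenegE.
apply: measurableT_comp => //; apply: emeasurable_funB.
- apply: (@measurable_fun_fubini_tonelli_F _ _ T1 T2 R m2 ((EFin \o F)^\+)%E) => //.
  exact: measurable_funepos.
- apply: (@measurable_fun_fubini_tonelli_F _ _ T1 T2 R m2 ((EFin \o F)^\-)%E) => //.
  exact: measurable_funeneg.
Qed.

Lemma integral_mul_prod (phi : T1 -> R) (chi : T2 -> R) :
  measurable_fun setT phi -> measurable_fun setT chi ->
  (forall x, 0 <= phi x) -> (forall y, 0 <= chi y) ->
  (\int[m1 \x m2]_z (phi z.1 * chi z.2)%:E =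
   \int[m1]_x (phi x)%:E * \int[m2]_y (chi y)%:E)%E.
Proof.
move=> mphi mchi phi0 chi0.
rewrite fubini_tonelli1/=; last 2 first.
- apply/measurable_EFinP; apply: measurable_funM.
    exact: measurableT_comp mphi measurable_fst.
  exact: measurableT_comp mchi measurable_snd.
- by move=> z; rewrite lee_fin mulr_ge0.
rewrite /fubini_F/= -ge0_integralZr//; last 3 first.
- exact/measurable_EFinP.
- by move=> x _; rewrite lee_fin.
- by apply: integral_ge0 => y _; rewrite lee_fin.
apply: eq_integral => x _; rewrite -ge0_integralZl//; last 3 first.
- exact/measurable_EFinP.
- by move=> y _; rewrite lee_fin.
by rewrite lee_fin.
Qed.

Lemma integrable_mul_prod (phi : T1 -> R) (chi : T2 -> R) :
  m1.-integrable setT (EFin \o phi) -> m2.-integrable setT (EFin \o chi) ->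
  (m1 \x m2)%E.-integrable setT (EFin \o (fun z => phi z.1 * chi z.2)).
Proof.
move=> /integrableP[/measurable_EFinP mphi phioo] /integrableP[/measurable_EFinP mchi chioo].
apply/integrableP; split.
  apply/measurable_EFinP; apply: measurable_funM.
    exact: measurableT_comp mphi measurable_fst.
  exact: measurableT_comp mchi measurable_snd.
rewrite (eq_integral (fun z => (`|phi z.1| * `|chi z.2|)%:E)); last first.
  by move=> z _; rewrite /= normrM.
rewrite (@integral_mul_prod (fun x => `|phi x|) (fun y => `|chi y|))//; last 2 first.
- exact: measurableT_comp.
- exact: measurableT_comp.
have fin (x : \bar R) : (0 <= x -> x < +oo -> x \is a fin_num)%E.
  by move=> x0; rewrite ge0_fin_numE.
apply: lte_mul_pinfty => //; first exact: integral_ge0.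
by apply: fin => //; exact: integral_ge0.
Qed.

Lemma Rintegral_mul_prod (phi : T1 -> R) (chi : T2 -> R) :
  m1.-integrable setT (EFin \o phi) -> m2.-integrable setT (EFin \o chi) ->
  \int[(m1 \x m2)%E]_z (phi z.1 * chi z.2) = \int[m1]_x phi x * \int[m2]_y chi y.
Proof.
move=> iphi ichi; have ii := integrable_mul_prod iphi ichi.
rewrite {1}/Rintegral -(integral12_prod_meas1 ii).
have E x : (fubini_F m2 (EFin \o (fun z => (phi z.1 * chi z.2)%R)) x =
    (phi x)%:E * (\int[m2]_y chi y)%:E)%E.
  rewrite /fubini_F/= fineK ?integrable_fin_num//.
  by rewrite -integralZl//.
under eq_integral do rewrite E.
by rewrite integralZr//= fineM ?fin_numE//; exact: integrable_fin_num.
Qed.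

Lemma Rintegral_fubini (F : T1 * T2 -> R) :
  (m1 \x m2)%E.-integrable setT (EFin \o F) ->
  \int[(m1 \x m2)%E]_z F z = \int[m1]_x \int[m2]_y F (x, y) /\
  \int[(m1 \x m2)%E]_z F z = \int[m2]_y \int[m1]_x F (x, y).
Proof.
move=> iF; have /integrableP[/measurable_EFinP mF _] := iF.
split; rewrite {1}/Rintegral.
  rewrite -(integral12_prod_meas1 iF).
  (* Sections that are not integrable, for which [fine] is not known to be faithful, form a null
     set. *)
  have [N [mN N0 HN]] := ae_integrable1 iF.
  congr fine; apply: (integral_null_eq mN N0) => x _ Nx.
  rewrite /fubini_F /Rintegral fineK//.
  apply: integrable_fin_num => //.
  by apply: contrapT => H; apply: Nx; apply: HN.
rewrite -(integral21_prod_meas1 iF).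
have [N [mN N0 HN]] := ae_integrable2 iF.
congr fine; apply: (integral_null_eq mN N0) => x _ Nx.
rewrite /fubini_G /Rintegral fineK//.
apply: integrable_fin_num => //.
by apply: contrapT => H; apply: Nx; apply: HN.
Qed.

End product_integrals.

(** * Convolution laws for time derivatives *)

Section heat_convolution.
Context {R : realType} {n : nat}.
Implicit Types (s t : R) (x y z : 'rV[R]_n).
Local Notation lam := (lebesgue_rV (R := R) n).

Lemma measurable_sub_rV z : measurable_fun setT (fun x : 'rV[R]_n => x - z).
Proof.
apply: measurable_fun_rVP => i; under eq_fun do rewrite !mxE.
by apply: measurable_funB => //; exact: measurable_coord.
Qed.

Lemma gauss_integrable_L1 (h : 'rV[R]_n -> R) :
  lam.-integrable setT (EFin \o h) -> gauss_integrable h.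
Proof.
move=> /integrableP[/measurable_EFinP mh hoo]; split => // c c0.
apply: le_lt_trans hoo; apply: ge0_le_integral => //.
- apply/measurable_EFinP; apply: measurable_funM; last exact: measurableT_comp.
  exact: measurable_expR_sqn.
- by apply: measurableT_comp => //; exact/measurable_EFinP.
move=> y _ /=; rewrite lee_fin ler_piMl// -expR0 ler_expR oppr_le0.
by rewrite mulr_ge0 ?sqn_ge0// ltW.
Qed.

Lemma integrable_heat_kernel t z : 0 < t ->
  lam.-integrable setT (EFin \o (fun x => heat_kernel t (x - z))).
Proof.
move=> t0; apply/integrableP; split.
  by apply/measurable_EFinP; apply: measurable_heat_kernel => //; exact: measurable_sub_rV.
under eq_integral do rewrite /= ger0_norm ?heat_kernel_ge0//.
by rewrite integral_heat_kernel// ltry.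
Qed.

Lemma integrable_heat_dt t z : 0 < t ->
  lam.-integrable setT (EFin \o (fun x => heat_dt t (x - z))).
Proof.
move=> t0.
have H : lam.-integrable setT (fun x =>
    (heat_dt_cst (R := R) (n := n) / t)%:E * (heat_kernel (2 * t) (x - z))%:E)%E.
  by apply: integrableZl => //; apply: integrable_heat_kernel; rewrite mulr_gt0.
apply: le_integrable H => //.
  by apply/measurable_EFinP; apply: measurable_heat_dt => //; exact: measurable_sub_rV.
move=> x _ /=; rewrite lee_fin (le_trans (heat_dt_bound _ t0))//.
by rewrite ler_norm.
Qed.

(** Integration against [heat_dt] is the time derivative of [heat], so an identity for [heat_kernel]
    valid at all times can be differentiated. Applied to the semigroup law and then to its
    consequence, this gives both laws below. *)
Lemma Rintegral_heat_dt_mul s y (h : 'rV[R]_n -> R) (F : R -> R) dF : 0 < s ->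
  lam.-integrable setT (EFin \o h) ->
  (forall u, 0 < u -> \int[lam]_x (heat_kernel u (y - x) * h x) = F u) ->
  is_derive s 1 F dF ->
  \int[lam]_x (heat_dt s (x - y) * h x) = dF.
Proof.
move=> s0 ih hF DF.
under eq_Rintegral do rewrite heat_dtB.
have [_ <-] := is_derive_heat y (gauss_integrable_L1 ih) s0.
have [_ <-] := DF.
apply: near_eq_derive.
near=> u; rewrite /heat hF//.
by near: u; exact: lt_nbhsr.
Unshelve. all: by end_near. Qed.

Lemma Rintegral_heat_dt_kernel s t y z : 0 < s -> 0 < t ->
  \int[lam]_x (heat_dt s (x - y) * heat_kernel t (x - z)) = heat_dt (s + t) (y - z).
Proof.
move=> s0 t0; apply: (@Rintegral_heat_dt_mul _ _ _ (fun u => heat_kernel (u + t) (y - z))) => //.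
- exact: integrable_heat_kernel.
- move=> u u0; under eq_Rintegral do rewrite heat_kernelB.
  by rewrite /Rintegral integral_heat_kernel_mul.
- have H := @is_derive1_comp _ (fun v => heat_kernel v (y - z)) (fun u => u + t) s _ _
    (is_derive_heat_kernel (y - z) (addr_gt0 s0 t0))
    (is_derive_add (is_derive_id s 1) (is_derive_cst t s 1)).
  by apply: (is_derive_eq H); rewrite addr0 mulr1.
Qed.

Lemma Rintegral_heat_dt_dt s t y z : 0 < s -> 0 < t ->
  \int[lam]_x (heat_dt s (x - y) * heat_dt t (x - z)) = heat_dtt (s + t) (y - z).
Proof.
move=> s0 t0; apply: (@Rintegral_heat_dt_mul _ _ _ (fun u => heat_dt (u + t) (y - z))) => //.
- exact: integrable_heat_dt.
- move=> u u0; under eq_Rintegral do rewrite mulrC heat_kernelB.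
  by rewrite Rintegral_heat_dt_kernel// heat_dtB addrC.
- have H := @is_derive1_comp _ (fun v => heat_dt v (y - z)) (fun u => u + t) s _ _
    (is_derive_heat_dt (y - z) (addr_gt0 s0 t0))
    (is_derive_add (is_derive_id s 1) (is_derive_cst t s 1)).
  by apply: (is_derive_eq H); rewrite addr0 mulr1.
Qed.

End heat_convolution.

(** * Maximal regularity in L^2 of the half-space *)

Section midpoint_convex.
Context {R : realType}.

(** By midpoint convexity an increase from [a] to [b] is repeated, at least as large, along the
    progression of step [b - a]; [N] would then grow linearly. Continuity is not involved. *)
Lemma midconvex_bounded_nonincreasing (N : R -> R) :
  (forall a b : R, 0 < a -> 0 < b -> 2 * N ((a + b) / 2) <= N a + N b) ->
  (forall a0 : R, 0 < a0 -> exists B : R, forall a : R, a0 <= a -> N a <= B) ->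
  forall a b : R, 0 < a -> a <= b -> N b <= N a.
Proof.
move=> convN bddN a b a0 ab; rewrite leNgt; apply/negP => Nab.
have [B hB] := bddN _ a0; pose d := N b - N a; pose x k : R := a + k%:R * (b - a).
have d0 : 0 < d by rewrite subr_gt0.
have ax k : a <= x k by rewrite lerDl mulr_ge0 ?subr_ge0.
have x0 k : 0 < x k by exact: lt_le_trans (ax k).
have inc k : d <= N (x k.+1) - N (x k).
  elim: k => [|k IH].
    by rewrite /x mul0r addr0 mul1r (addrC a) subrK.
  have := convN _ _ (x0 k) (x0 k.+2).
  have -> : (x k + x k.+2) / 2 = x k.+1.
    by rewrite /x -2![in X in _ + X]natr1 -natr1; field.
  lra.
have lin k : N a + k%:R * d <= N (x k).
  elim: k => [|k IH]; first by rewrite /x !mul0r !addr0.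
  by have := inc k; rewrite -[in X in _ -> X]natr1; lra.
have [k Bk] : exists k : nat, B - N a < k%:R * d.
  exists (Num.bound `|(B - N a) / d|); rewrite -ltr_pdivrMr//.
  by apply: le_lt_trans (ler_norm _) _; exact: archi_boundP.
have := lin k; have := hB _ (ax k); lra.
Qed.

End midpoint_convex.

Section product_sigma_finite.
Context d1 d2 (T1 : measurableType d1) (T2 : measurableType d2) (R : realType).
Variables (m1 : {sigma_finite_measure set T1 -> \bar R})
          (m2 : {sigma_finite_measure set T2 -> \bar R}).
Local Open Scope ereal_scope.

(* A copy of the product measure that carries a sigma-finite structure, so that it can itself
   be a factor of a product measure. *)
Definition sigma_finite_product : set (T1 * T2) -> \bar R := m1 \x m2.

HB.instance Definition _ := Measure.copy sigma_finite_product (m1 \x m2).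

Let sigma_finite_productT : sigma_finite setT sigma_finite_product.
Proof.
have /sigma_finiteP[F [TF ndF Foo]] := sigma_finiteT m1.
have /sigma_finiteP[G [TG ndG Goo]] := sigma_finiteT m2.
exists (fun k => F k `*` G k).
  apply/esym; rewrite -subTset => -[x y] _.
  have [i _ Fx] : (\bigcup_i F i) x by rewrite -TF.
  have [j _ Gy] : (\bigcup_i G i) y by rewrite -TG.
  exists (maxn i j) => //; split => /=.
    by move: x Fx; exact/subsetPset/ndF/leq_maxl.
  by move: y Gy; exact/subsetPset/ndG/leq_maxr.
move=> k; have [mF Fk] := Foo k; have [mG Gk] := Goo k.
split; first exact: measurableX.
rewrite /sigma_finite_product product_measure1E//.
by rewrite lte_mul_pinfty// ge0_fin_numE.
Qed.

HB.instance Definition _ := @Measure_isSigmaFinite.Build _ _ _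
  sigma_finite_product sigma_finite_productT.

End product_sigma_finite.

(** * Kernels with a symmetrized semigroup law *)

Section positive_type_kernel.
Context d (T : measurableType d) (R : realType).
Variable m : {sigma_finite_measure set T -> \bar R}.
Variable K : R -> T -> T -> R.
Hypothesis mK : forall a : R, 0 < a -> measurable_fun setT (fun z : T * T => K a z.1 z.2).
Hypothesis K_bdd : forall a0 : R, 0 < a0 ->
  exists B : R, forall (a : R) w h, a0 <= a -> `|K a w h| <= B.
Hypothesis K_sqr : forall a : R, 0 < a ->
  exists2 B : R, 0 <= B & forall h, (\int[m]_w (K a w h ^+ 2)%:E <= B%:E)%E.
Variable Z : set (T * T).
Hypotheses (mZ : measurable Z) (Z0 : (m \x m)%E Z = 0%E).
(* A symmetrized semigroup law: it makes |K_a f|^2 depend on [a] through a midpoint convex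
   function, since <K_a f, K_b f> is then the squared norm of K_((a+b)/2) f. *)
Hypothesis K_mul : forall (a b : R) z, 0 < a -> 0 < b -> ~ Z z ->
  \int[m]_w (K a w z.1 * K b w z.2) =
  - (K (a + b) z.1 z.2 + K (a + b) z.2 z.1) / 2.
Variable f : T -> R.
Hypotheses (if1 : m.-integrable setT (EFin \o f))
           (if2 : m.-integrable setT (EFin \o (fun h => f h ^+ 2))).

Definition kernel_op a w := \int[m]_h (K a w h * f h).
Local Notation g := kernel_op.

Let mf : measurable_fun setT f.
Proof. by have /integrableP[/measurable_EFinP] := if1. Qed.

Lemma measurable_kernel_fun a w : 0 < a -> measurable_fun setT (K a w).
Proof.
move=> a0; have := measurableT_comp (mK a0) (pair1_measurable w).
by [].
Qed.

Lemma measurable_kernel_op a : 0 < a -> measurable_fun setT (g a).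
Proof.
move=> a0; apply: (@measurable_Rintegral2 _ _ T T R m (fun z => K a z.1 z.2 * f z.2)).
apply: measurable_funM; first exact: mK.
exact: measurableT_comp mf measurable_snd.
Qed.

Lemma integrable_kernel a w : 0 < a -> m.-integrable setT (EFin \o (fun h => K a w h * f h)).
Proof.
move=> a0; have [B hB] := K_bdd a0.
have H : m.-integrable setT (fun h => B%:E * `|(f h)%:E|)%E.
  by apply: integrableZl => //; exact: integrable_abse.
apply: le_integrable H => //.
  apply/measurable_EFinP; apply: measurable_funM => //; exact: measurable_kernel_fun.
move=> h _; rewrite /= lee_fin !normrM normr_id ler_wpM2r//.
by apply: le_trans (hB a w h _) (ler_norm _).
Qed.

Let ff (z : T * T) := f z.1 * f z.2.

Let iff : (m \x m)%E.-integrable setT (EFin \o ff).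
Proof. exact: integrable_mul_prod. Qed.

Let G a b (p : T * (T * T)) := K a p.1 p.2.1 * K b p.1 p.2.2 * ff p.2.

Let mG a b : 0 < a -> 0 < b -> measurable_fun setT (G a b).
Proof.
move=> a0 b0; apply: measurable_funM; first apply: measurable_funM.
- apply: (measurableT_comp (mK a0) (g := fun p : T * (T * T) => (p.1, p.2.1))).
  apply: measurable_fun_pair; first exact: measurable_fst.
  exact: measurableT_comp measurable_fst measurable_snd.
- apply: (measurableT_comp (mK b0) (g := fun p : T * (T * T) => (p.1, p.2.2))).
  apply: measurable_fun_pair; first exact: measurable_fst.
  exact: measurableT_comp measurable_snd measurable_snd.
- apply: measurableT_comp measurable_snd.
  by have /integrableP[/measurable_EFinP] := iff.
Qed.

Let mK2 c h : 0 < c -> measurable_fun setT (fun w => K c w h).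
Proof. by move=> c0; exact: measurableT_comp (mK c0) (pair2_measurable h). Qed.

Let abs_KK a b A B h h' : 0 < a -> 0 < b ->
  (\int[m]_w (K a w h ^+ 2)%:E <= A%:E)%E ->
  (\int[m]_w (K b w h' ^+ 2)%:E <= B%:E)%E ->
  (\int[m]_w `|K a w h * K b w h'|%:E <= (A + B)%:E)%E.
Proof.
move=> a0 b0 hA hB; have mKE c k : 0 < c -> measurable_fun setT (fun w => (K c w k ^+ 2)%:E).
  by move=> c0; apply/measurable_EFinP; apply: measurable_funX; exact: mK2.
apply: (@le_trans _ _ (\int[m]_w ((K a w h ^+ 2)%:E + (K b w h' ^+ 2)%:E))%E); last first.
  rewrite ge0_integralD//; last 4 first.
  - by move=> w _; rewrite lee_fin sqr_ge0.
  - exact: mKE.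
  - by move=> w _; rewrite lee_fin sqr_ge0.
  - exact: mKE.
  by rewrite EFinD leeD.
apply: ge0_le_integral_nomeas => // w _.
rewrite -EFinD lee_fin normrM.
have := sqr_ge0 (`|K a w h| - `|K b w h'|).
rewrite sqrrB -[K a w h ^+ 2](real_normK (num_real _)) -[K b w h' ^+ 2](real_normK (num_real _)).
have := mulr_ge0 (normr_ge0 (K a w h)) (normr_ge0 (K b w h')); lra.
Qed.

Lemma integrable_kernel_mul a b h h' : 0 < a -> 0 < b ->
  m.-integrable setT (EFin \o (fun w => K a w h * K b w h')).
Proof.
move=> a0 b0; have [A _ hA] := K_sqr a0; have [B _ hB] := K_sqr b0.
apply/integrableP; split.
  by apply/measurable_EFinP; apply: measurable_funM; exact: mK2.
by apply: le_lt_trans (abs_KK a0 b0 (hA h) (hB h')) (ltry _).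
Qed.

Local Notation mm := (sigma_finite_product m m).

(** Integrating first in [w], the square bounds on the kernel leave a multiple of [|f h f h'|]; this
    licenses the exchange of integrals in [<K_a f, K_b f>]. *)
Let iG a b : 0 < a -> 0 < b -> (m \x mm)%E.-integrable setT (EFin \o G a b).
Proof.
move=> a0 b0; have [A A0 hA] := K_sqr a0; have [B B0 hB] := K_sqr b0.
have mGE : measurable_fun setT (EFin \o G a b) by apply/measurable_EFinP; exact: mG.
have [_ HH] := @integrable21ltyP _ _ _ _ R m mm _ mGE; apply: HH.
have /integrableP[mff ffoo] := iff.
apply: (@le_lt_trans _ _ (\int[(m \x m)%E]_z ((A + B)%:E * `|(ff z)%:E|))%E); last first.
  rewrite ge0_integralZl//; first by rewrite lte_mul_pinfty// lee_fin addr_ge0.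
  - exact: measurableT_comp.
  - by rewrite lee_fin addr_ge0.
apply: ge0_le_integral_nomeas => [z _|z _]; first exact: integral_ge0.
apply: (@le_trans _ _ (\int[m]_w (`|K a w z.1 * K b w z.2|%:E * `|(ff z)%:E|))%E).
  by apply: ge0_le_integral_nomeas => // w _; rewrite /G /= normrM EFinM.
rewrite ge0_integralZr//; first by rewrite lee_wpmul2r// abs_KK.
by apply/measurable_EFinP; apply: measurableT_comp => //; apply: measurable_funM; exact: mK2.
Qed.

(** After Fubini, [K_mul] replaces the inner integral off [Z]. Against the symmetric function
    [f h f h'] the kernel and its transpose have the same integral, which cancels the 1/2. *)
Lemma kernel_op_mul a b : 0 < a -> 0 < b ->
  m.-integrable setT (EFin \o (fun w => g a w * g b w)) /\
  \int[m]_w (g a w * g b w) = - \int[m]_h (f h * g (a + b) h).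
Proof.
move=> a0 b0; have iGab := iG a0 b0; have ab0 := addr_gt0 a0 b0.
have gg w : \int[mm]_z G a b (w, z) = g a w * g b w.
  rewrite /g /kernel_op.
  rewrite -(Rintegral_mul_prod (integrable_kernel w a0) (integrable_kernel w b0)).
  by apply: eq_Rintegral => z _; rewrite /G /ff /= mulrACA.
split.
  have := integrable_fubini_F iGab; apply: eq_integrable => // w _.
  rewrite /fubini_F /= -gg /Rintegral fineK//.
  apply: integrable_fin_num => //.
  have -> : (fun x => (G a b (w, x))%:E) = EFin \o
      (fun z => (K a w z.1 * f z.1) * (K b w z.2 * f z.2)).
    by apply/funext => z; rewrite /G /ff /= mulrACA.
  exact: integrable_mul_prod (integrable_kernel w a0) (integrable_kernel w b0).
under eq_Rintegral do rewrite -gg.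
have [<- ->] := Rintegral_fubini iGab.
pose H c (z : T * T) := K c z.1 z.2 * ff z.
have mH c : 0 < c -> measurable_fun setT (H c).
  move=> c0; apply: measurable_funM; first exact: mK.
  by have /integrableP[/measurable_EFinP] := iff.
pose H' c (z : T * T) := K c z.2 z.1 * ff z.
have swap_meas : measurable_fun setT (fun z : T * T => (z.2, z.1)).
  by apply: measurable_fun_pair; [exact: measurable_snd|exact: measurable_fst].
have mH' c : 0 < c -> measurable_fun setT (H' c).
  move=> c0; apply: measurable_funM; first exact: (measurableT_comp (mK c0) swap_meas).
  by have /integrableP[/measurable_EFinP] := iff.
have iKff (L : T -> T -> R) B : measurable_fun setT (fun z : T * T => L z.1 z.2) ->
    (forall w h, `|L w h| <= B) ->
    (m \x m)%E.-integrable setT (EFin \o (fun z => L z.1 z.2 * ff z)).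
  move=> mL LB.
  have HB : (m \x m)%E.-integrable setT (fun z => B%:E * `|(ff z)%:E|)%E.
    by apply: integrableZl => //; exact: integrable_abse.
  apply: le_integrable HB => //.
    apply/measurable_EFinP; apply: measurable_funM => //.
    by have /integrableP[/measurable_EFinP] := iff.
  move=> z _; rewrite /= lee_fin !normrM !normr_id ler_wpM2r ?mulr_ge0//.
  by apply: le_trans (LB _ _) (ler_norm _).
have [B hB] := K_bdd ab0.
have iH : (m \x m)%E.-integrable setT (EFin \o H (a + b)).
  by apply: (iKff (K (a + b)) B) => [|w h]; [exact: mK|exact: hB].
have iH' : (m \x m)%E.-integrable setT (EFin \o H' (a + b)).
  apply: (iKff (fun w h => K (a + b) h w) B) => [|w h]; last exact: hB.
  exact: (measurableT_comp (mK ab0) swap_meas).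
transitivity (\int[mm]_z (- 2^-1 * (H (a + b) z + H' (a + b) z))).
  apply: (Rintegral_null_eq mZ Z0) => z _ Zz.
  have -> : \int[m]_x G a b (x, z) = \int[m]_x (K a x z.1 * K b x z.2) * ff z.
    by rewrite -RintegralZr//; exact: integrable_kernel_mul.
  by rewrite K_mul// /H /H'; field.
change (\int[(m \x m)%E]_z (- 2^-1 * (H (a + b) z + H' (a + b) z)) = - \int[m]_h (f h * g (a + b) h)).
rewrite RintegralZl//; last exact: (integrableD measurableT iH iH').
rewrite RintegralD//.
have [-> _] := Rintegral_fubini iH; have [_ ->] := Rintegral_fubini iH'.
have E1 : \int[m]_x \int[m]_y H (a + b) (x, y) = \int[m]_h (f h * g (a + b) h).
  apply: eq_Rintegral => x _; rewrite /H /ff /g /kernel_op/= -RintegralZl//; last exact: integrable_kernel.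
  by apply: eq_Rintegral => y _; rewrite mulrCA.
have E2 : \int[m]_y \int[m]_x H' (a + b) (x, y) = \int[m]_h (f h * g (a + b) h).
  rewrite -E1; apply: eq_Rintegral => x _; apply: eq_Rintegral => y _.
  by rewrite /H /H' /ff /= (mulrC (f x)).
by rewrite E1 E2; field.
Qed.

Let N a := \int[m]_w (g a w ^+ 2).

Let igg a : 0 < a -> m.-integrable setT (EFin \o (fun w => g a w ^+ 2)).
Proof. by move=> a0; have [+ _] := kernel_op_mul a0 a0. Qed.

(** By [kernel_op_mul] the pairing depends on [a + b] alone, so both parameters may be replaced by
    their mean. *)
Let N_mul a b : 0 < a -> 0 < b -> \int[m]_w (g a w * g b w) = N ((a + b) / 2).
Proof.
move=> a0 b0; have ab0 : 0 < (a + b) / 2 by rewrite divr_gt0 ?addr_gt0.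
rewrite (kernel_op_mul a0 b0).2 /N; under [RHS]eq_Rintegral do rewrite expr2.
by rewrite (kernel_op_mul ab0 ab0).2 -splitr.
Qed.

Let N_ge0 a : 0 <= N a.
Proof. by apply: Rintegral_ge0 => w _; rewrite sqr_ge0. Qed.

(** Nonnegativity of the left-hand side is midpoint convexity of [N]; the same formula yields the
    Cauchy property once [N] is known to converge at 0. *)
Let N_sub a b : 0 < a -> 0 < b ->
  (\int[m]_w (`|g a w - g b w| ^+ 2)%:E = (N a + N b - 2 * N ((a + b) / 2))%:E)%E.
Proof.
move=> a0 b0; have [iab _] := kernel_op_mul a0 b0.
have i1 := integrableD measurableT (igg a0) (igg b0).
have i2 : m.-integrable setT (EFin \o (fun w => 2 * (g a w * g b w))).
  by have := integrableZl measurableT 2 iab.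
have E w : (`|g a w - g b w| ^+ 2)%:E =
    ((EFin \o (fun w => g a w ^+ 2 + g b w ^+ 2 - 2 * (g a w * g b w))%R) w).
  by rewrite real_normK ?num_real//= sqrrB; congr EFin; ring.
under eq_integral do rewrite E.
have i3 : m.-integrable setT (EFin \o (fun w => g a w ^+ 2 + g b w ^+ 2 - 2 * (g a w * g b w))%R).
  exact: (integrableB measurableT i1 i2).
rewrite -[LHS]fineK; last exact: integrable_fin_num.
congr EFin; change (\int[m]_w (g a w ^+ 2 + g b w ^+ 2 - 2 * (g a w * g b w)) = N a + N b - 2 * N ((a + b) / 2)).
rewrite RintegralB// RintegralD//; [|exact: igg|exact: igg].
by congr (_ - _); rewrite -(N_mul a0 b0) RintegralZl.
Qed.

(** [N a = - <f, K_(2a) f>] is at most the supremum of the kernel times the square of the L^1 norm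
    of [f]. *)
Let N_bdd (a0 : R) : 0 < a0 -> exists B : R, forall a : R, a0 <= a -> N a <= B.
Proof.
move=> a00; have [B hB] := K_bdd a00.
have B0 : 0 <= B by exact: le_trans (hB a0 point point _).
pose S := \int[m]_h `|f h|.
have gB a w : a0 <= a -> `|g a w| <= B * S.
  move=> a0a; apply: le_trans (le_normr_Rintegral _ _) _ => //.
    by apply: integrable_kernel; exact: lt_le_trans a0a.
  rewrite -RintegralZl//; last exact: (integrable_norm if1).
  apply: le_Rintegral => //.
  - by apply: (integrable_norm (integrable_kernel _ _)); exact: lt_le_trans a0a.
  - exact: (integrableZl measurableT B (integrable_norm if1)).
  by move=> h _; rewrite normrM ler_wpM2r// hB.
exists (B * S * S) => a a0a; have a1 := lt_le_trans a00 a0a.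
rewrite /N; under eq_Rintegral do rewrite expr2.
rewrite (kernel_op_mul a1 a1).2.
have ifg : m.-integrable setT (EFin \o (fun h => f h * g (a + a) h)).
  apply: (le_integrable measurableT _ _ (integrableZl measurableT (B * S) (integrable_norm if1))).
    apply/measurable_EFinP; apply: measurable_funM => //.
    by apply: measurable_kernel_op; rewrite addr_gt0.
  move=> h _ /=; rewrite lee_fin normrM mulrC [leRHS]normrM ler_pM//.
    by rewrite (le_trans (gB _ _ _) (ler_norm _))// ler_wpDr// ltW.
  by rewrite normr_id.
apply: le_trans (ler_norm _) _; rewrite normrN.
apply: le_trans (le_normr_Rintegral _ _) _ => //.
rewrite -RintegralZl//; last exact: (integrable_norm if1).
apply: le_Rintegral => //.
- exact: (integrable_norm ifg).
- exact: (integrableZl measurableT (B * S) (integrable_norm if1)).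
move=> h _; rewrite normrM mulrC ler_wpM2r// gB// ler_wpDr// ltW//.
Qed.

Let N_nonincreasing (a b : R) : 0 < a -> a <= b -> N b <= N a.
Proof.
apply: midconvex_bounded_nonincreasing => [c e c0 e0|]; last exact: N_bdd.
rewrite -subr_ge0 -lee_fin -N_sub//; apply: integral_ge0 => w _.
by rewrite lee_fin sqr_ge0.
Qed.

(* [N a = - <f, K_(2a) f> <= (|f|^2 + N (2 a)) / 2], and [N (2 a) <= N a]. *)
Let N_le a : 0 < a -> N a <= \int[m]_h (f h ^+ 2).
Proof.
move=> a0; have a20 : 0 < a + a by rewrite addr_gt0.
have H : N a <= (\int[m]_h (f h ^+ 2) + N (a + a)) / 2.
  rewrite /N; under [in leLHS]eq_Rintegral do rewrite expr2.
  rewrite (kernel_op_mul a0 a0).2 -RintegralD//; last exact: igg.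
  have i1 := integrableD measurableT if2 (igg a20).
  have ifg : m.-integrable setT (EFin \o (fun h => f h * g (a + a) h)).
    apply: (le_integrable measurableT _ _ i1).
      by apply/measurable_EFinP; apply: measurable_funM => //; exact: measurable_kernel_op.
    move=> h _ /=; rewrite lee_fin normrM [leRHS]ger0_norm ?addr_ge0 ?sqr_ge0//.
    have := sqr_ge0 (`|f h| - `|g (a + a) h|).
    rewrite sqrrB -[f h ^+ 2](real_normK (num_real _)) -[g (a + a) h ^+ 2](real_normK (num_real _)).
    have := mulr_ge0 (normr_ge0 (f h)) (normr_ge0 (g (a + a) h)); lra.
  rewrite -[leLHS]mulN1r mulrC -RintegralZr// mulrC -RintegralZl//.
  apply: le_Rintegral => //.
  - exact: (integrableZl measurableT (-1) ifg).
  - exact: (integrableZr measurableT 2^-1 i1).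
  move=> h _; have := sqr_ge0 (f h + g (a + a) h); rewrite sqrrD; lra.
have := N_nonincreasing a0 (_ : a <= a + a); rewrite lerDl ltW// => /(_ isT).
move: H; move: (N a) (N (a + a)) (\int[m]_h (f h ^+ 2)) => *; lra.
Qed.

Lemma kernel_op_L2 a : 0 < a ->
  (\int[m]_w (g a w ^+ 2)%:E <= \int[m]_h (f h ^+ 2)%:E)%E.
Proof.
move=> a0; rewrite -[leLHS]fineK; last exact: integrable_fin_num (igg a0).
rewrite -[leRHS]fineK; last exact: integrable_fin_num if2.
by rewrite lee_fin; exact: N_le.
Qed.

(** [N] is nonincreasing and bounded, so it increases to its supremum as the delay tends to 0;
    within [e / 2] of the supremum, [N a + N b - 2 N ((a + b) / 2) <= e]. *)
Lemma kernel_op_cauchy (e : R) : 0 < e -> exists2 del : R, 0 < del &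
  forall a b, 0 < a < del -> 0 < b < del ->
    (\int[m]_w (`|g a w - g b w| ^+ 2)%:E <= e%:E)%E.
Proof.
move=> e0; pose S := [set N a | a in [set a : R | 0 < a]].
have supS : has_sup S.
  split; first by exists (N 1); exists 1 => //=.
  by exists (\int[m]_h (f h ^+ 2)) => _ [a /= a0 <-]; exact: N_le.
have [_ [a0 /= a00 <-] Na0] := sup_adherent (divr_gt0 e0 (ltr0Sn _ 1)) supS.
have ub c : 0 < c -> N c <= sup S by move=> c0; apply: sup_upper_bound => //; exists c.
exists a0 => // a b /andP[a1 aa0] /andP[b1 ba0].
rewrite N_sub// lee_fin.
have H : N a0 <= N ((a + b) / 2).
  by apply: N_nonincreasing; [rewrite divr_gt0// addr_gt0|lra].
move: H Na0 (ub _ a1) (ub _ b1); move: (N a) (N b) (N a0) (N _) (sup S) => *; lra.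
Qed.

End positive_type_kernel.

(** * The delayed kernel of M *)

Section heat_time_kernel.
Context {R : realType} {n : nat}.
Implicit Types (x y z : 'rV[R]_n).
Local Notation leb := (@lebesgue_measure R).
Local Notation lam := (lebesgue_rV (R := R) n).
Local Notation T := (measurableTypeR R * 'rV[R]_n)%type.
Local Notation m := (sigma_finite_product leb lam).

(* Regularizing by a positive delay [a], instead of truncating at [s < t - a], yields an
   exact composition law; [dt_trunc] below translates it back to the truncation. *)
Definition dt_kernel (a : R) (w h : T) : R :=
  if h.1 <= w.1 then heat_dt (w.1 - h.1 + a) (w.2 - h.2) else 0.

Lemma measurable_fun_subrV d (S : measurableType d) (f g : S -> 'rV[R]_n) :
  measurable_fun setT f -> measurable_fun setT g ->
  measurable_fun setT (fun w => f w - g w).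
Proof.
move=> mf mg; apply: measurable_fun_rVP => i; under eq_fun do rewrite !mxE.
by apply: measurable_funB; exact: measurableT_comp (measurable_coord i) _.
Qed.

Lemma measurable_dt_kernel (a : R) :
  measurable_fun setT (fun z : T * T => dt_kernel a z.1 z.2).
Proof.
have m11 : measurable_fun setT (fun z : T * T => z.1.1 : R).
  exact: measurableT_comp measurable_fst measurable_fst.
have m21 : measurable_fun setT (fun z : T * T => z.2.1 : R).
  exact: measurableT_comp measurable_fst measurable_snd.
have m12 : measurable_fun setT (fun z : T * T => z.1.2).
  exact: measurableT_comp measurable_snd measurable_fst.
have m22 : measurable_fun setT (fun z : T * T => z.2.2).
  exact: measurableT_comp measurable_snd measurable_snd.
apply: measurable_fun_ifT => //; first exact: measurable_fun_ler.
apply: measurable_heat_dt; last exact: measurable_fun_subrV.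
by apply: measurable_funD => //; apply: measurable_funB.
Qed.

Definition dt_sup (a0 : R) : R := heat_dt_cst (n := n) * Num.sqrt (4 * pi * a0) ^- n.

Lemma dt_sup_ge0 a0 : 0 <= dt_sup a0.
Proof. by rewrite mulr_ge0 ?(ltW heat_dt_cst_gt0)// invr_ge0 exprn_ge0 ?sqrtr_ge0. Qed.

Lemma dt_kernel_le (a0 a : R) (w h : T) : 0 < a0 -> a0 <= a ->
  `|dt_kernel a w h| <= dt_sup a0 / a0.
Proof.
move=> a00 a0a; rewrite /dt_kernel; case: ifPn => [hw|_]; last first.
  by rewrite normr0 divr_ge0 ?dt_sup_ge0// ltW.
have ha : a0 <= w.1 - h.1 + a by rewrite ler_wpDl// subr_ge0.
apply: le_trans (heat_dt_le _ a00 ha) _.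
by rewrite ler_wpM2l ?dt_sup_ge0// lef_pV2 ?posrE//; exact: lt_le_trans ha.
Qed.

(** At time lag [tau] one factor is bounded by its supremum, of order [1 / tau], and the other by
    [1 / tau] times a Gaussian of mass 1; the resulting [tau ^- 2] is integrable from [a] on. *)
Lemma integral_dt_kernel_sqr (a : R) (h : T) : 0 < a ->
  (\int[m]_w (dt_kernel a w h ^+ 2)%:E <=
   (2 * dt_sup a * heat_dt_cst (n := n) / a)%:E)%E.
Proof.
case: h => s y a0; set D := heat_dt_cst (n := n).
rewrite [leLHS](_ : _ = \int[leb]_t \int[lam]_x (dt_kernel a (t, x) (s, y) ^+ 2)%:E)%E; last first.
  rewrite -[RHS](@fubini_tonelli1 _ _ _ _ _ leb lam (fun w => (dt_kernel a w (s, y) ^+ 2)%:E))//.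
  - apply/measurable_EFinP; apply: measurable_funX.
    exact: measurableT_comp (measurable_dt_kernel a) (pair2_measurable (s, y)).
  - by move=> w; rewrite lee_fin sqr_ge0.
have D0 : 0 < D by exact: heat_dt_cst_gt0.
have B0 := dt_sup_ge0 a; set A := dt_sup a in B0 *.
have a20 : 0 < a / 2 by rewrite divr_gt0.
(* Starting before [s] puts the closed condition [s <= t] inside an open half-line; this accounts
   for the factor 2. *)
pose c0 := s - a / 2.
apply: (@le_trans _ _ (\int[leb]_(t in `]c0, +oo[) ((A * D)%:E * ((t - c0 + a / 2) ^- 2)%:E))%E).
  rewrite [leRHS]integral_mkcond; apply: ge0_le_integral_nomeas => t _.
    by apply: integral_ge0 => x _; rewrite lee_fin sqr_ge0.
  rewrite patchE /dt_kernel /=; case: (leP s t) => st; last first.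
    rewrite integral0_eq; last by move=> x _; rewrite expr2 mul0r.
    by case: ifP => // _; rewrite -EFinM lee_fin mulr_ge0 ?invr_ge0 ?sqr_ge0// mulr_ge0// ltW.
  rewrite ifT; last by rewrite inE/= in_itv/= andbT; apply: lt_le_trans st; rewrite ltrBlDr ltrDl.
  have -> : t - c0 + a / 2 = t - s + a by rewrite /c0; field.
  have ta : a <= t - s + a by rewrite ler_wpDl// subr_ge0.
  move: (t - s + a) ta => tau ta; have tau0 := lt_le_trans a0 ta.
  apply: (@le_trans _ _ (\int[lam]_x ((A * D / tau ^+ 2)%:E * (heat_kernel (2 * tau) (x - y))%:E))%E).
    apply: ge0_le_integral_nomeas => x _; first by rewrite lee_fin sqr_ge0.
    rewrite -EFinM lee_fin -(real_normK (num_real _)) expr2.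
    apply: (@le_trans _ _ (A / tau * (D / tau * heat_kernel (2 * tau) (x - y)))).
      by apply: ler_pM => //; [exact: heat_dt_le|exact: heat_dt_bound].
    by rewrite le_eqVlt; apply/orP; left; apply/eqP; field; rewrite lt0r_neq0.
  rewrite ge0_integralZl//; last 3 first.
  - by apply/measurable_EFinP; apply: measurable_heat_kernel => //; exact: measurable_sub_rV.
  - by move=> x _; rewrite lee_fin heat_kernel_ge0.
  - by rewrite lee_fin divr_ge0 ?sqr_ge0// mulr_ge0// ltW.
  by rewrite integral_heat_kernel ?mulr_gt0// mule1 -EFinM.
rewrite ge0_integralZl//; last 3 first.
- apply/measurable_EFinP.
  have E : measurable_fun setT (fun t : R => (t - c0 + a / 2)).
    by apply: measurable_funD => //; apply: measurable_funB.
  apply: measurable_funTS; apply: measurable_funV; exact: measurable_funX.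
- by move=> t _; rewrite lee_fin invr_ge0 sqr_ge0.
- by rewrite lee_fin mulr_ge0// ltW.
apply: (@le_trans _ _ ((A * D)%:E * ((a / 2)^-1)%:E)%E).
  apply: lee_wpmul2l; first by rewrite lee_fin mulr_ge0// ltW.
  exact: integral_inv_sqr_le.
rewrite -EFinM lee_fin le_eqVlt; apply/orP; left; apply/eqP.
by field; rewrite lt0r_neq0.
Qed.

Lemma dt_kernel_sqr_bounded (c : R) : 0 < c -> exists2 B : R, 0 <= B &
  forall h, (\int[m]_w (dt_kernel c w h ^+ 2)%:E <= B%:E)%E.
Proof.
move=> c0; exists (2 * dt_sup c * heat_dt_cst (n := n) / c) => [|h].
  have := dt_sup_ge0 c; have := ltW (heat_dt_cst_gt0 (R := R) (n := n)) => *.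
  by rewrite divr_ge0 ?(ltW c0)// mulr_ge0// mulr_ge0.
exact: integral_dt_kernel_sqr.
Qed.

(** At equal times both terms on the right of [dt_kernel_mul] are present, and the right-hand side
    is twice the left. *)
Definition sim_times : set (T * T) := [set z | z.1.1 = z.2.1].

Lemma measurable_sim_times : measurable sim_times.
Proof.
have m11 : measurable_fun setT (fun z : T * T => z.1.1 : R).
  exact: measurableT_comp measurable_fst measurable_fst.
have m21 : measurable_fun setT (fun z : T * T => z.2.1 : R).
  exact: measurableT_comp measurable_fst measurable_snd.
have := measurable_fun_eqr m11 m21 measurableT (Y := [set true]) I.
rewrite setTI (_ : _ @^-1` _ = sim_times)//.
by apply/seteqP; split => z /= /eqP.
Qed.

Lemma measure_sim_times : (m \x m)%E sim_times = 0%E.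
Proof.
rewrite /product_measure1 integral0_eq// => -[s y] _ /=.
rewrite (_ : xsection _ _ = [set s] `*` [set: 'rV[R]_n]); last first.
  apply/seteqP; split => -[t x]; rewrite /xsection/= inE /sim_times/=.
    by move=> ->.
  by case=> ->.
rewrite /sigma_finite_product product_measure1E//.
transitivity (0 * lam setT)%E; last by rewrite mul0e.
by congr (_ * _)%E; exact: lebesgue_measure_set1.
Qed.

(** The space integral is [heat_dtt] at time [2 t - c], integrated over [t >= M]. Since
    [2 M - c = |s - s'| + a + b], the lower end gives [dt_kernel (a + b)] in whichever order of the
    two points is causal; the other order gives 0. *)
Lemma dt_kernel_mul (a b : R) (z : T * T) : 0 < a -> 0 < b -> ~ sim_times z ->
  \int[m]_w (dt_kernel a w z.1 * dt_kernel b w z.2) =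
  - (dt_kernel (a + b) z.1 z.2 + dt_kernel (a + b) z.2 z.1) / 2.
Proof.
move=> a0 b0; suff H (s s' : R) y y' : s <> s' ->
    \int[m]_w (dt_kernel a w (s, y) * dt_kernel b w (s', y')) =
    - (dt_kernel (a + b) (s, y) (s', y') + dt_kernel (a + b) (s', y') (s, y)) / 2.
  by move: z => [[s y] [s' y']]; exact: H.
move=> ss.
have iKK := integrable_kernel_mul (fun c _ => measurable_dt_kernel c) dt_kernel_sqr_bounded (s, y) (s', y') a0 b0.
have [-> _] := @Rintegral_fubini _ _ _ _ R leb lam
  (fun w => dt_kernel a w (s, y) * dt_kernel b w (s', y')) iKK.
pose c := s + s' - a - b; pose M := Num.max s s'.
have Mc : 0 < 2 * M - c.
  rewrite /c /M; case: (ltgtP s s') => ?; lra.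
transitivity (\int[leb]_(t in `[M, +oo[) heat_dtt (2 * t - c) (y - y')).
  rewrite [RHS]Rintegral_mkcond; apply: eq_Rintegral => t _; rewrite patchE mem_setE in_itv/= andbT.
  rewrite /dt_kernel /= ge_max.
  case: (leP s t) => st; last by under eq_Rintegral do rewrite mul0r; rewrite Rintegral_cst// mul0r.
  case: (leP s' t) => st'; last by under eq_Rintegral do rewrite mulr0; rewrite Rintegral_cst// mul0r.
  rewrite Rintegral_heat_dt_dt; first by congr heat_dtt; rewrite /c; ring.
  - by rewrite ltr_wpDl// subr_ge0.
  - by rewrite ltr_wpDl// subr_ge0.
rewrite (integral_heat_dtt (y - y') Mc).2 /dt_kernel/=; move: Mc; rewrite /M /c.
case: (ltgtP s s') => // sl Mc.
- rewrite add0r heat_dtB; congr (- heat_dt _ _ / 2); ring.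
- rewrite addr0; congr (- heat_dt _ _ / 2); ring.
Qed.

End heat_time_kernel.
Section abs_integral.
Context d (T : measurableType d) (R : realType) (mu : {measure set T -> \bar R}).

(** No integrability is required, since [fine] never increases an absolute value. *)
Lemma abs_Rintegral_le (F : T -> R) : measurable_fun setT F ->
  (`|\int[mu]_x F x|%:E <= \int[mu]_x `|F x|%:E)%E.
Proof.
move=> mF; have abs_fine (x : \bar R) : (`|fine x|%:E <= `|x|)%E.
  by case: x => //=; rewrite leey.
apply: le_trans (abs_fine _) _.
by apply: (@le_abse_integral _ _ _ mu setT (EFin \o F)) => //; exact/measurable_EFinP.
Qed.

End abs_integral.

(** * From the delayed operator to the truncated one *)

Section heat_time_operator.
Context {R : realType} {n : nat}.
Implicit Types (x y z : 'rV[R]_n).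
Local Notation leb := (@lebesgue_measure R).
Local Notation lam := (lebesgue_rV (R := R) n).
Local Notation T := (measurableTypeR R * 'rV[R]_n)%type.
Local Notation m := (sigma_finite_product leb lam).

Definition dtt_sup (a0 : R) : R :=
  heat_dtt_cst (n := n) * Num.sqrt (4 * pi * a0) ^- n / a0 ^+ 2.

Lemma dtt_sup_ge0 a0 : 0 <= dtt_sup a0.
Proof.
rewrite divr_ge0 ?sqr_ge0// mulr_ge0 ?(ltW heat_dtt_cst_gt0)// invr_ge0 exprn_ge0 ?sqrtr_ge0.
Qed.

Lemma heat_dt_lipschitz (a0 t a : R) z : 0 < a0 -> a0 <= t - a -> 0 <= a ->
  `|heat_dt (t - a) z - heat_dt t z| <= a * dtt_sup a0.
Proof.
move=> a00 ta; rewrite le_eqVlt => /predU1P[<-|a1].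
  by rewrite subr0 subrr normr0 mul0r.
have pos (u : R) : t - a <= u -> 0 < u by move=> tau; rewrite (lt_le_trans a00)// (le_trans ta).
have tat : t - a < t by rewrite gtrBl.
have dd (u : R) : u \in `](t - a), t[ -> is_derive u 1 (fun u => heat_dt u z) (heat_dtt u z).
  by rewrite in_itv/= => /andP[tu _]; apply: is_derive_heat_dt; apply: pos; exact: ltW.
have cc : {within `[t - a, t], continuous (fun u => heat_dt u z)}.
  apply: continuous_in_subspaceT => u; rewrite inE/= in_itv/= => /andP[tu _].
  apply: derivable_cvg_within.
  by have [] := is_derive_heat_dt z (pos _ tu).
have [c] := MVT tat dd cc.
rewrite in_itv/= => /andP[tc _] E.
rewrite distrC E normrM [X in _ * X]ger0_norm; last lra.
rewrite (_ : t - (t - a) = a); last ring.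
rewrite mulrC ler_wpM2l ?(ltW a1)//.
have a0c : a0 <= c by exact: le_trans ta (ltW tc).
apply: le_trans (heat_dtt_le _ a00 a0c) _; rewrite ler_wpM2l//.
  by rewrite mulr_ge0 ?(ltW heat_dtt_cst_gt0)// invr_ge0 exprn_ge0 ?sqrtr_ge0.
have c0 := lt_le_trans a00 a0c.
by rewrite lef_pV2 ?posrE ?exprn_gt0// lerXn2r ?nnegrE// ltW.
Qed.

(** The source times [s] at which the kernel is present at time [t] but not yet at time [t - a]. *)
Definition time_win (a t s : R) : R := if (t - a < s) && (s <= t) then 1 else 0.

(** For [s <= t - a] the mean value theorem applies; in the window only the supremum bound is
    available, without a factor [a]; later sources contribute nothing. *)
Lemma dt_kernel_shift (a0 a t : R) x (h : T) : 0 < a0 -> 0 <= a ->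
  `|dt_kernel a0 (t - a, x) h - dt_kernel a0 (t, x) h| <=
  a * dtt_sup a0 + dt_sup (n := n) a0 / a0 * time_win a t h.1.
Proof.
move=> a00 a1; have C0 := mulr_ge0 a1 (dtt_sup_ge0 a0).
have D0 : 0 <= dt_sup (n := n) a0 / a0 by rewrite divr_ge0 ?dt_sup_ge0// ltW.
case: h => s y; have [ht|ht] := leP (s : R) (t - a).
  rewrite /time_win/= ltNge ht/= mulr0 addr0 /dt_kernel/= ht (le_trans ht); last by rewrite gerBl.
  rewrite (_ : t - a - s + a0 = t - s + a0 - a); last ring.
  apply: heat_dt_lipschitz => //.
  by rewrite addrAC lerDr addrAC subr_ge0.
have -> : time_win a t (s, y).1 = if s <= t then 1 else 0.
  rewrite /time_win; congr (if _ then _ else _); apply: andb_idl => _; exact: ht.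
rewrite {1}/dt_kernel/= ifN -?ltNge//= sub0r normrN.
case: ifPn => [th|/negbTE th]; last first.
  by rewrite /dt_kernel/= th normr0 mulr0 addr0.
rewrite mulr1; apply: le_trans (dt_kernel_le _ _ a00 (lexx _)) _.
by rewrite lerDr.
Qed.

Variable f : T -> R.
Hypotheses (if1 : m.-integrable setT (EFin \o f))
           (if2 : m.-integrable setT (EFin \o (fun h => f h ^+ 2))).

Definition dt_op a w := \int[m]_h (dt_kernel a w h * f h).

Let K_bdd (a0 : R) : 0 < a0 ->
  exists B : R, forall (a : R) (w h : T), a0 <= a -> `|dt_kernel a w h| <= B.
Proof. by move=> a00; eexists => a w h; exact: dt_kernel_le. Qed.

Lemma measurable_dt_op (a : R) : 0 < a -> measurable_fun setT (dt_op a).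
Proof. exact: (measurable_kernel_op (fun c _ => measurable_dt_kernel c) if1). Qed.

Lemma integrable_dt_op (a : R) w : 0 < a ->
  m.-integrable setT (EFin \o (fun h => dt_kernel a w h * f h)).
Proof. exact: (integrable_kernel (fun c _ => measurable_dt_kernel c) K_bdd if1). Qed.

Lemma dt_op_L2 (a : R) : 0 < a ->
  (\int[m]_w (dt_op a w ^+ 2)%:E <= \int[m]_h (f h ^+ 2)%:E)%E.
Proof.
exact: (kernel_op_L2 (fun c _ => measurable_dt_kernel c) K_bdd dt_kernel_sqr_bounded
  measurable_sim_times measure_sim_times dt_kernel_mul if1 if2).
Qed.

Lemma dt_op_cauchy (e : R) : 0 < e -> exists2 del : R, 0 < del &
  forall a b, 0 < a < del -> 0 < b < del ->
    (\int[m]_w (`|dt_op a w - dt_op b w| ^+ 2)%:E <= e%:E)%E.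
Proof.
exact: (kernel_op_cauchy (fun c _ => measurable_dt_kernel c) K_bdd dt_kernel_sqr_bounded
  measurable_sim_times measure_sim_times dt_kernel_mul if1 if2).
Qed.

Let S := \int[m]_h `|f h|.

Let S0 : 0 <= S. Proof. exact: Rintegral_ge0. Qed.

Let time_window (a t : R) (h : T) : R := time_win a t h.1 * `|f h|.

Let mf : measurable_fun setT f.
Proof. by have /integrableP[/measurable_EFinP] := if1. Qed.

Let measurable_time_window2 (a : R) :
  measurable_fun setT (fun p : measurableTypeR R * T => (time_window a p.1 p.2)%:E).
Proof.
apply/measurable_EFinP; apply: measurable_funM; last first.
  by apply: measurableT_comp => //; exact: measurableT_comp mf measurable_snd.
have m1 : measurable_fun setT (fun p : measurableTypeR R * T => p.2.1 : R).
  exact: measurableT_comp measurable_fst measurable_snd.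
have m2 : measurable_fun setT (fun p : measurableTypeR R * T => p.1 : R).
  exact: measurable_fst.
apply: measurable_fun_ifT => //; apply: measurable_and.
  by apply: measurable_fun_ltr => //; apply: measurable_funB.
exact: measurable_fun_ler.
Qed.

Let measurable_time_window (a t : R) : measurable_fun setT (fun h : T => (time_window a t h)%:E).
Proof. exact: measurableT_comp (measurable_time_window2 a) (pair1_measurable (t : measurableTypeR R)). Qed.

Let time_window_ge0 (a t : R) (h : T) : 0 <= time_window a t h.
Proof. by rewrite mulr_ge0// /time_win; case: ifP. Qed.

Lemma dt_op_shift (a0 a t : R) x : 0 < a0 -> 0 <= a ->
  (`|dt_op a0 (t - a, x) - dt_op a0 (t, x)|%:E <=
   (a * dtt_sup a0 * S)%:E + (dt_sup (n := n) a0 / a0)%:E *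
     \int[m]_h (time_window a t h)%:E)%E.
Proof.
move=> a00 a1.
have i1 := integrable_dt_op (t - a, x) a00; have i2 := integrable_dt_op (t, x) a00.
have D0 : 0 <= dt_sup (n := n) a0 / a0 by rewrite divr_ge0 ?dt_sup_ge0// ltW.
have mI := measurable_time_window a t.
have aD0 : 0 <= a * dtt_sup a0 by rewrite mulr_ge0 ?dtt_sup_ge0.
have mK c w : 0 < c -> measurable_fun setT (fun h => dt_kernel c w h * f h).
  by move=> c0; have /integrableP[/measurable_EFinP] := integrable_dt_op w c0.
rewrite /dt_op -RintegralB//.
apply: le_trans (abs_Rintegral_le _ _) _.
  by apply: measurable_funB; exact: mK.
apply: (@le_trans _ _ (\int[m]_h ((a * dtt_sup a0)%:E * `|f h|%:E +
  (dt_sup (n := n) a0 / a0)%:E * (time_window a t h)%:E))%E).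
  apply: ge0_le_integral_nomeas => // h _.
  rewrite -!EFinM -EFinD lee_fin -mulrBl normrM.
  apply: le_trans (ler_wpM2r (normr_ge0 _) (dt_kernel_shift _ _ _ a00 a1)) _.
  by rewrite /time_window mulrDl -[X in _ + X <= _]mulrA.
have mnf : measurable_fun setT (fun h => `|f h|%:E) by apply/measurable_EFinP; exact: measurableT_comp.
rewrite ge0_integralD//; last 4 first.
- by move=> h _; rewrite -EFinM lee_fin mulr_ge0.
- exact: measurable_funeM.
- by move=> h _; rewrite mule_ge0 ?lee_fin.
- exact: measurable_funeM.
rewrite !ge0_integralZl//; last first.
- by move=> h _; rewrite lee_fin.
have -> : ((a * dtt_sup a0 * S)%:E = (a * dtt_sup a0)%:E * \int[m]_h `|f h|%:E)%E.
  rewrite EFinM /S /Rintegral fineK//.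
  by apply: integrable_fin_num => //; exact: (integrable_norm if1).
by [].
Qed.

(** The window term [I a t] is not small at a given [t], but it is at most [S] and has integral
    [a * S] in [t], so the integral of its square is at most [a * S ^+ 2]. *)
Lemma dt_op_shift_L2 (a0 : R) (A : set R) (B : set 'rV[R]_n) :
  0 < a0 -> measurable A -> measurable B -> (leb A < +oo)%E -> (lam B < +oo)%E ->
  exists C : R, forall a : R, 0 <= a <= 1 ->
    (\int[m]_(w in A `*` B)
      (`|dt_op a0 ((w.1 - a)%R, w.2) - dt_op a0 w| ^+ 2)%:E <= (C * a)%:E)%E.
Proof.
move=> a00 mA mB Aoo Boo.
have D0 : 0 <= dt_sup (n := n) a0 / a0 by rewrite divr_ge0 ?dt_sup_ge0// ltW.
have fS : (\int[m]_h `|f h|%:E = S%:E)%E.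
  rewrite /S /Rintegral fineK//.
  by apply: integrable_fin_num => //; exact: (integrable_norm if1).
pose I (a t : R) := \int[m]_h (time_window a t h).
have windowS a t : (\int[m]_h (time_window a t h)%:E <= S%:E)%E.
  rewrite -fS; apply: ge0_le_integral_nomeas => h _; rewrite lee_fin//.
  by rewrite ler_piMl// /time_win; case: ifP.
have IE a t : (\int[m]_h (time_window a t h)%:E = (I a t)%:E)%E.
  rewrite /I /Rintegral fineK// ge0_fin_numE; first exact: le_lt_trans (windowS _ _) (ltry _).
  by apply: integral_ge0 => h _; rewrite lee_fin.
have I0 a t : 0 <= I a t by apply: Rintegral_ge0.
have IS a t : I a t <= S by rewrite -lee_fin -IE.
have mIt a : measurable_fun setT (fun t : measurableTypeR R => (I a t)%:E).
  under eq_fun do rewrite -IE.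
  apply: (@measurable_fun_fubini_tonelli_F _ _ (measurableTypeR R) T R m (fun p => (time_window a p.1 p.2)%:E)) => //.
  by move=> p; rewrite lee_fin.
(* By Tonelli: each source time [u] is in the window exactly for [t] in [[u, u + a[]. *)
have intI a : 0 <= a -> (\int[leb]_t (I a t)%:E = (a * S)%:E)%E.
  move=> a1; under eq_integral do rewrite -IE.
  rewrite (@fubini_tonelli _ _ (measurableTypeR R) T R leb m (fun p => (time_window a p.1 p.2)%:E))//; last first.
    by move=> p; rewrite lee_fin.
  rewrite EFinM -fS -ge0_integralZl//; last first.
    by apply/measurable_EFinP; exact: measurableT_comp.
  apply: eq_integral => -[u z] _; rewrite /time_window/=.
  rewrite (_ : (fun t : measurableTypeR R => _) = (fun t : measurableTypeR R =>
    `|f (u, z)|%:E * (\1_(`[u, u + a[%classic : set R) t)%:E)%E); last first.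
    apply/funext => t; rewrite -EFinM mulrC /time_win indicE mem_setE in_itv/= andbC.
    by rewrite ltrBlDr; case: ifP.
  rewrite ge0_integralZl//; last first.
    by apply/measurable_EFinP; exact: measurable_indic.
  rewrite integral_indic// setIT muleC; congr (_ * _)%E.
  transitivity (lebesgue_measure (`[u, u + a[%classic : set R)); first by [].
  rewrite lebesgue_measure_itv/= lte_fin ltrDl; case: ltP => [_|a2].
    by rewrite -EFinD addrAC subrr add0r.
  by congr EFin; apply/eqP; rewrite eq_le a1 a2.
set c1 := dtt_sup a0; set c0 := dt_sup a0 / a0 in D0 *.
have C1 : 0 <= c1 by exact: dtt_sup_ge0.
have shift (a t : R) x : 0 <= a ->
    `|dt_op a0 (t - a, x) - dt_op a0 (t, x)| <= a * c1 * S + c0 * I a t.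
  by move=> a1; rewrite -lee_fin EFinD [X in (_ + X)%E]EFinM -IE; exact: dt_op_shift.
clearbody c1 c0.
pose vB := fine (lam B); pose vA := fine (leb A).
exists (2 * (c1 * S) ^+ 2 * vA * vB + 2 * c0 ^+ 2 * S * S * vB) => a /andP[a1 ale].
have k1 : 0 <= 2 * (a * c1 * S) ^+ 2 by rewrite mulr_ge0 ?sqr_ge0.
have k2 : 0 <= 2 * c0 ^+ 2 * S by rewrite mulr_ge0// mulr_ge0// sqr_ge0.
apply: (@le_trans _ _ (\int[m]_w ((2 * (a * c1 * S) ^+ 2)%:E * ((\1_A w.1 : R) * (\1_B w.2 : R))%:E +
   (2 * c0 ^+ 2 * S)%:E * (I a w.1 * (\1_B w.2 : R))%:E)))%E.
  rewrite integral_mkcond; apply: ge0_le_integral_nomeas => -[t x] _; rewrite patchE/=.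
    by case: ifPn => //; rewrite lee_fin sqr_ge0.
  case: ifPn => [|_]; last first.
    by rewrite -!EFinM -EFinD lee_fin addr_ge0// mulr_ge0// mulr_ge0.
  rewrite inE/= => -[At Bx]; rewrite !indicE !mem_set// !mulr1 -!EFinM -EFinD lee_fin mulr1.
  have H := shift _ t x a1.
  have H2 := I0 a t; have H3 := IS a t.
  have U0 : 0 <= a * c1 * S by rewrite !mulr_ge0.
  apply: (@le_trans _ _ ((a * c1 * S + c0 * I a t) ^+ 2)).
    by rewrite lerXn2r ?nnegrE// addr_ge0// mulr_ge0.
  apply: (@le_trans _ _ (2 * (a * c1 * S) ^+ 2 + 2 * (c0 * I a t) ^+ 2)).
    rewrite sqrrD; have := sqr_ge0 (a * c1 * S - c0 * I a t); rewrite sqrrB; lra.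
  have := ler_wpM2l (mulr_ge0 (mulr_ge0 (ler0n R 2) (sqr_ge0 c0)) H2) H3.
  lra.
have mA1 : measurable_fun setT (fun t : measurableTypeR R => \1_A t : R) by exact: measurable_indic.
have mB1 : measurable_fun setT (fun x : 'rV[R]_n => \1_B x : R) by exact: measurable_indic.
have mIa : measurable_fun setT (fun t : measurableTypeR R => I a t) by apply/(@measurable_EFinP _ (measurableTypeR R)); exact: mIt.
have intB : (\int[lam]_x (\1_B x)%:E = vB%:E)%E.
  by rewrite integral_indic// setIT /vB fineK// ge0_fin_numE.
have intA : (\int[leb]_t (\1_A t)%:E = vA%:E)%E.
  by rewrite integral_indic// setIT /vA fineK// ge0_fin_numE.
have P1 : (\int[m]_w ((\1_A w.1 : R) * (\1_B w.2 : R))%:E = (vA * vB)%:E)%E.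
  by rewrite EFinM -intA -intB; apply: (integral_mul_prod leb lam mA1 mB1).
have P2 : (\int[m]_w (I a w.1 * (\1_B w.2 : R))%:E = (a * S * vB)%:E)%E.
  by rewrite EFinM -intI// -intB; apply: (integral_mul_prod leb lam mIa mB1).
have vA0 : 0 <= vA by rewrite fine_ge0.
have vB0 : 0 <= vB by rewrite fine_ge0.
have mP1 : measurable_fun setT (fun w : T => ((\1_A w.1 : R) * (\1_B w.2 : R))%:E).
  apply/measurable_EFinP; apply: measurable_funM.
    exact: measurableT_comp mA1 measurable_fst.
  exact: measurableT_comp mB1 measurable_snd.
have mP2 : measurable_fun setT (fun w : T => (I a w.1 * (\1_B w.2 : R))%:E).
  apply/measurable_EFinP; apply: measurable_funM.
    exact: measurableT_comp mIa measurable_fst.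
  exact: measurableT_comp mB1 measurable_snd.
rewrite ge0_integralD//; last 4 first.
- by move=> w _; rewrite -EFinM lee_fin !mulr_ge0.
- exact: measurable_funeM.
- by move=> w _; rewrite -EFinM lee_fin !mulr_ge0.
- exact: measurable_funeM.
rewrite ge0_integralZl// ge0_integralZl//; last by move=> w _; rewrite lee_fin mulr_ge0.
rewrite [X in (_ * X + _)%E]P1 [X in (_ + _ * X)%E]P2 -!EFinM -EFinD lee_fin.
rewrite [leRHS]mulrDl; apply: lerD; last first.
  by rewrite le_eqVlt; apply/orP; left; apply/eqP; ring.
(* Here [a <= 1] turns the quadratic Lipschitz term into a linear one. *)
have -> : 2 * (a * c1 * S) ^+ 2 * (vA * vB) = a * (2 * (c1 * S) ^+ 2 * vA * vB * a) by ring.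
by rewrite ler_piMl// mulr_ge0// mulr_ge0// mulr_ge0// mulr_ge0// sqr_ge0.
Qed.

Lemma integral_time_translate (a : R) (F : T -> \bar R) :
  measurable_fun setT F -> (forall w, (0 <= F w)%E) ->
  (\int[m]_w F ((w.1 - a)%R, w.2) = \int[m]_w F w)%E.
Proof.
move=> mF F0; have mFa : measurable_fun setT (fun w : T => F (w.1 - a, w.2)).
  apply: (measurableT_comp mF); apply: measurable_fun_pair; last exact: measurable_snd.
  exact: measurableT_comp (measurable_translate a) measurable_fst.
transitivity (\int[lam]_x \int[leb]_t F ((t - a)%R, x))%E.
  exact: (@fubini_tonelli2 _ _ _ _ _ leb lam (fun w => F (w.1 - a, w.2))).
transitivity (\int[lam]_x \int[leb]_t F (t, x))%E; last first.
  by apply/esym; exact: (@fubini_tonelli2 _ _ _ _ _ leb lam F).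
apply: eq_integral => x _.
apply: (@ge0_integral_translate _ a (fun t => F (t, x))) => //.
exact: measurableT_comp mF (pair2_measurable x).
Qed.

Definition dt_trunc (a : R) (w : T) := dt_op a (w.1 - a, w.2).

Lemma measurable_dt_trunc (a : R) : 0 < a -> measurable_fun setT (dt_trunc a).
Proof.
move=> a0; apply: (measurableT_comp (measurable_dt_op a0)).
apply: measurable_fun_pair; last exact: measurable_snd.
exact: measurableT_comp (measurable_translate a) measurable_fst.
Qed.

Lemma dt_trunc_L2 (a : R) : 0 < a ->
  (\int[m]_w (dt_trunc a w ^+ 2)%:E <= \int[m]_h (f h ^+ 2)%:E)%E.
Proof.
move=> a0; apply: le_trans (dt_op_L2 a0).
rewrite (integral_time_translate a (F := fun w => (dt_op a w ^+ 2)%:E))//.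
  by apply/measurable_EFinP; apply: measurable_funX; exact: measurable_dt_op.
by move=> w; rewrite lee_fin sqr_ge0.
Qed.

(** Both truncations are compared with a fixed delay [eta]: replacing the delay by [eta] is uniform
    and commutes with translation, and only the operator of delay [eta] is then translated, with
    constants independent of [a] and [b]. Four terms with a factor 4 for the square give
    [e / 16]. *)
Lemma dt_trunc_cauchy (A : set R) (B : set 'rV[R]_n) (e : R) :
  measurable A -> measurable B -> (leb A < +oo)%E -> (lam B < +oo)%E -> 0 < e ->
  exists2 del : R, 0 < del & forall a b : R, 0 < a < del -> 0 < b < del ->
    (\int[m]_(w in A `*` B) (`|dt_trunc a w - dt_trunc b w| ^+ 2)%:E <= e%:E)%E.
Proof.
move=> mA mB Aoo Boo e0; have e16 : 0 < e / 16 by rewrite divr_gt0.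
have [d d0 hd] := dt_op_cauchy e16.
pose eta := d / 2; have eta0 : 0 < eta by rewrite divr_gt0.
have etad : 0 < eta < d by rewrite eta0/= /eta; lra.
have [C hC] := dt_op_shift_L2 eta0 mA mB Aoo Boo.
pose C' := `|C| + 1; have C'0 : 0 < C' by rewrite ltr_wpDl.
exists (Num.min d (Num.min 1 (e / 16 / C'))).
  by rewrite !lt_min d0 ltr01 divr_gt0.
have small a : 0 <= a -> a <= e / 16 / C' -> C * a <= e / 16.
  move=> a0; rewrite ler_pdivlMr// => aC; apply: le_trans aC.
  by rewrite mulrC ler_wpM2l// (le_trans (ler_norm _))// lerDl.
move=> a b; rewrite !lt_min => /and4P[a0 ad a1 aC] /and4P[b0 bd b1 bC].
have mAB : measurable (A `*` B) by exact: measurableX.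
pose tr c (w : T) : T := (w.1 - c, w.2).
have mtr c : measurable_fun setT (tr c).
  apply: measurable_fun_pair; last exact: measurable_snd.
  exact: measurableT_comp (measurable_translate c) measurable_fst.
have mg c c' : 0 < c -> measurable_fun setT (fun w => dt_op c (tr c' w)).
  by move=> c0; exact: measurableT_comp (measurable_dt_op c0) (mtr c').
have mgeta := measurable_dt_op eta0.
pose sq (u v : T -> R) w := (`|u w - v w| ^+ 2)%:E.
have msq u v : measurable_fun setT u -> measurable_fun setT v -> measurable_fun setT (sq u v).
  move=> mu mv; apply/measurable_EFinP; apply: measurable_funX.
  by apply: measurableT_comp => //; exact: measurable_funB.
have sq0 u v w : (0 <= sq u v w)%E by rewrite lee_fin sqr_ge0.
have I1 c c' : 0 < c < d -> (\int[m]_(w in A `*` B)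
    sq (fun w => dt_op c (tr c' w)) (fun w => dt_op eta (tr c' w)) w <= (e / 16)%:E)%E.
  move=> cd; have /andP[c0 _] := cd.
  apply: (@le_trans _ _ (\int[m]_w sq (fun w => dt_op c (tr c' w)) (fun w => dt_op eta (tr c' w)) w)%E).
    by apply: ge0_subset_integral => //; apply: msq; exact: mg.
  have mse : measurable_fun setT (sq (dt_op c) (dt_op eta)).
    by apply: msq => //; exact: measurable_dt_op.
  have -> := integral_time_translate c' mse (sq0 _ _).
  exact: hd.
have I2 c : 0 < c -> c < 1 -> c < e / 16 / C' -> (\int[m]_(w in A `*` B)
    sq (fun w => dt_op eta (tr c w)) (dt_op eta) w <= (e / 16)%:E)%E.
  move=> c0 c1 cC; apply: le_trans (hC c _) _; first by rewrite !ltW.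
  by rewrite lee_fin small// ltW.
pose s1 := sq (dt_trunc a) (fun w => dt_op eta (tr a w)).
pose s2 := sq (fun w => dt_op eta (tr a w)) (dt_op eta).
pose s3 := sq (fun w => dt_op eta (tr b w)) (dt_op eta).
pose s4 := sq (dt_trunc b) (fun w => dt_op eta (tr b w)).
have ms1 : measurable_fun (A `*` B) s1 by apply: measurable_funTS; apply: msq; exact: mg.
have ms2 : measurable_fun (A `*` B) s2 by apply: measurable_funTS; apply: msq => //; exact: mg.
have ms3 : measurable_fun (A `*` B) s3 by apply: measurable_funTS; apply: msq => //; exact: mg.
have ms4 : measurable_fun (A `*` B) s4 by apply: measurable_funTS; apply: msq; exact: mg.
have s10 w : (0 <= s1 w)%E := sq0 _ _ w.
have s20 w : (0 <= s2 w)%E := sq0 _ _ w.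
have s30 w : (0 <= s3 w)%E := sq0 _ _ w.
have s40 w : (0 <= s4 w)%E := sq0 _ _ w.
apply: (@le_trans _ _ (\int[m]_(w in A `*` B) (4%:E * (s1 w + s2 w + s3 w + s4 w)))%E).
  apply: ge0_le_integral_nomeas => w _; first by rewrite lee_fin sqr_ge0.
  rewrite /s1 /s2 /s3 /s4 /sq -!EFinD -EFinM lee_fin !real_normK ?num_real//.
  rewrite -/(dt_trunc a w); move: (dt_trunc a w) (dt_trunc b w) (dt_op eta (tr a w)) (dt_op eta (tr b w)) (dt_op eta w) => p q u v k.
  (* The six pairwise differences of the four summands show that the square of the sum is at most
     four times the sum of the squares. *)
  have := sqr_ge0 (p - u - (u - k)); have := sqr_ge0 (p - u - (k - v)).
  have := sqr_ge0 (p - u - (v - q)); have := sqr_ge0 (u - k - (k - v)).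
  have := sqr_ge0 (u - k - (v - q)); have := sqr_ge0 (k - v - (v - q)).
  rewrite !expr2; lra.
rewrite ge0_integralZl//; last 2 first.
- by apply: emeasurable_funD => //; apply: emeasurable_funD => //; apply: emeasurable_funD.
- by move=> w _; rewrite !adde_ge0.
rewrite ge0_integralD//; last 2 first.
- by move=> w _; rewrite !adde_ge0.
- by apply: emeasurable_funD => //; apply: emeasurable_funD.
rewrite ge0_integralD//; last 2 first.
- by move=> w _; rewrite !adde_ge0.
- by apply: emeasurable_funD.
rewrite ge0_integralD//.
have -> : e = 4 * (e / 16 + e / 16 + e / 16 + e / 16) by lra.
rewrite EFinM lee_wpmul2l ?lee_fin// !EFinD.
apply: leeD; last by apply: I1; rewrite b0.
apply: leeD; last exact: I2.
apply: leeD; last exact: I2.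
by apply: I1; rewrite a0.
Qed.

End heat_time_operator.

(** * Oscillation against Gaussian weights *)

Section euclidean_balls.
Context {R : realType} {n : nat}.
Implicit Types (x y z : 'rV[R]_n).
Local Notation leb := (@lebesgue_measure R).
Local Notation lam := (lebesgue_rV (R := R) n).

Lemma eballE x (r : R) y : 0 < r -> eball x r y <-> sqn (y - x) < r ^+ 2.
Proof.
move=> r0; rewrite /eball/= -enorm_sqr ltr_pXn2r// nnegrE ?(ltW r0)//.
exact: sqrtr_ge0.
Qed.

Lemma measurable_eball x (r : R) : 0 < r -> measurable (eball x r).
Proof.
move=> r0; have mf : measurable_fun setT (fun y => sqn (y - x)).
  by apply: measurable_sqn; exact: measurable_sub_rV.
have := measurable_fun_ltr mf (measurable_cst (r ^+ 2)) measurableT (Y := [set true]) I.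
rewrite setTI (_ : _ @^-1` _ = eball x r)//.
by apply/seteqP; split => y /=; rewrite eballE.
Qed.

Lemma eball_le x (r s : R) : r <= s -> eball x r `<=` eball x s.
Proof. by move=> rs y; rewrite /eball/= => /lt_le_trans; apply. Qed.

Lemma eball_measure_ub x (r : R) : 0 < r -> (lam (eball x r) <= ((2 * r) ^+ n)%:E)%E.
Proof.
move=> r0; pose A (i : 'I_n) := `](x ord0 i - r), (x ord0 i + r)[%classic : set R.
have mA i : measurable (A i) by exact: measurable_itv.
apply: (@le_trans _ _ (lam [set y | forall i, A i (y ord0 i)])).
  apply: le_measure; rewrite ?inE; [exact: measurable_eball|exact: measurable_box|].
  move=> y /eballE-/(_ r0) yr i; rewrite /A/= in_itv/= -ltr_distlC distrC.
  rewrite -(@ltr_pXn2r _ 2)// ?nnegrE ?normr_ge0 ?(ltW r0)// real_normK ?num_real//.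
  apply: le_lt_trans yr; have := sqn_coord (y - x) i; by rewrite !mxE.
rewrite lebesgue_rV_box// (eq_bigr (fun=> (2 * r)%:E)); last first.
  move=> i _; rewrite /A lebesgue_measure_itv/= lte_fin ifT; last lra.
  by rewrite -EFinD; congr EFin; ring.
by rewrite -(big_morph EFin (@EFinM R) (erefl _)) prodr_const card_ord.
Qed.

(** Inscribed cube of half-side [r / n]; this is smaller than the optimal [r / sqrt n] but rational
    in [n]. *)
Lemma eball_measure_lb x (r : R) : (0 < n)%N -> 0 < r ->
  (((2 * r / n%:R) ^+ n)%:E <= lam (eball x r))%E.
Proof.
move=> n0 r0; have nR : 0 < n%:R :> R by rewrite ltr0n.
pose s := r / n%:R; have s0 : 0 < s by rewrite divr_gt0.
pose A (i : 'I_n) := `](x ord0 i - s), (x ord0 i + s)[%classic : set R.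
have mA i : measurable (A i) by exact: measurable_itv.
apply: (@le_trans _ _ (lam [set y | forall i, A i (y ord0 i)])); last first.
  apply: le_measure; rewrite ?inE; [exact: measurable_box|exact: measurable_eball|].
  move=> y yA; apply/eballE => //.
  apply: (@lt_le_trans _ _ (\sum_(i < n) s ^+ 2)).
    apply: ltr_sum => [|i _]; first by apply/hasP; exists (Ordinal n0) => //; rewrite mem_index_enum.
    rewrite !mxE -real_normK ?num_real// ltrXn2r ?nnegrE ?(ltW s0)//.
    by have := yA i; rewrite /A/= in_itv/= -ltr_distlC distrC.
  rewrite sumr_const card_ord -mulr_natl /s expr_div_n.
  have n1 : 1 <= n%:R :> R by rewrite ler1n.
  have -> : n%:R * (r ^+ 2 / n%:R ^+ 2) = r ^+ 2 / n%:R by field; rewrite lt0r_neq0.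
  by rewrite ler_pdivrMr// ler_peMr ?sqr_ge0.
rewrite lebesgue_rV_box// (eq_bigr (fun=> (2 * r / n%:R)%:E)); last first.
  move=> i _; rewrite /A lebesgue_measure_itv/= lte_fin ifT; last lra.
  by rewrite -EFinD; congr EFin; rewrite /s; ring.
by rewrite -(big_morph EFin (@EFinM R) (erefl _)) prodr_const card_ord.
Qed.

End euclidean_balls.

Section gauss_weight_series.
Context {R : realType} {n : nat}.
Implicit Types (x y z : 'rV[R]_n).

(** The value of [(m / u) ^+ m] for [m = n + 1] and [u = 4 ^ (k - 1) / 64], the exponent of the
    weight just outside the ball of radius [2 ^ (k - 1) * r]. *)
Definition dyadic_cst (k : nat) : R := (256 * n.+1%:R) ^+ n.+1 / (4 ^+ k) ^+ n.+1.

Lemma dyadic_cst_ge0 k : 0 <= dyadic_cst k.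
Proof. by rewrite /dyadic_cst divr_ge0 ?exprn_ge0 ?mulr_ge0 ?ler0n. Qed.

Lemma gauss_weight_ge0 (r : R) z : 0 <= gauss_weight r z.
Proof. exact: expR_ge0. Qed.

(** From [expR u = expR (u / m) ^+ m] and [expR (u / m) >= u / m]. *)
Lemma expRN_le (u : R) (m : nat) : (0 < m)%N -> 0 < u -> expR (- u) <= (m%:R / u) ^+ m.
Proof.
move=> m0 u0; have mR : 0 < m%:R :> R by rewrite ltr0n.
have um : 0 < u / m%:R by rewrite divr_gt0.
rewrite expRN -[m%:R / u]invrK invf_div exprVn lef_pV2 ?posrE ?expR_gt0 ?exprn_gt0//.
have {2}-> : u = m%:R * (u / m%:R) by rewrite mulrC divfK ?lt0r_neq0.
rewrite expRM_natl ler_pXn2r ?nnegrE ?expR_ge0 ?(ltW um)//.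
by apply: le_trans (expR_ge1Dx _); rewrite lerDr.
Qed.

(* The loss of the factor [4 ^+ k] to the power [n + 1] leaves a geometric series once the
   volumes of the dyadic balls are accounted for. *)
Lemma gauss_weight_dyadic (r : R) x y : 0 < r ->
  exists k, eball x (2 ^+ k * r) y /\ gauss_weight r (y - x) <= dyadic_cst k.
Proof.
move=> r0; have r20 : 0 < r ^+ 2 by rewrite exprn_gt0.
have ball k : eball x (2 ^+ k * r) y <-> sqn (y - x) < 4 ^+ k * r ^+ 2.
  rewrite eballE ?mulr_gt0 ?exprn_gt0// exprMn -exprM mulnC exprM.
  by rewrite (_ : 2 ^+ 2 = 4 :> R)//; ring.
have ex : exists k, sqn (y - x) < 4 ^+ k * r ^+ 2.
  exists (Num.bound (sqn (y - x) / r ^+ 2)); rewrite -ltr_pdivrMr//.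
  apply: lt_le_trans (archi_boundP _) _; first by rewrite divr_ge0 ?sqn_ge0 ?ltW.
  by rewrite -natrX ler_nat ltnW// ltn_expl.
(* For the least such [k], either [k = 0] and the constant exceeds 1, or [y] lies outside the
   previous ball and the weight is small. *)
have [k kP kmin] := ex_minnP ex; exists k; split; first exact/ball.
case: k kP kmin => [|k] kP kmin.
  rewrite /dyadic_cst expr0 expr1n divr1 (@le_trans _ _ 1)//.
    by rewrite /gauss_weight -expR0 ler_expR oppr_le0 divr_ge0 ?sqn_ge0 ?mulr_ge0 ?ltW.
  by rewrite exprn_ege1// -natrM ler1n muln_gt0.
have low : 4 ^+ k * r ^+ 2 <= sqn (y - x).
  by rewrite leNgt; apply/negP => /kmin; rewrite ltnn.
have k0 : 0 < 4 ^+ k / 64 :> R by rewrite divr_gt0 ?exprn_gt0.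
apply: (@le_trans _ _ (expR (- (4 ^+ k / 64)))).
  rewrite ler_expR lerN2 ler_pdivlMr ?mulr_gt0//.
  by have -> : 4 ^+ k / 64 * (64 * r ^+ 2) = 4 ^+ k * r ^+ 2 by field.
apply: le_trans (expRN_le (ltn0Sn n) k0) _.
rewrite /dyadic_cst -expr_div_n.
rewrite (_ : n.+1%:R / (4 ^+ k / 64) = 256 * n.+1%:R / 4 ^+ k.+1)//.
by rewrite (exprS 4); field; rewrite expf_neq0.
Qed.

Lemma gauss_weight_series (r : R) x y : 0 < r ->
  ((gauss_weight r (y - x))%:E <=
   \sum_(k <oo) (dyadic_cst k * \1_(eball x (2 ^+ k * r)) y)%:E)%E.
Proof.
move=> r0; have [k [kB kw]] := gauss_weight_dyadic x y r0.
have nn i : (0 <= (dyadic_cst i * \1_(eball x (2 ^+ i * r)) y)%:E)%E.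
  by rewrite lee_fin mulr_ge0 ?dyadic_cst_ge0.
apply: le_trans (nneseries_lim_ge k.+1 (fun i _ _ => nn i)).
rewrite big_nat_recr//= indicE mem_set// mulr1.
apply: (@le_trans _ _ (dyadic_cst k)%:E); first by rewrite lee_fin.
by rewrite leeDr// sume_ge0.
Qed.

Lemma nneseries_geometric_le (A : R) (u : nat -> R) : 0 <= A ->
  (forall k, 0 <= u k) -> (forall k, u k <= A / 4 ^+ k) ->
  (\sum_(k <oo) (u k)%:E <= (2 * A)%:E)%E.
Proof.
move=> A0 u0 uA; apply: lime_le; first by apply: is_cvg_nneseries => k _ _; rewrite lee_fin.
apply: nearW => N; rewrite sumEFin lee_fin.
(* The subtracted tail lets the induction close. *)
apply: (@le_trans _ _ (2 * A - 2 * A / 4 ^+ N)); last first.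
  by rewrite gerBl divr_ge0 ?mulr_ge0// exprn_ge0.
elim: N => [|N IH]; first by rewrite big_nil expr0 divr1 subrr.
rewrite big_nat_recr//= exprS invfM; have := uA N.
have : 0 <= A / 4 ^+ N by rewrite divr_ge0// exprn_ge0.
move: IH; rewrite -!mulrA (mulrCA A 4^-1); move: (A / 4 ^+ N) => q; lra.
Qed.

End gauss_weight_series.

Section dyadic_constants.
Context {R : realType} {n : nat}.

Lemma dyadic_cst_geometric (r K v : R) k : 0 < r -> 0 <= K -> 0 <= v ->
  v <= (2 * (2 ^+ k * r)) ^+ n ->
  dyadic_cst (n := n) k * (v ^+ 2 * K) <=
  (256 * n.+1%:R) ^+ n.+1 * (2 * r) ^+ n * (2 * r) ^+ n * K / 4 ^+ k.
Proof.
move=> r0 K0 v0; pose q : R := 2 ^+ k; have q0 : 0 < q by rewrite exprn_gt0.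
have -> : 4 ^+ k = q * q by rewrite -exprMn; congr (_ ^+ _); ring.
rewrite /dyadic_cst (_ : 4 ^+ k = q * q); last by rewrite -exprMn; congr (_ ^+ _); ring.
rewrite -/q (_ : 2 * (q * r) = 2 * r * q); last by ring.
rewrite (exprMn _ (2 * r)) (exprS (q * q)) (exprMn _ q).
have b0 : 0 < q ^+ n by rewrite exprn_gt0.
have a0 : 0 < (2 * r) ^+ n by rewrite exprn_gt0// mulr_gt0.
have c0 : 0 < (256 * n.+1%:R) ^+ n.+1 :> R by rewrite exprn_gt0 ?mulr_gt0 ?ltr0n.
move: (q ^+ n) ((2 * r) ^+ n) ((256 * n.+1%:R) ^+ n.+1) b0 a0 c0 => b a c b0 a0 c0 vab.
have vv : v ^+ 2 <= (a * b) ^+ 2 by rewrite lerXn2r ?nnegrE// mulr_ge0// ltW.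
apply: (@le_trans _ _ (c / (q * q * (b * b)) * ((a * b) ^+ 2 * K))).
  apply: ler_wpM2l; last exact: ler_wpM2r.
  by rewrite divr_ge0 ?(ltW c0)// !mulr_ge0// ltW.
rewrite le_eqVlt; apply/orP; left; apply/eqP; field.
by rewrite !lt0r_neq0.
Qed.

End dyadic_constants.

(** * Oscillation of f around one of its values *)

Section bmo_oscillation.
Context {R : realType} {n : nat}.
Implicit Types (x y z : 'rV[R]_n).
Local Notation leb := (@lebesgue_measure R).
Local Notation lam := (lebesgue_rV (R := R) n).
Local Notation T := (measurableTypeR R * 'rV[R]_n)%type.
Local Notation m := (sigma_finite_product leb lam).
Local Notation ll := (sigma_finite_product lam lam).
Variables (f : 'rV[R]_n -> R -> R) (K : R).
Hypothesis mf : measurable_upper f.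
Hypothesis K0 : 0 < K.
Hypothesis bmo : forall xB (r : R), 0 < r ->
  (\int[leb]_(t in `]0%R, (r ^+ 2)%R[)
      ((fine (lam (eball xB r)) ^- 2)%:E *
       \int[lam \x lam]_(z in eball xB r `*` eball xB r)
         (`|f z.1 t - f z.2 t| ^+ 2)%:E) <= K%:E)%E.

(** Time comes first, as in the product measure, and the value 0 at nonpositive times turns
    measurability on the half-space into measurability everywhere. *)
Definition upper_ext (w : T) : R := if 0 < w.1 then f w.2 w.1 else 0.

Lemma measurable_upper_ext : measurable_fun setT upper_ext.
Proof.
pose D := [set: 'rV[R]_n] `*` [set t : R | 0 < t].
have mD : measurable D.
  apply: measurableX => //.
  rewrite (_ : [set t : R | 0 < t] = `]0, +oo[%classic); first exact: measurable_itv.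
  by apply/seteqP; split => t /=; rewrite in_itv/= andbT.
have := mf; rewrite /measurable_upper => /(measurable_restrictT _ mD) mfD.
have msw : measurable_fun setT (fun w : T => (w.2, w.1)).
  by apply: measurable_fun_pair; [exact: measurable_snd|exact: measurable_fst].
have := measurableT_comp mfD msw; congr (measurable_fun _ _).
apply/funext => w; rewrite /= patchE /upper_ext; case: ifPn.
  by rewrite inE /D/= => -[_ ->].
by rewrite notin_setE/= => H; case: ifPn => // w0; exfalso; apply: H.
Qed.

Let osc (z : 'rV[R]_n) (h : T) : R := (upper_ext h - upper_ext (h.1, z)) ^+ 2.

Let osc_ge0 z h : 0 <= osc z h. Proof. exact: sqr_ge0. Qed.

Let mosc d (S : measurableType d) (g : S -> 'rV[R]_n) (h : S -> T) :
  measurable_fun setT g -> measurable_fun setT h ->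
  measurable_fun setT (fun w => osc (g w) (h w)).
Proof.
move=> mg mh; apply: measurable_funX; apply: measurable_funB.
  exact: measurableT_comp measurable_upper_ext mh.
apply: (measurableT_comp measurable_upper_ext); apply: measurable_fun_pair => //.
exact: measurableT_comp measurable_fst mh.
Qed.

Let time_osc (A B : set 'rV[R]_n) (s : R) : \bar R :=
  (\int[ll]_z (\1_A z.1 * \1_B z.2 * osc z.1 (s, z.2))%:E)%E.

Let mtime_osc A B : measurable A -> measurable B ->
  measurable_fun setT (time_osc A B : measurableTypeR R -> \bar R).
Proof.
move=> mA mB.
apply: (@measurable_fun_fubini_tonelli_F _ _ (measurableTypeR R) ('rV[R]_n * 'rV[R]_n)%type R ll
  (fun p => (\1_A p.2.1 * \1_B p.2.2 * osc p.2.1 (p.1, p.2.2))%:E)).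
  have m1 d (S : measurableType d) (C : set 'rV[R]_n) (g : S -> 'rV[R]_n) :
      measurable C -> measurable_fun setT g -> measurable_fun setT (fun w => \1_C (g w) : R).
    by move=> mC mg; exact: measurableT_comp (measurable_indic mC) mg.
  have p21 : measurable_fun setT (fun p : measurableTypeR R * ('rV[R]_n * 'rV[R]_n) => p.2.1).
    exact: measurableT_comp measurable_fst measurable_snd.
  have p22 : measurable_fun setT (fun p : measurableTypeR R * ('rV[R]_n * 'rV[R]_n) => p.2.2).
    exact: measurableT_comp measurable_snd measurable_snd.
  apply/measurable_EFinP; apply: measurable_funM.
    by apply: measurable_funM; exact: m1.
  by apply: mosc => //; apply: measurable_fun_pair => //; exact: measurable_fst.
by move=> p; rewrite lee_fin mulr_ge0// mulr_ge0.
Qed.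

Lemma ball_osc_le xB (r : R) : 0 < r -> 0 < fine (lam (eball xB r)) ->
  (\int[leb]_(s in `]0%R, (r ^+ 2)%R[) time_osc (eball xB r) (eball xB r) s <=
   (fine (lam (eball xB r)) ^+ 2 * K)%:E)%E.
Proof.
move=> r0; set v := fine _ => v0; set B := eball xB r.
have mB : measurable B by exact: measurable_eball.
have v20 : 0 < v ^+ 2 by rewrite exprn_gt0.
have H := bmo xB r0.
set X := (\int[leb]_(s in _) _)%E.
suff : ((v ^- 2)%:E * X <= K%:E)%E by rewrite lee_pdivrMl// -EFinM.
rewrite /X -ge0_integralZl; last 4 first.
- exact: measurable_itv.
- by apply: measurable_funTS; exact: mtime_osc.
- by move=> s _; apply: integral_ge0 => z _; rewrite lee_fin mulr_ge0// mulr_ge0.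
- by rewrite lee_fin invr_ge0 ltW.
apply: le_trans H; rewrite le_eqVlt; apply/orP; left; apply/eqP.
apply: eq_integral => s; rewrite inE/= in_itv/= => /andP[s0 _].
congr (_ * _)%E; rewrite [RHS]integral_mkcond; apply: eq_integral => -[z y] _.
rewrite patchE /time_osc/= /osc /upper_ext/= s0 !indicE.
case: ifPn => [|zy]; first by rewrite inE/= => -[Bz By]; rewrite !mem_set// !mul1r real_normK ?num_real// -sqrrN opprB.
case: (boolP (z \in B)) => zB; last by rewrite !mul0r.
case: (boolP (y \in B)) => yB; last by rewrite mulr0 mul0r.
by move: zB yB zy; rewrite !inE notin_setE/= => zB yB; case.
Qed.

(** The hypothesis on the large ball covers times up to [rho ^+ 2] and all pairs of its points;
    restricting to earlier times and to [z] in the small ball only decreases the integral. *)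
Lemma dyadic_osc_le xB (r rho : R) : 0 < r -> r <= rho -> 0 < fine (lam (eball xB rho)) ->
  (\int[lam]_z \int[m]_h (\1_(eball xB r) z * (\1_(`]0%R, (r ^+ 2)%R[%classic) h.1 *
      \1_(eball xB rho) h.2 * osc z h))%:E <=
   (fine (lam (eball xB rho)) ^+ 2 * K)%:E)%E.
Proof.
move=> r0 rrho v0; have rho0 := lt_le_trans r0 rrho.
apply: le_trans (ball_osc_le rho0 v0).
set A := eball xB r; set B := eball xB rho; pose I : set R := `]0, r ^+ 2[%classic.
have mA : measurable A by exact: measurable_eball.
have mB : measurable B by exact: measurable_eball.
have mI : measurable (I : set (measurableTypeR R)) by exact: measurable_itv.
have m1 d (S : measurableType d) d' (S' : measurableType d') (C : set S') (g : S -> S') :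
    measurable C -> measurable_fun setT g -> measurable_fun setT (fun w => \1_C (g w) : R).
  by move=> mC mg; exact: measurableT_comp (measurable_indic mC) mg.
pose G z s y : R := \1_A z * (\1_I s * \1_B y * osc z (s, y)).
have G0 z s y : 0 <= G z s y by do 3 apply: mulr_ge0 => //.
have mG d (S : measurableType d) (g1 : S -> 'rV[R]_n) (g2 : S -> measurableTypeR R) (g3 : S -> 'rV[R]_n) :
    measurable_fun setT g1 -> measurable_fun setT g2 -> measurable_fun setT g3 ->
    measurable_fun setT (fun w => (G (g1 w) (g2 w) (g3 w))%:E).
  move=> mg1 mg2 mg3; apply/measurable_EFinP; apply: measurable_funM; first exact: m1.
  apply: measurable_funM; first by apply: measurable_funM; exact: m1.
  by apply: mosc => //; exact: measurable_fun_pair.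
apply: (@le_trans _ _ (\int[lam]_z \int[leb]_s \int[lam]_y (G z s y)%:E)%E).
  rewrite le_eqVlt; apply/orP; left; apply/eqP; apply: eq_integral => z _.
  apply: (@fubini_tonelli1 _ _ (measurableTypeR R) 'rV[R]_n R leb lam (fun h => (G z h.1 h.2)%:E)).
    by apply: mG.
  by move=> h; rewrite lee_fin.
have -> : (\int[lam]_z \int[leb]_s \int[lam]_y (G z s y)%:E =
    \int[leb]_s \int[lam]_z \int[lam]_y (G z s y)%:E)%E.
  apply: (@fubini_tonelli _ _ 'rV[R]_n (measurableTypeR R) R lam leb
    (fun p => \int[lam]_y (G p.1 p.2 y)%:E)%E); last first.
    by move=> p; apply: integral_ge0 => y _; rewrite lee_fin.
  apply: (@measurable_fun_fubini_tonelli_F _ _ ('rV[R]_n * measurableTypeR R)%type 'rV[R]_n R lam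
    (fun p => (G p.1.1 p.1.2 p.2)%:E)).
    apply: mG; [| |exact: measurable_snd].
      exact: measurableT_comp measurable_fst measurable_fst.
    exact: measurableT_comp measurable_snd measurable_fst.
  by move=> p; rewrite lee_fin.
rewrite [leRHS]integral_mkcond; apply: ge0_le_integral_nomeas => s _.
  by apply: integral_ge0 => z _; apply: integral_ge0 => y _; rewrite lee_fin.
rewrite patchE; case: ifPn => sI; last first.
  rewrite integral0_eq// => z _; rewrite integral0_eq// => y _.
  rewrite /G (_ : \1_I s = 0) ?mul0r ?mulr0// indicE; case: (boolP (s \in I)) => //.
  rewrite inE /I/= in_itv/= => /andP[s0 sr]; exfalso; move: sI; rewrite notin_setE; apply.
  by rewrite /= in_itv/= s0 (lt_le_trans sr)// lerXn2r ?nnegrE ?(ltW r0) ?(ltW rho0).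
have -> : (time_osc B B s = \int[lam]_z \int[lam]_y (\1_B z * \1_B y * osc z (s, y))%:E)%E.
  apply: (@fubini_tonelli1 _ _ 'rV[R]_n 'rV[R]_n R lam lam
    (fun p => (\1_B p.1 * \1_B p.2 * osc p.1 (s, p.2))%:E)).
    apply/measurable_EFinP; apply: measurable_funM.
      by apply: measurable_funM; exact: m1.
    apply: mosc; first exact: measurable_fst.
    by apply: measurable_fun_pair => //; exact: measurable_snd.
  by move=> p; rewrite lee_fin; do 2 apply: mulr_ge0 => //.
apply: ge0_le_integral_nomeas => z _; first by apply: integral_ge0 => y _; rewrite lee_fin.
apply: ge0_le_integral_nomeas => y _; first by rewrite lee_fin.
rewrite lee_fin /G mulrA ler_wpM2r//= mulrCA mulrA ler_wpM2r//.
rewrite (@le_trans _ _ (\1_A z))//.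
  by rewrite ler_piMl// indicE lern1 leq_b1.
rewrite !indicE ler_nat; case: (boolP (z \in A)) => // zA.
by rewrite mem_set//; move: zA; rewrite inE; exact: eball_le.
Qed.

(* The constants removed from [f] at time [t] are its values [f(z, t)] at one well-chosen point
   [z], which avoids averages and their measurability. *)
Definition centered (r : R) z (h : T) : R :=
  \1_(`]0, (r ^+ 2)[%classic) h.1 * (upper_ext h - upper_ext (h.1, z)).

(** Obtained by dividing the bound [2 * A] on the integral over [z] by the lower volume bound
    [(2 r / n) ^+ n], with another factor 2 to have a strict contradiction. *)
Definition bmo_cst : R := 4 * (256 * n.+1%:R) ^+ n.+1 * (2 * n%:R) ^+ n.

Lemma centered_sqr r z h :
  centered r z h ^+ 2 = \1_(`]0, (r ^+ 2)[%classic) h.1 * osc z h.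
Proof. by rewrite /centered exprMn /osc indicE; case: (_ \in _); rewrite ?expr1n ?expr0n. Qed.

(* The bound holds on average over [z] in the ball, by summing the oscillations over dyadic
   enlargements of it, hence at some [z]. *)
Lemma weighted_oscillation xB (r : R) : (0 < n)%N -> 0 < r ->
  exists2 z, eball xB r z &
    (\int[m]_h (gauss_weight r (h.2 - xB) * centered r z h ^+ 2)%:E <=
     (bmo_cst * r ^+ n * K)%:E)%E.
Proof.
move=> n0 r0; set B := eball xB r; pose I : set R := `]0, r ^+ 2[%classic.
pose w y : R := gauss_weight r (y - xB).
have mw : measurable_fun setT w.
  have H := measurable_sqn (measurable_sub_rV xB).
  rewrite /w /gauss_weight; apply: measurableT_comp => //.
  by apply: measurableT_comp => //; apply: measurable_funM.
pose rho k : R := 2 ^+ k * r.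
have rho0 k : 0 < rho k by rewrite mulr_gt0 ?exprn_gt0.
have rrho k : r <= rho k by rewrite ler_peMl ?(ltW r0)// exprn_ege1// ler1n.
have mB : measurable B by exact: measurable_eball.
have mBk k : measurable (eball xB (rho k)) by exact: measurable_eball.
have mI : measurable (I : set (measurableTypeR R)) by exact: measurable_itv.
have nR : 0 < n%:R :> R by rewrite ltr0n.
pose v k := fine (lam (eball xB (rho k))).
have vE k : ((v k)%:E = lam (eball xB (rho k)))%E.
  rewrite /v fineK// ge0_fin_numE//.
  exact: le_lt_trans (eball_measure_ub _ (rho0 k)) (ltry _).
have vlb k : (2 * rho k / n%:R) ^+ n <= v k by rewrite -lee_fin vE eball_measure_lb.
have v0 k : 0 < v k.
  by apply: lt_le_trans (vlb k); rewrite exprn_gt0// divr_gt0// mulr_gt0.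
have vub k : v k <= (2 * rho k) ^+ n by rewrite -lee_fin vE eball_measure_ub.
have m1 d (S : measurableType d) d' (S' : measurableType d') (C : set S') (g : S -> S') :
    measurable C -> measurable_fun setT g -> measurable_fun setT (fun w => \1_C (g w) : R).
  by move=> mC mg; exact: measurableT_comp (measurable_indic mC) mg.
pose G k z h : R := \1_B z * (\1_I h.1 * \1_(eball xB (rho k)) h.2 * osc z h).
have G0 k z h : 0 <= G k z h by do 3 apply: mulr_ge0 => //.
have mG k : measurable_fun setT (fun p : 'rV[R]_n * T => G k p.1 p.2).
  apply: measurable_funM; first by apply: m1 => //.
  apply: measurable_funM; last by apply: mosc.
  apply: measurable_funM; apply: m1 => //.
    exact: measurableT_comp measurable_fst measurable_snd.
  exact: measurableT_comp measurable_snd measurable_snd.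
have mGk k : measurable_fun setT (fun p : 'rV[R]_n * T => (dyadic_cst (n := n) k * G k p.1 p.2)%:E).
  by apply/measurable_EFinP; apply: measurable_funM.
pose Phi z := (\int[m]_h (w h.2 * (\1_I h.1 * osc z h))%:E)%E.
have mPhi : measurable_fun setT Phi.
  apply: (@measurable_fun_fubini_tonelli_F _ _ 'rV[R]_n T R m
    (fun p => (w p.2.2 * (\1_I p.2.1 * osc p.1 p.2))%:E)).
    apply/measurable_EFinP; apply: measurable_funM.
      apply: (measurableT_comp mw); exact: measurableT_comp measurable_snd measurable_snd.
    apply: measurable_funM; last exact: mosc.
    apply: m1 => //; exact: measurableT_comp measurable_fst measurable_snd.
  by move=> p; rewrite lee_fin mulr_ge0 ?gauss_weight_ge0// mulr_ge0.
have Phi0 z : (0 <= Phi z)%E.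
  by apply: integral_ge0 => h _; rewrite lee_fin mulr_ge0 ?gauss_weight_ge0// mulr_ge0.
pose A := (256 * n.+1%:R) ^+ n.+1 * (2 * r) ^+ n * (2 * r) ^+ n * K.
have A0 : 0 < A by rewrite !mulr_gt0 ?exprn_gt0 ?mulr_gt0.
have IPhi : (\int[lam]_(z in B) Phi z <= (2 * A)%:E)%E.
  (* The weight is replaced by its dyadic series and the sum is taken out of both integrals; each
     term is an oscillation over one ball. *)
  apply: (@le_trans _ _ (\sum_(k <oo) (dyadic_cst (n := n) k)%:E * \int[lam]_z \int[m]_h (G k z h)%:E)%E).
    have -> : (\sum_(k <oo) (dyadic_cst (n := n) k)%:E * \int[lam]_z \int[m]_h (G k z h)%:E =
        \int[lam]_z \int[m]_h \sum_(k <oo) (dyadic_cst (n := n) k * G k z h)%:E)%E.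
      have mGz k z : measurable_fun setT (fun h => (dyadic_cst (n := n) k * G k z h)%:E).
        exact: measurableT_comp (mGk k) (pair1_measurable z).
      have GE0 k z h : (0 <= (dyadic_cst (n := n) k * G k z h)%:E)%E.
        by rewrite lee_fin mulr_ge0 ?dyadic_cst_ge0.
      transitivity (\int[lam]_z \sum_(k <oo) \int[m]_h (dyadic_cst (n := n) k * G k z h)%:E)%E; last first.
        apply: eq_integral => z _; apply/esym.
        apply: (@integral_nneseries _ _ _ m setT measurableT (fun k h => (dyadic_cst (n := n) k * G k z h)%:E)) => //.
        by move=> k; exact: mGz.
      transitivity (\sum_(k <oo) \int[lam]_z \int[m]_h (dyadic_cst (n := n) k * G k z h)%:E)%E; last first.
        apply/esym; apply: (@integral_nneseries _ _ _ lam setT measurableT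
          (fun k z => \int[m]_h (dyadic_cst (n := n) k * G k z h)%:E)%E).
      - move=> k; apply: (@measurable_fun_fubini_tonelli_F _ _ 'rV[R]_n T R m
          (fun p => (dyadic_cst (n := n) k * G k p.1 p.2)%:E)) => //.
      - by move=> k z _; apply: integral_ge0 => h _; exact: GE0.
      apply: eq_eseriesr => k _.
      have mGk1 : measurable_fun setT (fun p : 'rV[R]_n * T => (G k p.1 p.2)%:E).
        by apply/measurable_EFinP.
      rewrite -ge0_integralZl//; last 3 first.
      - apply: (@measurable_fun_fubini_tonelli_F _ _ 'rV[R]_n T R m
          (fun p => (G k p.1 p.2)%:E)) => //.
        by move=> p; rewrite lee_fin.
      - by move=> z _; apply: integral_ge0 => h _; rewrite lee_fin.
      - by rewrite lee_fin dyadic_cst_ge0.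
      apply: eq_integral => z _; rewrite -ge0_integralZl//; last 3 first.
      - exact: measurableT_comp mGk1 (pair1_measurable z).
      - by move=> h _; rewrite lee_fin.
      - by rewrite lee_fin dyadic_cst_ge0.
    rewrite integral_mkcond; apply: ge0_le_integral_nomeas => z _; rewrite patchE.
      by case: ifP.
    case: ifPn => zB; last first.
      by apply: integral_ge0 => h _; apply: nneseries_ge0 => k _ _; rewrite lee_fin mulr_ge0 ?dyadic_cst_ge0.
    apply: ge0_le_integral_nomeas => h _.
      by rewrite lee_fin mulr_ge0 ?gauss_weight_ge0// mulr_ge0.
    rewrite EFinM; apply: le_trans (lee_wpmul2r _ (gauss_weight_series xB h.2 r0)) _.
      by rewrite lee_fin mulr_ge0.
    rewrite muleC -nneseriesZl//; last by move=> k _; rewrite lee_fin mulr_ge0 ?dyadic_cst_ge0.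
    rewrite le_eqVlt; apply/orP; left; apply/eqP; apply: eq_eseriesr => k _.
    have zB1 : \1_B z = 1 :> R by rewrite indicE zB.
    by rewrite -EFinM /G zB1 mul1r; congr EFin; rewrite /rho; ring.
  have term k : (\int[lam]_z \int[m]_h (G k z h)%:E <= (v k ^+ 2 * K)%:E)%E.
    exact: (dyadic_osc_le r0 (rrho k) (v0 k)).
  apply: (@le_trans _ _ (\sum_(k <oo) (dyadic_cst (n := n) k * (v k ^+ 2 * K))%:E)%E).
    apply: lee_nneseries => k _.
      rewrite mule_ge0 ?lee_fin ?dyadic_cst_ge0// integral_ge0// => z _.
      by apply: integral_ge0 => h _; rewrite lee_fin.
    by rewrite [leRHS]EFinM; apply: lee_wpmul2l; rewrite ?lee_fin ?dyadic_cst_ge0.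
  apply: nneseries_geometric_le; first exact: ltW.
    by move=> k; rewrite mulr_ge0 ?dyadic_cst_ge0// mulr_ge0 ?sqr_ge0// ltW.
  by move=> k; apply: dyadic_cst_geometric => //; exact: ltW.
have [H|H] := pselect (exists2 z, B z & (Phi z <= (bmo_cst * r ^+ n * K)%:E)%E).
  have [z Bz Hz] := H; exists z => //; apply: le_trans Hz.
  by rewrite /Phi; under eq_integral do rewrite centered_sqr.
(* Otherwise the integral of [Phi] over the ball would be at least [L] times its volume, hence at
   least [4 * A]. *)
exfalso.
pose L := bmo_cst * r ^+ n * K.
have L0 : 0 < L by rewrite !mulr_gt0 ?exprn_gt0 ?mulr_gt0.
have : (L%:E * lam B <= (2 * A)%:E)%E.
  apply: le_trans IPhi; rewrite -integral_cst//.
  apply: ge0_le_integral => //; first by move=> z _; rewrite lee_fin ltW.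
    exact: measurable_funTS.
  by move=> z Bz; rewrite leNgt; apply/negP => /ltW Hz; apply: H; exists z.
apply/negP; rewrite -ltNge -/L.
apply: (@lt_le_trans _ _ (L * (2 * r / n%:R) ^+ n)%:E).
  rewrite lte_fin.
  have -> : L * (2 * r / n%:R) ^+ n = 4 * A.
    rewrite /L /bmo_cst /A expr_div_n !exprMn; field.
    by rewrite expf_neq0// lt0r_neq0.
  by rewrite ltr_pM2r// ltr_nat.
by rewrite EFinM lee_wpmul2l ?lee_fin ?(ltW L0)// eball_measure_lb.
Qed.

End bmo_oscillation.

(** * Invariance of the derivatives under constants *)

Section gauss_constants.
Context {R : realType} {n : nat}.
Implicit Types (x y z : 'rV[R]_n) (h : 'rV[R]_n -> R).
Local Notation lam := (lebesgue_rV (R := R) n).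

Lemma integral_expR_sqn (c : R) : 0 < c ->
  (\int[lam]_y (expR (- (c * sqn y)))%:E < +oo)%E.
Proof.
move=> c0; pose t := (4 * c)^-1; have t0 : 0 < t by rewrite invr_gt0 mulr_gt0.
pose A := Num.sqrt (4 * pi * t) ^+ n.
have A0 : 0 < A by rewrite exprn_gt0// sqrtr_gt0 mulr_gt0 ?mulr_gt0 ?pi_gt0.
under eq_integral => y _.
  rewrite (_ : expR (- (c * sqn y)) = A * heat_kernel t (y - 0)); last first.
    rewrite subr0 heat_kernelE -/A mulrA divff ?mul1r ?lt0r_neq0//.
    by congr expR; rewrite /t; field; rewrite lt0r_neq0.
  rewrite EFinM; over.
rewrite ge0_integralZl//; last 3 first.
- by apply/measurable_EFinP; apply: measurable_heat_kernel => //; exact: measurable_sub_rV.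
- by move=> y _; rewrite lee_fin heat_kernel_ge0.
- by rewrite lee_fin ltW.
by rewrite integral_heat_kernel// mule1 ltry.
Qed.

Lemma gauss_integrable_le h (g : 'rV[R]_n -> R) (c0 : R) :
  measurable_fun setT h -> measurable_fun setT g -> (forall y, 0 <= g y) -> 0 <= c0 ->
  (forall y, `|h y| <= c0 + g y) ->
  (forall c : R, 0 < c -> (\int[lam]_y (expR (- (c * sqn y)) * g y)%:E < +oo)%E) ->
  gauss_integrable h.
Proof.
move=> mh mg g0 c00 hg goo; split => // c c1.
have mE : measurable_fun setT (fun y => expR (- (c * sqn y)) : R) by exact: measurable_expR_sqn.
apply: (@le_lt_trans _ _ (\int[lam]_y (c0%:E * (expR (- (c * sqn y)))%:E + (expR (- (c * sqn y)) * g y)%:E))%E).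
  apply: ge0_le_integral_nomeas => y _; first by rewrite lee_fin mulr_ge0 ?expR_ge0.
  rewrite -EFinM -EFinD lee_fin mulrC (le_trans (ler_wpM2r (expR_ge0 _) (hg y)))//.
  by rewrite mulrDl (mulrC (g y)).
rewrite ge0_integralD//; last 4 first.
- by move=> y _; rewrite -EFinM lee_fin mulr_ge0 ?expR_ge0.
- by apply: measurable_funeM; exact/measurable_EFinP.
- by move=> y _; rewrite lee_fin mulr_ge0 ?expR_ge0.
- by apply/measurable_EFinP; exact: measurable_funM.
rewrite ge0_integralZl//; last exact/measurable_EFinP.
rewrite lte_add_pinfty//; last exact: goo.
by rewrite lte_mul_pinfty// integral_expR_sqn.
Qed.

Lemma gauss_integrable_subcst h (c : R) : gauss_integrable h -> gauss_integrable (fun y => h y - c).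
Proof.
move=> [mh hoo]; apply: (@gauss_integrable_le _ (fun y => `|h y|) `|c|) => //.
- exact: measurable_funB.
- exact: measurableT_comp.
- by move=> y; rewrite addrC (le_trans (ler_normD _ _))// normrN.
Qed.

Lemma heat_subcst h (c t : R) x : gauss_integrable h -> 0 < t ->
  heat t h x = heat t (fun y => h y - c) x + c.
Proof.
move=> gh t0; rewrite /heat.
have ih := integrable_heat_kernel_mul x gh t0.
have ih' := integrable_heat_kernel_mul x (gauss_integrable_subcst c gh) t0.
have ic : lam.-integrable setT (EFin \o (fun y => c * heat_kernel t (x - y))).
  have H := integrableZl measurableT c (integrable_heat_kernel x t0).
  congr (_.-integrable _ _): H; apply/funext => y.
  by rewrite /= (heat_kernelB t x y) EFinM.
have cE : \int[lam]_y (c * heat_kernel t (x - y)) = c.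
  under eq_Rintegral do rewrite heat_kernelB.
  rewrite RintegralZl//; last exact: integrable_heat_kernel.
  by rewrite /Rintegral integral_heat_kernel// mulr1.
rewrite -[X in _ = _ + X]cE -RintegralD//; apply: eq_Rintegral => y _; ring.
Qed.

(** The mean zero of [heat_dt] enters through the mass of [heat_kernel]: [heat] commutes with the
    subtraction of [c], and a constant has zero derivative. *)
Lemma derive1_heat_centered h (s t c : R) x : gauss_integrable h -> s < t ->
  ((fun u => heat (u - s) h x)^`())%classic t =
  \int[lam]_y (heat_dt (t - s) (x - y) * (h y - c)).
Proof.
move=> gh st; have ts : 0 < t - s by rewrite subr_gt0.
have H := @is_derive1_comp _ (fun v => heat v (fun y => h y - c) x) (fun u => u - s) t _ _
  (is_derive_heat x (gauss_integrable_subcst c gh) ts)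
  (is_derive_sub (is_derive_id t 1) (is_derive_cst s t 1)).
have H2 := is_derive_add H (is_derive_cst c t 1).
have E : is_derive t 1 (fun u => heat (u - s) (fun y => h y - c) x + c)
    (\int[lam]_y (heat_dt (t - s) (x - y) * (h y - c))).
  by apply: (is_derive_eq H2); rewrite subr0 mulr1 addr0.
rewrite derive1E; have [_ <-] := E.
apply: near_eq_derive; near=> u; apply: heat_subcst => //.
by rewrite subr_gt0; near: u; exact: lt_nbhsr.
Unshelve. all: by end_near. Qed.

Lemma derive_heat_centered h (t c : R) x i : gauss_integrable h -> 0 < t ->
  'D_(delta_mx ord0 i) (heat t h) x = \int[lam]_y (heat_dx i t (x - y) * (h y - c)).
Proof.
move=> gh t0; rewrite -(derive_heat x i (gauss_integrable_subcst c gh) t0).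
rewrite (_ : heat t h = (fun z => heat t (fun y => h y - c) z + c)); last first.
  by apply/funext => z; exact: (heat_subcst c z gh t0).
(* The difference quotients coincide, so the derivatives do as well, even where [g] is not
   differentiable. *)
suff H (g : 'rV[R]_n -> R) v : 'D_v (fun z => g z + c) x = 'D_v g x by exact: H.
have E : (fun u : R => u^-1 *: (((fun z => g z + c) \o shift x) (u *: v) - (g x + c))) =
    (fun u : R => u^-1 *: ((g \o shift x) (u *: v) - g x)).
  by apply/funext => u; rewrite /= opprD addrACA subrr addr0.
exact: (congr1 (fun F : R -> R => lim (F @ 0^')) E).
Qed.

Lemma measurable_gauss_weight (r : R) d (S : measurableType d) (g : S -> 'rV[R]_n) :
  measurable_fun setT g -> measurable_fun setT (fun w => gauss_weight r (g w)).
Proof.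
move=> mg; have H := measurable_sqn mg; rewrite /gauss_weight.
apply: measurableT_comp => //; apply: measurableT_comp => //.
by apply: measurable_funM.
Qed.

End gauss_constants.

Section good_times.
Context {R : realType} {n : nat}.
Local Notation leb := (@lebesgue_measure R).
Local Notation lam := (lebesgue_rV (R := R) n).
Local Notation T := (measurableTypeR R * 'rV[R]_n)%type.
Local Notation m := (sigma_finite_product leb lam).
Variables (f : 'rV[R]_n -> R -> R) (K : R).
Hypothesis mf : measurable_upper f.
Hypothesis K0 : 0 < K.
Hypothesis bmo : forall xB (r : R), 0 < r ->
  (\int[leb]_(t in `]0%R, (r ^+ 2)%R[)
      ((fine (lam (eball xB r)) ^- 2)%:E *
       \int[lam \x lam]_(z in eball xB r `*` eball xB r)
         (`|f z.1 t - f z.2 t| ^+ 2)%:E) <= K%:E)%E.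
Hypothesis n0 : (0 < n)%N.

Lemma measurable_centered (r : R) z : measurable_fun setT (centered f r z).
Proof.
apply: measurable_funM.
  have mI : measurable (`]0, (r ^+ 2)[%classic : set (measurableTypeR R)) by exact: measurable_itv.
  exact: measurableT_comp (measurable_indic mI) measurable_fst.
apply: measurable_funB; first exact: (measurable_upper_ext mf).
have mp : measurable_fun setT (fun h : T => (h.1, z)).
  by apply: measurable_fun_pair => //; exact: measurable_fst.
exact: measurableT_comp (measurable_upper_ext mf) mp.
Qed.

(** The weighted oscillation over the ball of radius [j + 1] about 0 is an integral over time, so it
    is finite at almost every time below [(j + 1)^2]. Countably many [j] reach all times and all
    Gaussians. *)
Lemma good_times : exists N : set (measurableTypeR R), [/\ measurable N, leb N = 0%E &
  forall s : R, 0 < s -> ~ N s -> gauss_integrable (f^~ s)].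
Proof.
have rj j : 0 < j.+1%:R :> R by rewrite ltr0n.
have /choice[z hz] : forall j : nat, exists z : 'rV[R]_n,
    (\int[m]_h (gauss_weight j.+1%:R (h.2 - 0) * centered f j.+1%:R z h ^+ 2)%:E < +oo)%E.
  move=> j; have [z _ hz] := weighted_oscillation mf K0 bmo 0 n0 (rj j).
  by exists z; exact: le_lt_trans hz (ltry _).
pose F j (h : T) : \bar R := (gauss_weight j.+1%:R (h.2 - 0) * centered f j.+1%:R (z j) h ^+ 2)%:E.
have F0 j h : (0 <= F j h)%E by rewrite lee_fin mulr_ge0 ?gauss_weight_ge0 ?sqr_ge0.
have mF j : measurable_fun setT (F j).
  apply/measurable_EFinP; apply: measurable_funM.
    apply: measurable_gauss_weight.
    exact: measurableT_comp (measurable_sub_rV 0) measurable_snd.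
  by apply: measurable_funX; exact: measurable_centered.
pose psi j (s : measurableTypeR R) := (\int[lam]_y F j (s, y))%E.
have mpsi j : measurable_fun setT (psi j).
  exact: (@measurable_fun_fubini_tonelli_F _ _ (measurableTypeR R) 'rV[R]_n R lam (F j)).
have psi0 j s : (0 <= psi j s)%E by exact: integral_ge0.
have ipsi j : leb.-integrable setT (psi j).
  apply/integrableP; split => //.
  under eq_integral do rewrite gee0_abs//.
  apply: le_lt_trans (hz j); rewrite le_eqVlt; apply/orP; left; apply/eqP/esym.
  exact: (@fubini_tonelli1 _ _ (measurableTypeR R) 'rV[R]_n R leb lam (F j)).
have [N [mN N0 HN]] : leb.-negligible (\bigcup_j [set s | psi j s \isn't a fin_num]).
  apply: negligible_bigcup => j; have := integrable_ae measurableT (ipsi j).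
  by apply: negligibleS => s /= /negP H; apply: contra_not H => /(_ I).
exists N; split => // s s0 Ns.
have fs y : upper_ext f (s, y) = f y s by rewrite /upper_ext/= s0.
have mfs : measurable_fun setT (f^~ s).
  have := measurableT_comp (measurable_upper_ext mf) (@pair1_measurable _ _ (measurableTypeR R) 'rV[R]_n s).
  by congr measurable_fun; apply/funext => y /=; exact: fs.
have fin j : (psi j s < +oo)%E.
  rewrite ltNge leye_eq; apply/negP => /eqP H; apply: Ns; apply: HN; exists j => //=.
  by rewrite H.
split => // c c0.
(* Large enough for [s] to precede [(j + 1)^2] and for the j-th weight to dominate the Gaussian of
   parameter [c]. *)
pose j := (Num.bound s + Num.bound c^-1)%N.
have js : s < j.+1%:R.
  apply: lt_le_trans (archi_boundP (ltW s0)) _; rewrite ler_nat /j; lia.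
have jc : c^-1 <= j.+1%:R.
  apply: ltW; apply: lt_le_trans (archi_boundP _) _; first by rewrite invr_ge0 ltW.
  by rewrite ler_nat /j; lia.
have j1 : 1 <= j.+1%:R :> R by rewrite ler1n.
have j2 : j.+1%:R <= j.+1%:R ^+ 2 :> R by rewrite expr2 ler_peMr.
pose d := f (z j) s.
have cE y : centered f j.+1%:R (z j) (s, y) = f y s - d.
  rewrite /centered !fs /= indicE mem_set ?mul1r//= in_itv/= s0.
  exact: lt_le_trans js j2.
have mE : measurable_fun setT (fun y : 'rV[R]_n => expR (- (c * sqn y)) : R) by exact: measurable_expR_sqn.
apply: (@le_lt_trans _ _ (\int[lam]_y ((`|d| + 1)%:E * (expR (- (c * sqn y)))%:E + F j (s, y)))%E).
  apply: ge0_le_integral_nomeas => y _; first by rewrite lee_fin mulr_ge0 ?expR_ge0.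
  rewrite /F/= cE -EFinM -EFinD lee_fin.
  have wE : expR (- (c * sqn y)) <= gauss_weight j.+1%:R (y - 0).
    rewrite subr0 /gauss_weight ler_expR lerN2 mulrC ler_wpM2r ?sqn_ge0//.
    have j64 : c^-1 <= 64 * j.+1%:R ^+ 2.
      by apply: (le_trans jc (le_trans j2 _)); rewrite ler_peMl ?sqr_ge0// ler1n.
    rewrite -[leRHS]invrK lef_pV2 ?posrE ?invr_gt0//.
  have E0 := expR_ge0 (- (c * sqn y)).
  apply: (@le_trans _ _ (expR (- (c * sqn y)) * (`|d| + 1) + expR (- (c * sqn y)) * (f y s - d) ^+ 2)).
    rewrite -mulrDr ler_wpM2l//.
    have : `|f y s| <= `|d| + `|f y s - d| by rewrite addrC -{1}(subrK d (f y s)) ler_normD.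
    rewrite -[(f y s - d) ^+ 2](real_normK (num_real _)).
    move: (sqr_ge0 (`|f y s - d| - 1)) (normr_ge0 (f y s - d)).
    move: (`|f y s - d|) (`|f y s|) (`|d|) => u v w; rewrite !expr2; lra.
  by rewrite mulrC lerD2l ler_wpM2r ?sqr_ge0.
have d1 : (0 <= (`|d| + 1)%:E)%E by rewrite lee_fin addr_ge0.
have mE1 : measurable_fun setT (fun y : 'rV[R]_n => (expR (- (c * sqn y)))%:E) by exact/measurable_EFinP.
have mE2 : measurable_fun setT (fun y : 'rV[R]_n => (`|d| + 1)%:E * (expR (- (c * sqn y)))%:E)%E.
  exact: measurable_funeM.
have E0 (y : 'rV[R]_n) : (0 <= (expR (- (c * sqn y)))%:E)%E by rewrite lee_fin expR_ge0.
have E1 (y : 'rV[R]_n) : (0 <= (`|d| + 1)%:E * (expR (- (c * sqn y)))%:E)%E by rewrite mule_ge0.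
have mFs : measurable_fun setT (fun y => F j (s, y)).
  exact: measurableT_comp (mF j) (pair1_measurable (s : measurableTypeR R)).
rewrite ge0_integralD// ge0_integralZl//.
rewrite lte_add_pinfty//; last exact: fin.
by rewrite lte_mul_pinfty ?integral_expR_sqn// lee_fin addr_ge0.
Qed.

End good_times.

(** * The operator T *)

Section box_integrals.
Context {R : realType} {n : nat}.
Implicit Types (x y z : 'rV[R]_n) (kap : R -> R -> R) (phi sg : R -> R).
Local Notation leb := (@lebesgue_measure R).
Local Notation lam := (lebesgue_rV (R := R) n).
Local Notation T := (measurableTypeR R * 'rV[R]_n)%type.
Local Notation m := (sigma_finite_product leb lam).

Lemma box_iterated (A : set R) (B : set 'rV[R]_n) (F : T -> \bar R) :
  measurable (A : set (measurableTypeR R)) -> measurable B ->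
  measurable_fun setT F -> (forall w, (0 <= F w)%E) ->
  (\int[leb]_(t in A) \int[lam]_(x in B) F (t, x) = \int[m]_(w in A `*` B) F w)%E.
Proof.
move=> mA mB mF F0; have mAB : measurable (A `*` B : set T) by exact: measurableX.
rewrite [RHS]integral_mkcond.
have mFAB : measurable_fun setT (F \_ (A `*` B)).
  by apply/(measurable_restrictT _ mAB); exact: measurable_funTS.
have FAB0 w : (0 <= (F \_ (A `*` B)) w)%E by rewrite patchE; case: ifP.
transitivity (\int[leb]_t \int[lam]_x (F \_ (A `*` B)) (t, x))%E; last first.
  by apply/esym; exact: (@fubini_tonelli1 _ _ (measurableTypeR R) 'rV[R]_n R leb lam).
have ABE t x : ((t, x) \in (A `*` B : set T)) = (t \in A) && (x \in B).
  by apply/idP/andP; rewrite !inE.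
rewrite integral_mkcond; apply: eq_integral => t _; rewrite patchE; case: ifPn => tA.
  by rewrite integral_mkcond; apply: eq_integral => x _; rewrite !patchE ABE tA.
by rewrite integral0_eq// => x _; rewrite patchE ABE (negbTE tA).
Qed.

(** Common form of the majorants: [kap] carries the dependence on time and [a] the dilation caused
    by freeing exponents, 2 for T and 4 for the far part of M. *)
Definition causal_kernel (kap : R -> R -> R) (a : R) (w h : T) : R :=
  if h.1 < w.1 then kap w.1 h.1 * heat_kernel (a * (w.1 - h.1)) (w.2 - h.2) else 0.

Lemma causal_kernel_ge0 kap a w h : (forall t s, 0 <= kap t s) -> 0 <= causal_kernel kap a w h.
Proof. by move=> kap0; rewrite /causal_kernel; case: ifP => // _; rewrite mulr_ge0// heat_kernel_ge0. Qed.

Lemma measurable_causal_kernel kap a :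
  measurable_fun setT (fun p : measurableTypeR R * measurableTypeR R => kap p.1 p.2) ->
  measurable_fun setT (fun z : T * T => causal_kernel kap a z.1 z.2).
Proof.
move=> mkap; have m11 : measurable_fun setT (fun z : T * T => z.1.1 : R).
  exact: measurableT_comp measurable_fst measurable_fst.
have m21 : measurable_fun setT (fun z : T * T => z.2.1 : R).
  exact: measurableT_comp measurable_fst measurable_snd.
have m12 : measurable_fun setT (fun z : T * T => z.1.2).
  exact: measurableT_comp measurable_snd measurable_fst.
have m22 : measurable_fun setT (fun z : T * T => z.2.2).
  exact: measurableT_comp measurable_snd measurable_snd.
apply: measurable_fun_ifT => //; first exact: measurable_fun_ltr.
apply: measurable_funM.
  exact: measurableT_comp mkap (measurable_fun_pair m11 m21).
apply: measurable_heat_kernel; last exact: measurable_fun_subrV.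
by apply: measurable_funM => //; apply: measurable_funB.
Qed.

Lemma causal_kernel_mass kap (a M t : R) x : 0 < a ->
  measurable_fun setT (fun p : measurableTypeR R * measurableTypeR R => kap p.1 p.2) ->
  (forall t s, 0 <= kap t s) ->
  (\int[leb]_s (if (s < t)%R then kap t s else 0%R)%:E <= M%:E)%E ->
  (\int[m]_h (causal_kernel kap a (t, x) h)%:E <= M%:E)%E.
Proof.
move=> a0 mkap kap0; apply: le_trans.
have E : (\int[m]_h (causal_kernel kap a (t, x) h)%:E =
    \int[leb]_s \int[lam]_y (causal_kernel kap a (t, x) (s, y))%:E)%E.
  apply: (@fubini_tonelli1 _ _ (measurableTypeR R) 'rV[R]_n R leb lam
    (fun h => (causal_kernel kap a (t, x) h)%:E)).
    apply/measurable_EFinP.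
    exact: measurableT_comp (measurable_causal_kernel a mkap) (pair1_measurable ((t, x) : T)).
  by move=> h; rewrite lee_fin causal_kernel_ge0.
rewrite E; apply: ge0_le_integral_nomeas => s _.
  by apply: integral_ge0 => y _; rewrite lee_fin causal_kernel_ge0.
rewrite /causal_kernel/=; case: ifPn => st; last by rewrite integral0_eq.
under eq_integral do rewrite EFinM heat_kernelB.
rewrite ge0_integralZl//; last 3 first.
- apply/measurable_EFinP; apply: measurable_heat_kernel => //; exact: measurable_sub_rV.
- by move=> y _; rewrite lee_fin heat_kernel_ge0.
- by rewrite lee_fin.
by rewrite integral_heat_kernel ?mule1// mulr_gt0// subr_gt0.
Qed.

Variables (xB : 'rV[R]_n) (r : R).
Hypothesis r0 : 0 < r.
Local Notation I := (`]0, (r ^+ 2)[%classic : set R).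
Local Notation B := (eball xB r).
Local Notation wt := (fun h : T => gauss_weight r (h.2 - xB)).

(** By Tonelli the target point [w] is integrated first. On the box [heat_kernel_weight] extracts
    the weight of the source point, since [a (t - s) <= 4 r^2], and the remaining kernel has mass 1
    in [x]. *)
Lemma weighted_box_integral (a : R) kap (S : R) (H : T -> R) :
  0 < a -> a <= 4 ->
  measurable_fun setT (fun p : measurableTypeR R * measurableTypeR R => kap p.1 p.2) ->
  (forall t s, 0 <= kap t s) -> measurable_fun setT H -> (forall h, 0 <= H h) ->
  (forall h : T, ~~ (0 < h.1 < r ^+ 2) -> H h = 0) ->
  (forall s : R, 0 < s < r ^+ 2 -> (\int[leb]_(t in `]s, (r ^+ 2)%R[) (kap t s)%:E <= S%:E)%E) ->
  0 <= S ->
  (\int[m]_(w in I `*` B) \int[m]_h (causal_kernel kap a w h * H h)%:E <=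
   (2 * sqrt2n (R := R) (n := n) * S)%:E * \int[m]_h (wt h * H h)%:E)%E.
Proof.
move=> a0 a4 mkap kap0 mH H0 Hsupp hS S0.
have c0 : 0 <= 2 * sqrt2n (R := R) (n := n) by rewrite mulr_ge0// ltW// sqrt2n_gt0.
have mB : measurable B by exact: measurable_eball.
have mI : measurable (I : set (measurableTypeR R)) by exact: measurable_itv.
have mIB : measurable (I `*` B : set T) by exact: measurableX.
pose ck := causal_kernel kap a.
have ck0 w h : 0 <= ck w h by exact: causal_kernel_ge0.
have mck := measurable_causal_kernel a mkap.
have mHwt : measurable_fun setT (fun h => (wt h * H h)%:E).
  apply/measurable_EFinP; apply: measurable_funM => //; apply: measurable_gauss_weight.
  exact: measurableT_comp (measurable_sub_rV xB) measurable_snd.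
have wt0 h : 0 <= wt h by exact: gauss_weight_ge0.
pose G (w h : T) : R := \1_(I `*` B) w * (ck w h * H h).
have G0 w h : 0 <= G w h by rewrite mulr_ge0// mulr_ge0.
have mG : measurable_fun setT (fun p : T * T => (G p.1 p.2)%:E).
  apply/measurable_EFinP; apply: measurable_funM.
    exact: measurableT_comp (measurable_indic mIB) measurable_fst.
  by apply: measurable_funM => //; exact: measurableT_comp mH measurable_snd.
apply: (@le_trans _ _ (\int[m]_w \int[m]_h (G w h)%:E)%E).
  rewrite integral_mkcond; apply: ge0_le_integral_nomeas => w _; rewrite patchE; case: ifPn => // wIB.
    by apply: integral_ge0 => h _; rewrite lee_fin mulr_ge0.
  - rewrite le_eqVlt; apply/orP; left; apply/eqP; apply: eq_integral => h _.
    by rewrite /G indicE wIB mul1r.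
  by apply: integral_ge0 => h _; rewrite lee_fin.
rewrite (@fubini_tonelli _ _ T T R m m (fun p => (G p.1 p.2)%:E))//; last by move=> p; rewrite lee_fin.
rewrite -ge0_integralZl//; last 2 first.
- by move=> h _; rewrite lee_fin mulr_ge0.
- by rewrite lee_fin mulr_ge0.
apply: ge0_le_integral_nomeas => -[s y] _ /=.
  by apply: integral_ge0 => w _; rewrite lee_fin.
have [sI|sI] := boolP (0 < s < r ^+ 2); last first.
  rewrite integral0_eq; first by apply: mule_ge0; rewrite lee_fin ?(mulr_ge0 c0 S0)// mulr_ge0 ?gauss_weight_ge0.
  by move=> w _; rewrite /G Hsupp// !mulr0.
have E : (\int[m]_w (G w (s, y))%:E = \int[leb]_t \int[lam]_x (G (t, x) (s, y))%:E)%E.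
  apply: (@fubini_tonelli1 _ _ (measurableTypeR R) 'rV[R]_n R leb lam (fun w => (G w (s, y))%:E)).
    exact: measurableT_comp mG (pair2_measurable ((s, y) : T)).
  by move=> w; rewrite lee_fin.
rewrite E; pose D := 2 * sqrt2n (R := R) (n := n) * (wt (s, y) * H (s, y)).
have D0 : 0 <= D by rewrite mulr_ge0// mulr_ge0.
apply: (@le_trans _ _ (\int[leb]_(t in `]s, (r ^+ 2)%R[) (D%:E * (kap t s)%:E))%E); last first.
  rewrite ge0_integralZl//; last 2 first.
  - apply/measurable_EFinP; apply: measurable_funTS.
    exact: measurableT_comp mkap (pair2_measurable (s : measurableTypeR R)).
  - by move=> t _; rewrite lee_fin.
  apply: le_trans (lee_wpmul2l _ (hS s sI)) _; first by rewrite lee_fin.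
  by rewrite -!EFinM lee_fin /D le_eqVlt; apply/orP; left; apply/eqP; ring.
rewrite [leRHS]integral_mkcond; apply: ge0_le_integral_nomeas => t _.
  by apply: integral_ge0 => x _; rewrite lee_fin.
rewrite patchE; case: ifPn => ts; last first.
  rewrite integral0_eq// => x _; rewrite /G indicE; case: (boolP (_ \in _)) => /=; last by rewrite mul0r.
  rewrite inE/= in_itv/= => -[/andP[t0 tr] _]; rewrite /ck /causal_kernel/=.
  case: ifPn; last by rewrite mul0r mulr0.
  by move=> st; exfalso; move: ts; rewrite notin_setE/= in_itv/= st tr; apply.
move: ts; rewrite inE/= in_itv/= => /andP[st tr].
have ts0 : 0 < t - s by rewrite subr_gt0.
apply: (@le_trans _ _ (\int[lam]_x ((D * kap t s)%:E * (heat_kernel (2 * (a * (t - s))) (x - y))%:E))%E).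
  apply: ge0_le_integral_nomeas => x _; first by rewrite lee_fin.
  rewrite -EFinM lee_fin /G indicE; case: (boolP (_ \in _)) => xB'; last first.
    by rewrite mul0r mulr_ge0 ?heat_kernel_ge0// mulr_ge0.
  have xr : sqn (x - xB) <= r ^+ 2.
    by move: xB'; rewrite inE/= => -[_ /eballE-/(_ r0)/ltW].
  rewrite mul1r /ck /causal_kernel/= st /D.
  have := heat_kernel_weight y r0 (mulr_gt0 a0 ts0) _ xr => /(_ _) HW.
  have {}HW := HW (_ : a * (t - s) <= 4 * r ^+ 2).
  apply: (@le_trans _ _ (kap t s * (2 * sqrt2n (n := n) * gauss_weight r (y - xB) * heat_kernel (2 * (a * (t - s))) (x - y)) * H (s, y))).
    rewrite ler_wpM2r// ler_wpM2l// HW// ler_pM ?(ltW a0) ?(ltW ts0)//.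
    by case/andP: sI => s0 _; rewrite lerBlDr (le_trans (ltW tr))// lerDl ltW.
  rewrite le_eqVlt; apply/orP; left; apply/eqP; ring.
rewrite ge0_integralZl//; last 3 first.
- apply/measurable_EFinP; apply: measurable_heat_kernel => //; exact: measurable_sub_rV.
- by move=> x _; rewrite lee_fin heat_kernel_ge0.
- by rewrite lee_fin mulr_ge0.
by rewrite integral_heat_kernel ?mulr_gt0// mule1 EFinM.
Qed.

(** Schur's test with multipliers: Schwarz against a kernel of mass at most [M], then the previous
    lemma for [M * phi t * kap t s * sg s ^+ 2]. The multiplier [sg] allows the mass and the dual
    integral to be balanced. *)
Lemma box_schwarz (a : R) kap phi sg (M S : R) (F : T -> R) :
  0 < a -> a <= 4 -> 0 < M -> 0 <= S ->
  measurable_fun setT (fun p : measurableTypeR R * measurableTypeR R => kap p.1 p.2) ->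
  (forall t s, 0 <= kap t s) ->
  measurable_fun setT (phi : measurableTypeR R -> R) -> (forall t, 0 <= phi t) ->
  measurable_fun setT (sg : measurableTypeR R -> R) -> (forall t, 0 <= sg t) ->
  measurable_fun setT F -> (forall h : T, ~~ (0 < h.1 < r ^+ 2) -> F h = 0) ->
  (forall t : R, 0 < t < r ^+ 2 ->
    (\int[leb]_s (if (s < t)%R then kap t s else 0%R)%:E <= M%:E)%E) ->
  (forall s : R, 0 < s < r ^+ 2 ->
    (\int[leb]_(t in `]s, (r ^+ 2)%R[) (phi t * kap t s * sg s ^+ 2)%:E <= S%:E)%E) ->
  (\int[m]_(w in I `*` B)
     ((phi w.1)%:E * (\int[m]_h (causal_kernel kap a w h * (sg h.1 * `|F h|))%:E) ^+ 2) <=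
   (2 * sqrt2n (R := R) (n := n) * (M * S))%:E * \int[m]_h (wt h * F h ^+ 2)%:E)%E.
Proof.
move=> a0 a4 M0 S0 mkap kap0 mphi phi0 msg sg0 mF Fsupp hM hS.
pose kap' t s := M * (phi t * kap t s * sg s ^+ 2).
have kap'0 t s : 0 <= kap' t s by rewrite mulr_ge0 ?(ltW M0)// mulr_ge0 ?sqr_ge0// mulr_ge0.
have mkap' : measurable_fun setT (fun p : measurableTypeR R * measurableTypeR R => kap' p.1 p.2).
  apply: measurable_funM => //; apply: measurable_funM.
    by apply: measurable_funM => //; exact: measurableT_comp mphi measurable_fst.
  by apply: measurable_funX; exact: measurableT_comp msg measurable_snd.
have mF2 : measurable_fun setT (fun h => F h ^+ 2) by exact: measurable_funX.
have F20 h : 0 <= F h ^+ 2 by exact: sqr_ge0.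
have F2s (h : T) : ~~ (0 < h.1 < r ^+ 2) -> F h ^+ 2 = 0.
  by move=> /Fsupp ->; rewrite expr0n.
have hS' (s : R) : 0 < s < r ^+ 2 -> (\int[leb]_(t in `]s, (r ^+ 2)%R[) (kap' t s)%:E <= (M * S)%:E)%E.
  move=> sI; under eq_integral do rewrite EFinM.
  rewrite ge0_integralZl//; last 3 first.
  - apply/measurable_EFinP; apply: measurable_funTS.
    apply: measurable_funM => //; apply: measurable_funM => //.
    exact: measurableT_comp mkap (pair2_measurable (s : measurableTypeR R)).
  - by move=> t _; rewrite lee_fin mulr_ge0 ?sqr_ge0// mulr_ge0.
  - by rewrite lee_fin ltW.
  by rewrite [leRHS]EFinM; apply: lee_wpmul2l; [rewrite lee_fin ltW|exact: hS].
have MS0 : 0 <= M * S by rewrite mulr_ge0// ltW.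
apply: le_trans (weighted_box_integral a0 a4 mkap' kap'0 mF2 F20 F2s hS' MS0).
apply: ge0_le_integral_nomeas => -[t x] [/= tI _].
  have X0 : (0 <= \int[m]_h (causal_kernel kap a (t, x) h * (sg h.1 * `|F h|))%:E)%E.
    by apply: integral_ge0 => h _; rewrite lee_fin mulr_ge0 ?causal_kernel_ge0// mulr_ge0.
  by apply: mule_ge0; [rewrite lee_fin|exact: mule_ge0].
move: tI; rewrite in_itv/= => tI.
have mck : measurable_fun setT (fun h => causal_kernel kap a (t, x) h).
  exact: measurableT_comp (measurable_causal_kernel a mkap) (pair1_measurable ((t, x) : T)).
have msF : measurable_fun setT (fun h : T => sg h.1 * `|F h|).
  apply: measurable_funM; first exact: measurableT_comp msg measurable_fst.
  exact: measurableT_comp.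
have sF0 (h : T) : 0 <= sg h.1 * `|F h| by rewrite mulr_ge0.
have CS := ge0_cauchy_schwarz mck msF (fun h => causal_kernel_ge0 a (t, x) h kap0) sF0 M0
  (causal_kernel_mass x a0 mkap kap0 (hM t tI)).
apply: (le_trans (lee_wpmul2l _ CS)); first by rewrite lee_fin.
rewrite muleA -EFinM -ge0_integralZl//; last 3 first.
- by apply/measurable_EFinP; apply: measurable_funM => //; exact: measurable_funX.
- by move=> h _; rewrite lee_fin mulr_ge0 ?causal_kernel_ge0 ?sqr_ge0.
- by rewrite lee_fin mulr_ge0// ltW.
rewrite le_eqVlt; apply/orP; left; apply/eqP; apply: eq_integral => h _.
rewrite -EFinM; congr EFin; rewrite /causal_kernel/= /kap'; case: ifPn => _; last by rewrite !mul0r mulr0.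
by rewrite exprMn real_normK ?num_real//; ring.
Qed.

End box_integrals.

Section gradient_estimate.
Context {R : realType} {n : nat}.
Local Notation leb := (@lebesgue_measure R).
Local Notation lam := (lebesgue_rV (R := R) n).
Local Notation T := (measurableTypeR R * 'rV[R]_n)%type.
Local Notation m := (sigma_finite_product leb lam).
Variables (f : 'rV[R]_n -> R -> R) (K : R).
Hypothesis mf : measurable_upper f.
Hypothesis K0 : 0 < K.
Hypothesis bmo : forall xB (r : R), 0 < r ->
  (\int[leb]_(t in `]0%R, (r ^+ 2)%R[)
      ((fine (lam (eball xB r)) ^- 2)%:E *
       \int[lam \x lam]_(z in eball xB r `*` eball xB r)
         (`|f z.1 t - f z.2 t| ^+ 2)%:E) <= K%:E)%E.
Hypothesis n0 : (0 < n)%N.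

(** The kernel [(t - s)^(-1/2)] of T divided by [sqrt s], with [sqrt s] moved to the function. This
    makes the mass in [s] independent of [t], and the dual integral with [dt / t] independent of
    [s]. *)
Definition beta_kernel (t s : R) : R := (Num.sqrt s * Num.sqrt (t - s))^-1.

Lemma beta_kernel_ge0 t s : 0 <= beta_kernel t s.
Proof. by rewrite invr_ge0 mulr_ge0 ?sqrtr_ge0. Qed.

Lemma measurable_beta_kernel :
  measurable_fun setT (fun p : measurableTypeR R * measurableTypeR R => beta_kernel p.1 p.2).
Proof.
have m1 : measurable_fun setT (fun p : measurableTypeR R * measurableTypeR R => p.1 : R) by exact: measurable_fst.
have m2 : measurable_fun setT (fun p : measurableTypeR R * measurableTypeR R => p.2 : R) by exact: measurable_snd.
apply: measurable_funV; apply: measurable_funM; apply: measurable_fun_sqrt => //.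
exact: measurable_funB.
Qed.

Definition gradient_majorant (F : T -> R) (w : T) : \bar R :=
  (\int[m]_h (causal_kernel beta_kernel 2 w h * (Num.sqrt h.1 * `|F h|))%:E)%E.

Lemma T_heat_majorant (r t : R) x z i : 0 < r -> 0 < t < r ^+ 2 ->
  (`|T_heat f x t i| <=
   (2 * sqrt2n (R := R) (n := n))%:E * gradient_majorant (centered f r z) (t, x))%E.
Proof.
move=> r0 /andP[t0 tr]; have [N [mN N0 HN]] := good_times mf K0 bmo n0.
set F := centered f r z; have mF : measurable_fun setT F by exact: measurable_centered.
have mFp : measurable_fun setT (fun h : T => F (h.1, h.2)).
  by rewrite (_ : (fun _ => _) = F)//; apply/funext => -[].
have mFs (s : R) : measurable_fun setT (fun y => F (s, y)).
  exact: measurableT_comp mF (pair1_measurable (s : measurableTypeR R)).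
pose k (s : R) y := heat_dx i (t - s) (x - y) * F (s, y).
have mk : measurable_fun setT (fun h : T => k h.1 h.2).
  apply: measurable_funM => //; apply: measurable_heat_dx.
    by apply: measurable_funB => //; exact: measurable_fst.
  apply: measurable_fun_subrV => //; exact: measurable_snd.
pose J (s : R) := \int[lam]_y k s y.
have mJ : measurable_fun setT (J : measurableTypeR R -> R).
  exact: (@measurable_Rintegral2 _ _ (measurableTypeR R) 'rV[R]_n R lam (fun h => k h.1 h.2)).
(* At good times the constant [f z s] can be subtracted; the other times form a null set. *)
have -> : T_heat f x t i = (\int[leb]_(s in `]0%R, t[) (J s)%:E)%E.
  apply: (integral_null_eq mN N0) => s /=; rewrite in_itv/= => /andP[s0 st] Ns.
  rewrite (derive_heat_centered (f z s) x i (HN s s0 Ns)) ?subr_gt0//.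
  congr EFin; apply: eq_Rintegral => y _; rewrite /k /F /centered /upper_ext/= s0.
  by rewrite indicE mem_set ?mul1r//= in_itv/= s0 (lt_trans st).
have mIt : measurable (`]0, t[%classic : set (measurableTypeR R)) by exact: measurable_itv.
apply: le_trans (le_abse_integral _ mIt _) _.
  by apply: measurable_funTS; exact/measurable_EFinP.
have c0 : 0 <= 2 * sqrt2n (R := R) (n := n) by rewrite mulr_ge0// ltW// sqrt2n_gt0.
pose g (s : R) y := causal_kernel beta_kernel 2 ((t, x) : T) ((s, y) : T) * (Num.sqrt s * `|F (s, y)|).
have g0 s y : 0 <= g s y.
  apply: mulr_ge0; last by rewrite mulr_ge0 ?sqrtr_ge0.
  by apply: causal_kernel_ge0; exact: beta_kernel_ge0.
have mg : measurable_fun setT (fun h : T => g h.1 h.2).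
  have H := measurableT_comp (measurable_causal_kernel 2 measurable_beta_kernel) (pair1_measurable ((t, x) : T)).
  apply: measurable_funM.
    rewrite (_ : (fun _ => _) = causal_kernel beta_kernel 2 ((t, x) : T))//.
  apply: measurable_funM.
    by apply: measurable_fun_sqrt; exact: measurable_fst.
  exact: measurableT_comp mFp.
have -> : (gradient_majorant F (t, x) = \int[leb]_s \int[lam]_y (g s y)%:E)%E.
  rewrite /gradient_majorant.
  transitivity (\int[m]_h (g h.1 h.2)%:E)%E; first by apply: eq_integral => -[s y] _.
  apply: (@fubini_tonelli1 _ _ (measurableTypeR R) 'rV[R]_n R leb lam (fun h => (g h.1 h.2)%:E)).
    exact/measurable_EFinP.
  by move=> h; rewrite lee_fin.
have mgs s : measurable_fun setT (fun y => (g s y)%:E).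
  apply/measurable_EFinP.
  exact: measurableT_comp mg (pair1_measurable (s : measurableTypeR R)).
have mG1 : measurable_fun setT (fun s : measurableTypeR R => \int[lam]_y (g s y)%:E)%E.
  apply: (@measurable_fun_fubini_tonelli_F _ _ (measurableTypeR R) 'rV[R]_n R lam (fun h => (g h.1 h.2)%:E)).
    by apply/measurable_EFinP.
  by move=> h; rewrite lee_fin.
have G10 s : (0 <= \int[lam]_y (g s y)%:E)%E.
  by apply: integral_ge0 => y _; rewrite lee_fin.
rewrite -ge0_integralZl//.
rewrite [leLHS]integral_mkcond; apply: ge0_le_integral_nomeas => s _.
  by rewrite patchE; case: ifP => _; [exact: abse_ge0|exact: lexx].
rewrite patchE; case: ifPn => [|_]; last first.
  by apply: mule_ge0 => //; rewrite lee_fin.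
rewrite inE/= in_itv/= => /andP[s0 st]; have ts0 : 0 < t - s by rewrite subr_gt0.
apply: le_trans (abs_Rintegral_le lam _) _.
  exact: measurableT_comp mk (pair1_measurable (s : measurableTypeR R)).
rewrite -ge0_integralZl//; last by move=> y _; rewrite lee_fin.
apply: ge0_le_integral_nomeas => y _ //; rewrite -EFinM lee_fin /k normrM /g /causal_kernel/= st.
rewrite (_ : 2 * sqrt2n * _ = 2 * sqrt2n (R := R) (n := n) / Num.sqrt (t - s) * heat_kernel (2 * (t - s)) (x - y) * `|F (s, y)|).
  rewrite ler_wpM2r//; apply: le_trans (heat_dx_bound i _ ts0) _.
  by rewrite (mulrC 2 (sqrt2n (n := n))).
rewrite /beta_kernel; field.
by rewrite !lt0r_neq0 ?sqrtr_gt0.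
Qed.

(** The [n] components, the square of the constant in [heat_dx_bound], [box_schwarz] with
    [M = S = pi], and the weighted oscillation. *)
Definition gradient_cst : R :=
  n%:R * (2 * sqrt2n (R := R) (n := n)) ^+ 2 * (2 * sqrt2n (R := R) (n := n) * (pi * pi)) * bmo_cst (R := R) (n := n).

Lemma T_heat_box xB (r : R) : 0 < r ->
  (\int[leb]_(t in `]0%R, (r ^+ 2)%R[) \int[lam]_(x in eball xB r)
     (T_heat_sqnorm f x t * (t^-1)%:E) <= (gradient_cst * r ^+ n * K)%:E)%E.
Proof.
move=> r0; have [z zB hz] := weighted_oscillation mf K0 bmo xB n0 r0.
set F := centered f r z in hz; have mF : measurable_fun setT F by exact: measurable_centered.
pose c : R := 2 * sqrt2n (n := n).
have c0 : 0 <= c by rewrite mulr_ge0// ltW// sqrt2n_gt0.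
have ck0 w h : 0 <= causal_kernel (n := n) beta_kernel 2 w h.
  exact: causal_kernel_ge0 beta_kernel_ge0.
pose X := gradient_majorant F.
have X0 w : (0 <= X w)%E.
  apply: integral_ge0 => h _; rewrite lee_fin; apply: mulr_ge0; first exact: ck0.
  by rewrite mulr_ge0 ?sqrtr_ge0.
have mX : measurable_fun setT X.
  apply: (@measurable_fun_fubini_tonelli_F _ _ T T R m
    (fun p => (causal_kernel beta_kernel 2 p.1 p.2 * (Num.sqrt p.2.1 * `|F p.2|))%:E)).
    apply/measurable_EFinP; apply: measurable_funM.
      exact: measurable_causal_kernel measurable_beta_kernel.
    apply: measurable_funM.
      apply: measurable_fun_sqrt; exact: measurableT_comp measurable_fst measurable_snd.
    by apply: measurableT_comp => //; exact: measurableT_comp mF measurable_snd.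
  move=> p; rewrite lee_fin; apply: mulr_ge0; first exact: ck0.
  by rewrite mulr_ge0 ?sqrtr_ge0.
(* The absolute value makes the factor nonnegative at all times, as [box_schwarz] demands; on the
   box it is [1 / t]. *)
pose phi (t : R) : R := `|t|^-1.
have phi0 t : 0 <= phi t by rewrite invr_ge0.
have mphi : measurable_fun setT (phi : measurableTypeR R -> R) by apply: measurable_funV; exact: (@normr_measurable R setT).
pose Y (w : T) : \bar R := ((phi w.1)%:E * X w ^+ 2)%E.
have Y0 w : (0 <= Y w)%E by apply: mule_ge0; [rewrite lee_fin|exact: mule_ge0].
have mY : measurable_fun setT Y.
  apply: emeasurable_funM; last exact: emeasurable_funM.
  by apply/measurable_EFinP; exact: measurableT_comp mphi measurable_fst.
have mI : measurable (`]0, (r ^+ 2)[%classic : set (measurableTypeR R)) by exact: measurable_itv.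
have mB : measurable (eball xB r) by exact: measurable_eball.
have C0 : 0 <= n%:R * c ^+ 2 by rewrite mulr_ge0 ?sqr_ge0.
apply: (@le_trans _ _ (\int[leb]_(t in `]0%R, (r ^+ 2)%R[) \int[lam]_(x in eball xB r)
    ((n%:R * c ^+ 2)%:E * Y (t, x)))%E).
  have T0 x t : (0 <= T_heat_sqnorm f x t)%E.
    by apply: sume_ge0 => i _; exact: sqre_ge0.
  apply: ge0_le_integral_nomeas => t /=; rewrite in_itv/= => tI.
    apply: integral_ge0 => x _; rewrite mule_ge0// lee_fin invr_ge0 ltW//.
    by case/andP: tI.
  have /andP[t0 _] := tI.
  apply: ge0_le_integral_nomeas => x _; first by rewrite mule_ge0// lee_fin invr_ge0 ltW.
  have -> : (Y (t, x) = (t^-1)%:E * X (t, x) ^+ 2)%E by rewrite /Y/= /phi gtr0_norm.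
  rewrite muleCA muleC.
  apply: lee_wpmul2l; first by rewrite lee_fin invr_ge0 ltW.
  have H i : (T_heat f x t i ^+ 2 <= (c%:E * X (t, x)) ^+ 2)%E.
    have := T_heat_majorant x z i r0 tI; rewrite -/F -/X -/c => H.
    have -> : (T_heat f x t i ^+ 2 = `|T_heat f x t i| ^+ 2)%E.
      by rewrite [RHS]expe2 -abseM gee0_abs// -expe2 sqre_ge0.
    by rewrite !expe2; apply: lee_pmul.
  apply: (@le_trans _ _ (\sum_(i < n) (c%:E * X (t, x)) ^+ 2)%E); first by rewrite /T_heat_sqnorm; apply: lee_sum => i _; exact: H.
  have sumV (V : \bar R) k : (0 <= V -> \sum_(i < k) V = k%:R%:E * V)%E.
    move=> V0; elim: k => [|k IH]; first by rewrite big_ord0 mul0e.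
    by rewrite big_ord_recr/= IH -natr1 EFinD ge0_muleDl ?lee_fin// mul1e.
  rewrite le_eqVlt; apply/orP; left; apply/eqP; rewrite sumV ?sqre_ge0//.
  rewrite (EFinM n%:R (c ^+ 2)) -muleA; congr (_ * _)%E.
  by rewrite EFin_expe !expe2 [LHS]muleACA.
have mcY : measurable_fun setT (fun w => (n%:R * c ^+ 2)%:E * Y w)%E by exact: measurable_funeM.
have cY0 w : (0 <= (n%:R * c ^+ 2)%:E * Y w)%E by rewrite mule_ge0.
rewrite [leLHS](_ : _ = \int[m]_(w in `]0%R, (r ^+ 2)%R[ `*` eball xB r)
   ((n%:R * c ^+ 2)%:E * Y w))%E; last exact: (box_iterated mI mB mcY cY0).
rewrite ge0_integralZl//; last 2 first.
- exact: measurableX.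
- exact: measurable_funTS.
have Fsupp (h : T) : ~~ (0 < h.1 < r ^+ 2) -> F h = 0.
  move=> hI; rewrite /F /centered indicE memNset ?mul0r//= in_itv/=; exact/negP.
have mass (t : R) : 0 < t < r ^+ 2 ->
    (\int[leb]_s (if (s < t)%R then beta_kernel t s else 0%R)%:E <= pi%:E)%E.
  move=> /andP[t0 _]; apply: le_trans (integral_beta_le t0).
  rewrite [leRHS]integral_mkcond; apply: ge0_le_integral_nomeas => s _.
    by rewrite lee_fin; case: ifP => // _; exact: beta_kernel_ge0.
  have P0 : (0%E <= ((fun s => (beta_kernel t s)%:E) \_ `]0%R, t[) s)%E.
    by rewrite patchE; case: ifP => // _; rewrite lee_fin beta_kernel_ge0.
  (* For [s <= 0] the root is 0 and so is the kernel, by the convention on inverses. *)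
  have [s0|s0] := ltP 0 (s : R); last first.
    rewrite (_ : beta_kernel t s = 0); last by rewrite /beta_kernel ler0_sqrtr// mul0r invr0.
    by rewrite if_same.
  case: ifPn => // st; rewrite patchE mem_set//=.
  by rewrite in_itv/= s0.
have hardy (s : R) : 0 < s < r ^+ 2 ->
    (\int[leb]_(t in `]s, (r ^+ 2)%R[) (phi t * beta_kernel t s * Num.sqrt s ^+ 2)%:E <= pi%:E)%E.
  move=> /andP[s0 _]; apply: le_trans (integral_hardy_le s0).
  rewrite [leLHS]integral_mkcond [leRHS]integral_mkcond; apply: ge0_le_integral_nomeas => t _; rewrite !patchE.
    by case: ifP => // _; rewrite lee_fin mulr_ge0 ?sqr_ge0// mulr_ge0 ?beta_kernel_ge0.
  have st0 : s < t -> (phi t * beta_kernel t s * Num.sqrt s ^+ 2 = Num.sqrt s / (t * Num.sqrt (t - s))).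
    move=> st; have t0 := lt_trans s0 st.
    rewrite /phi gtr0_norm// /beta_kernel; field.
    by rewrite !lt0r_neq0 ?sqrtr_gt0 ?subr_gt0.
  case: ifPn => [|_]; last first.
    case: ifPn => // ts; move: ts; rewrite inE/= in_itv/= andbT => st.
    by rewrite lee_fin -st0// mulr_ge0 ?sqr_ge0// mulr_ge0 ?beta_kernel_ge0.
  rewrite inE/= in_itv/= => /andP[st _].
  rewrite mem_set; last by rewrite /= in_itv/= st.
  by rewrite lee_fin; rewrite le_eqVlt; apply/orP; left; apply/eqP; exact: st0.
have msq : measurable_fun setT ((fun s => Num.sqrt s) : measurableTypeR R -> R).
  exact: measurable_fun_sqrt.
have pi0 := pi_gt0 R.
have BS := box_schwarz (a := 2) (phi := phi) (sg := fun s => Num.sqrt s) xB r0 (ltr0Sn _ _) (_ : 2 <= 4) pi0 (ltW pi0)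
  measurable_beta_kernel (fun _ _ => beta_kernel_ge0 _ _) mphi phi0 msq (fun s => sqrtr_ge0 s) mF Fsupp mass hardy.
apply: (@le_trans _ _ ((n%:R * c ^+ 2)%:E * ((2 * sqrt2n (n := n) * (pi * pi))%:E * (bmo_cst (n := n) * r ^+ n * K)%:E)))%E.
  apply: lee_wpmul2l; first by rewrite lee_fin.
  apply: le_trans (BS _) _; first by rewrite ler_nat.
  apply: lee_wpmul2l => //; rewrite lee_fin mulr_ge0// mulr_ge0// ltW//.
by rewrite -!EFinM lee_fin /gradient_cst /c le_eqVlt; apply/orP; left; apply/eqP; ring.
Qed.

End gradient_estimate.

Lemma norm_le_1sqr (R : realType) (u : R) : `|u| <= 1 + u ^+ 2.
Proof.
rewrite -[u ^+ 2](real_normK (num_real _)).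
by have := sqr_ge0 (`|u| - 1); have := normr_ge0 u; move: (`|u|) => v; rewrite !expr2; lra.
Qed.

(** * The operator M *)

Section square_bounds.
Context d (T : measurableType d) (R : realType) (mu : {measure set T -> \bar R}).
Local Open Scope ereal_scope.

Lemma ge0_integral_le_twice (D : set T) (g u1 u2 : T -> \bar R) (A B : R) :
  measurable D -> measurable_fun D u1 -> measurable_fun D u2 ->
  (forall w, D w -> 0 <= g w) -> (forall w, D w -> 0 <= u1 w) -> (forall w, D w -> 0 <= u2 w) ->
  (forall w, D w -> g w <= 2%:E * u1 w + 2%:E * u2 w) ->
  \int[mu]_(w in D) u1 w <= A%:E -> \int[mu]_(w in D) u2 w <= B%:E ->
  \int[mu]_(w in D) g w <= (2 * A + 2 * B)%R%:E.
Proof.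
move=> mD mu1 mu2 g0 u10 u20 gu hA hB.
have c0 : 0 <= 2%:E :> \bar R by rewrite lee_fin.
apply: (@le_trans _ _ (\int[mu]_(w in D) (2%:E * u1 w + 2%:E * u2 w))).
  exact: ge0_le_integral_nomeas.
rewrite ge0_integralD//; last 4 first.
- by move=> w Dw; rewrite mule_ge0 ?u10.
- exact: measurable_funeM.
- by move=> w Dw; rewrite mule_ge0 ?u20.
- exact: measurable_funeM.
rewrite !ge0_integralZl// [leRHS]EFinD.
by apply: leeD; rewrite [leRHS]EFinM; exact: lee_wpmul2l.
Qed.

Lemma measurable_sqre (X : T -> \bar R) : measurable_fun setT X ->
  measurable_fun setT (fun w => X w ^+ 2).
Proof.
move=> mX; rewrite (_ : (fun _ => _) = (fun w => X w * X w)); first exact: emeasurable_funM.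
by apply/funext => w; rewrite expe2.
Qed.

Lemma sqr_le_expe2 (u c : R) (X : \bar R) : (0 <= c)%R -> 0 <= X ->
  `|u|%:E <= c%:E * X -> (`|u| ^+ 2)%:E <= (c ^+ 2)%:E * X ^+ 2.
Proof.
move=> c0 X0 uX; rewrite !EFin_expe !expe2 -muleACA; apply: lee_pmul => //.
Qed.

End square_bounds.

Section maximal_regularity_truncation.
Context {R : realType} {n : nat}.
Local Notation leb := (@lebesgue_measure R).
Local Notation lam := (lebesgue_rV (R := R) n).
Local Notation T := (measurableTypeR R * 'rV[R]_n)%type.
Local Notation m := (sigma_finite_product leb lam).
Variables (f : 'rV[R]_n -> R -> R) (K : R).
Hypothesis mf : measurable_upper f.
Hypothesis K0 : 0 < K.
Hypothesis bmo : forall xB (r : R), 0 < r ->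
  (\int[leb]_(t in `]0%R, (r ^+ 2)%R[)
      ((fine (lam (eball xB r)) ^- 2)%:E *
       \int[lam \x lam]_(z in eball xB r `*` eball xB r)
         (`|f z.1 t - f z.2 t| ^+ 2)%:E) <= K%:E)%E.
Hypothesis n0 : (0 < n)%N.

(** With [l = r ^+ 2] all sources on the box are included; with small [l] only those that
    distinguish two truncations of parameter at most [l]. *)
Definition window_kernel (l t s : R) : R := if t - l <= s then 1 else 0.

Lemma window_kernel_ge0 l t s : 0 <= window_kernel l t s.
Proof. by rewrite /window_kernel; case: ifP. Qed.

Lemma measurable_window_kernel l :
  measurable_fun setT (fun p : measurableTypeR R * measurableTypeR R => window_kernel l p.1 p.2).
Proof.
apply: measurable_fun_ifT => //; apply: measurable_fun_ler => //.
by apply: measurable_funB => //; exact: measurable_fst.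
Qed.

Definition window_majorant (l : R) (F : T -> R) (w : T) : \bar R :=
  (\int[m]_h (causal_kernel (window_kernel l) 4 w h * (1 * `|F h|))%:E)%E.

Lemma window_majorant_ge0 l F w : (0 <= window_majorant l F w)%E.
Proof.
apply: integral_ge0 => h _; rewrite lee_fin; apply: mulr_ge0.
  exact: causal_kernel_ge0 (window_kernel_ge0 l).
by rewrite mul1r.
Qed.

Lemma measurable_window_majorant l F : measurable_fun setT F ->
  measurable_fun setT (window_majorant l F).
Proof.
move=> mF; apply: (@measurable_fun_fubini_tonelli_F _ _ T T R m
    (fun p => (causal_kernel (window_kernel l) 4 p.1 p.2 * (1 * `|F p.2|))%:E)).
  apply/measurable_EFinP; apply: measurable_funM.
    exact: measurable_causal_kernel (measurable_window_kernel l).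
  apply: measurable_funM => //.
  by apply: measurableT_comp => //; exact: measurableT_comp mF measurable_snd.
move=> p; rewrite lee_fin; apply: mulr_ge0; last by rewrite mul1r.
exact: causal_kernel_ge0 (window_kernel_ge0 l).
Qed.

Lemma lebesgue_itv_le (a b : R) (A : set R) : a <= b -> measurable A ->
  A `<=` `[a, b]%classic -> (leb A <= (b - a)%:E)%E.
Proof.
move=> ab mA AI; apply: (@le_trans _ _ (lebesgue_measure (`[a, b]%classic : set R))).
  by apply: le_measure; rewrite ?inE.
rewrite lebesgue_measure_itv/= lte_fin; case: ltP => [_|_]; first by rewrite -EFinB.
by rewrite lee_fin subr_ge0.
Qed.

Lemma integral_itv_indic_le (a b : R) : a <= b ->
  (\int[leb]_s (\1_(`[a, b]%classic : set R) s)%:E <= (b - a)%:E)%E.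
Proof.
move=> ab; have mab : measurable (`[a, b]%classic : set (measurableTypeR R)) by exact: measurable_itv.
rewrite integral_indic// setIT; exact: (lebesgue_itv_le ab mab (@subset_refl _ _)).
Qed.

Variables (xB z : 'rV[R]_n) (r : R).
Hypothesis r0 : 0 < r.
Local Notation F := (centered f r z).
Let V : R := bmo_cst (n := n) * r ^+ n * K.
Hypothesis hz : (\int[m]_h (gauss_weight r (h.2 - xB) * F h ^+ 2)%:E <= V%:E)%E.
Local Notation I := (`]0, (r ^+ 2)[%classic : set R).
Local Notation B := (eball xB r).

Let mF : measurable_fun setT F. Proof. exact: measurable_centered. Qed.

Let mI : measurable (I : set (measurableTypeR R)). Proof. exact: measurable_itv. Qed.

Let mB : measurable B. Proof. exact: measurable_eball. Qed.

Let Fsupp (h : T) : ~~ (0 < h.1 < r ^+ 2) -> F h = 0.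
Proof. by move=> hI; rewrite /centered indicE memNset ?mul0r//= in_itv/=; exact/negP. Qed.

Let V0 : 0 <= V.
Proof. by rewrite !mulr_ge0 ?exprn_ge0 ?(ltW r0) ?(ltW K0)// mulr_ge0. Qed.

(** The window has length [l] both in [s] and in [t], so [M = S = l]; the factor [l * l] yields
    smallness for short windows. *)
Lemma window_box (l : R) : 0 < l ->
  (\int[m]_(w in I `*` B) window_majorant l F w ^+ 2 <=
   (2 * sqrt2n (R := R) (n := n) * (l * l) * V)%:E)%E.
Proof.
move=> l0.
have mass (t : R) : 0 < t < r ^+ 2 ->
    (\int[leb]_s (if (s < t)%R then window_kernel l t s else 0%R)%:E <= l%:E)%E.
  move=> _; apply: (@le_trans _ _ (\int[leb]_s (\1_(`[t - l, t]%classic : set R) s)%:E)%E).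
    apply: ge0_le_integral_nomeas => s _.
      by rewrite lee_fin; case: ifP => // _; exact: window_kernel_ge0.
    rewrite lee_fin /window_kernel; case: ifP => // st; case: ifP => // ts.
    by rewrite indicE mem_set//= in_itv/= ts ltW.
  apply: le_trans (integral_itv_indic_le (_ : t - l <= t)) _; first by rewrite gerBl ltW.
  by rewrite lee_fin opprB addrC subrK.
have win (s : R) : 0 < s < r ^+ 2 ->
    (\int[leb]_(t in `]s, (r ^+ 2)%R[) (1 * window_kernel l t s * 1 ^+ 2)%:E <= l%:E)%E.
  move=> _; apply: (@le_trans _ _ (\int[leb]_t (\1_(`[s, s + l]%classic : set R) t)%:E)%E).
    rewrite integral_mkcond; apply: ge0_le_integral_nomeas => t _; rewrite patchE.
      by case: ifP => // _; rewrite lee_fin !mul1r expr1n mulr1 window_kernel_ge0.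
    case: ifPn => [ts|_]; last by rewrite (_ : point = 0%E)// lee_fin.
    rewrite lee_fin !mul1r expr1n mulr1 /window_kernel; case: ifP => // tl.
    move: ts; rewrite inE/= in_itv/= => /andP[st _].
    by rewrite indicE mem_set//= in_itv/= (ltW st) -lerBlDr.
  apply: le_trans (integral_itv_indic_le (_ : s <= s + l)) _; first by rewrite lerDl ltW.
  by rewrite lee_fin addrAC subrr add0r.
have m1 : measurable_fun setT ((fun=> 1) : measurableTypeR R -> R) by exact: measurable_cst.
have p1 (t : R) : 0 <= 1 :> R by exact: ler01.
have BS := box_schwarz (a := 4) (phi := fun=> 1) (sg := fun=> 1) xB r0 (ltr0Sn _ _) (lexx 4) l0 (ltW l0)
  (measurable_window_kernel l) (window_kernel_ge0 l) m1 p1 m1 p1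
  mF Fsupp mass win.
apply: (@le_trans _ _ ((2 * sqrt2n (n := n) * (l * l))%:E * V%:E)%E); last by rewrite -EFinM.
apply: le_trans (lee_wpmul2l _ hz); last first.
  by rewrite lee_fin mulr_ge0 ?mulr_ge0 ?(ltW l0)// ltW// sqrt2n_gt0.
apply: le_trans BS; apply: ge0_le_integral_nomeas => w _; first exact: sqre_ge0.
by rewrite mul1e.
Qed.

Definition near_part (h : T) : R := \1_(eball xB (2 * r)) h.2 * F h.

Let mnear_ball : measurable (eball xB (2 * r)).
Proof. by apply: measurable_eball; rewrite mulr_gt0. Qed.

Lemma measurable_near_part : measurable_fun setT near_part.
Proof.
apply: measurable_funM; last exact: mF.
exact: measurableT_comp (measurable_indic mnear_ball) measurable_snd.
Qed.

Lemma near_part_sqr (h : T) :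
  near_part h ^+ 2 <= 2 * (gauss_weight r (h.2 - xB) * F h ^+ 2).
Proof.
have w0 := gauss_weight_ge0 r (h.2 - xB).
rewrite /near_part indicE; case: (boolP (h.2 \in _)) => hB; last first.
  by rewrite mul0r expr0n/= mulr_ge0// mulr_ge0// sqr_ge0.
rewrite mul1r mulrA ler_peMl ?sqr_ge0//.
have r20 : 0 < 2 * r by rewrite mulr_gt0.
move: hB; rewrite inE => /eballE-/(_ r20) hB.
(* On the double ball the exponent is even below 1/16, and [expR (- u) >= 1 - u] makes the weight at
   least 1/2. *)
have H : sqn (h.2 - xB) / (64 * r ^+ 2) <= 2^-1.
  rewrite ler_pdivrMr ?mulr_gt0 ?exprn_gt0//.
  by have := sqr_ge0 r; move: hB; rewrite exprMn; lra.
have := expR_ge1Dx (- (sqn (h.2 - xB) / (64 * r ^+ 2))).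
rewrite -/(gauss_weight r (h.2 - xB)); move: (gauss_weight _ _) w0 H => u; lra.
Qed.

Lemma integral_near_part_sqr : (\int[m]_h (near_part h ^+ 2)%:E <= (2 * V)%:E)%E.
Proof.
have mw : measurable_fun setT (fun h : T => (gauss_weight r (h.2 - xB) * F h ^+ 2)%:E).
  apply/measurable_EFinP; apply: measurable_funM; last exact: measurable_funX.
  apply: measurable_gauss_weight; exact: measurableT_comp (measurable_sub_rV xB) measurable_snd.
apply: (@le_trans _ _ (\int[m]_h (2%:E * (gauss_weight r (h.2 - xB) * F h ^+ 2)%:E))%E).
  apply: ge0_le_integral_nomeas => h _; first by rewrite lee_fin sqr_ge0.
  by rewrite -EFinM lee_fin near_part_sqr.
rewrite ge0_integralZl//; last first.
  by move=> h _; rewrite lee_fin mulr_ge0 ?gauss_weight_ge0 ?sqr_ge0.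
by rewrite [leRHS]EFinM lee_wpmul2l.
Qed.

Lemma integrable_near_part_sqr : m.-integrable setT (EFin \o (fun h => near_part h ^+ 2)).
Proof.
apply/integrableP; split.
  by apply/measurable_EFinP; apply: measurable_funX; exact: measurable_near_part.
apply: le_lt_trans (ltry (2 * V)); apply: le_trans integral_near_part_sqr.
apply: ge0_le_integral_nomeas => h _ //=; by rewrite ger0_norm ?sqr_ge0.
Qed.

Lemma integrable_box_indic (C : set 'rV[R]_n) : measurable C -> (lam C < +oo)%E ->
  m.-integrable setT (EFin \o (fun h : T => \1_I h.1 * \1_C h.2)).
Proof.
move=> mC Coo; apply: integrable_mul_prod.
  apply/integrableP; split; first exact/measurable_EFinP/measurable_indic.
  under eq_integral do rewrite /= ger0_norm//.
  rewrite integral_indic// setIT.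
  apply: le_lt_trans (lebesgue_itv_le (_ : 0 <= r ^+ 2) _ _) (ltry _) => //.
    exact: sqr_ge0.
  by move=> t/=; rewrite !in_itv/= => /andP[/ltW -> /ltW ->].
apply/integrableP; split; first exact/measurable_EFinP/measurable_indic.
under eq_integral do rewrite /= ger0_norm//.
by rewrite integral_indic// setIT.
Qed.

(** The near part lives on a box of finite measure, where [|u| <= 1 + u^2] passes from square
    integrability to integrability. *)
Lemma integrable_near_part : m.-integrable setT (EFin \o near_part).
Proof.
have Boo : (lam (eball xB (2 * r)) < +oo)%E.
  by apply: le_lt_trans (eball_measure_ub _ _) (ltry _); rewrite mulr_gt0.
have H := integrableD measurableT (integrable_box_indic mnear_ball Boo) integrable_near_part_sqr.
apply: (le_integrable measurableT _ _ H).
  by apply/measurable_EFinP; exact: measurable_near_part.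
move=> h _; rewrite /= lee_fin.
have P0 : 0 <= \1_I h.1 * \1_(eball xB (2 * r)) h.2 :> R by rewrite mulr_ge0.
rewrite [leRHS]ger0_norm; last by rewrite addr_ge0// sqr_ge0.
have [hI|/Fsupp hI] := boolP (0 < h.1 < r ^+ 2); last first.
  by rewrite /near_part hI mulr0 normr0 expr0n/= addr0.
have -> : \1_I h.1 = 1 :> R by rewrite indicE mem_set//= in_itv/=.
rewrite mul1r /near_part indicE; case: (_ \in _); last first.
  by rewrite mul0r normr0 expr0n/= addr0.
by rewrite !mul1r; exact: norm_le_1sqr.
Qed.

Definition trunc_kernel (a : R) (w h : T) : R := dt_kernel a (w.1 - a, w.2) h.

Lemma trunc_kernelE (a t s : R) x y : trunc_kernel a (t, x) (s, y) =
  if s <= t - a then heat_dt (t - s) (x - y) else 0.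
Proof. by rewrite /trunc_kernel /dt_kernel/=; case: ifP => // _; congr heat_dt; ring. Qed.

Lemma measurable_trunc_kernel (a : R) :
  measurable_fun setT (fun p : T * T => trunc_kernel a p.1 p.2).
Proof.
have mp : measurable_fun setT (fun p : T * T => (((p.1.1 - a, p.1.2), p.2) : T * T)).
  apply: measurable_fun_pair; last exact: measurable_snd.
  apply: measurable_fun_pair; last exact: measurableT_comp measurable_snd measurable_fst.
  apply: measurableT_comp (measurable_translate a) _.
  exact: measurableT_comp measurable_fst measurable_fst.
exact: measurableT_comp (measurable_dt_kernel a) mp.
Qed.

Let mtk a w : measurable_fun setT (trunc_kernel a w).
Proof. exact: measurableT_comp (measurable_trunc_kernel a) (pair1_measurable w). Qed.

(* Since the kernel has mean zero in space, [M_heat_trunc a f] coincides on the box with its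
   action on the centered function, for which the integral converges absolutely. *)
Definition M_op (a : R) (w : T) : R := \int[m]_h (trunc_kernel a w h * F h).

Lemma measurable_M_op (a : R) : measurable_fun setT (M_op a).
Proof.
apply: (@measurable_Rintegral2 _ _ T T R m (fun p => trunc_kernel a p.1 p.2 * F p.2)).
apply: measurable_funM; first exact: measurable_trunc_kernel.
exact: measurableT_comp mF measurable_snd.
Qed.

Lemma integrable_gauss_weight : lam.-integrable setT (EFin \o (fun y => gauss_weight r (y - xB))).
Proof.
(* At this time [4 t = 64 r^2], so the weight is a multiple of the heat kernel. *)
pose t := 16 * r ^+ 2; have t0 : 0 < t by rewrite mulr_gt0 ?exprn_gt0.
pose A := Num.sqrt (4 * pi * t) ^+ n.
have A0 : 0 < A by rewrite exprn_gt0// sqrtr_gt0 mulr_gt0 ?mulr_gt0 ?pi_gt0.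
have H := integrableZl measurableT A (integrable_heat_kernel xB t0).
congr (_.-integrable _ _): H; apply/funext => y.
rewrite -EFinM; congr EFin; rewrite heat_kernelE -/A mulrA divff ?lt0r_neq0// mul1r.
rewrite /gauss_weight /t; congr (expR (- (_ / _))); ring.
Qed.

(** The truncation keeps [t - s >= a], so on the box the kernel is at most a constant times the
    weight, and [|F| <= 1 + F^2]. *)
Lemma integrable_trunc_kernel (a : R) (w : T) : 0 < a -> (I `*` B) w ->
  m.-integrable setT (EFin \o (fun h => trunc_kernel a w h * F h)).
Proof.
move: w => [t x] a0 [/= tI xB']; move: tI; rewrite in_itv/= => /andP[t0 tr].
have xr : sqn (x - xB) <= r ^+ 2 by move: xB' => /eballE-/(_ r0)/ltW.
pose wt (h : T) := gauss_weight r (h.2 - xB).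
have wt0 h : 0 <= wt h by exact: gauss_weight_ge0.
have mwt : measurable_fun setT wt.
  apply: measurable_gauss_weight; exact: measurableT_comp (measurable_sub_rV xB) measurable_snd.
have iI : leb.-integrable setT (EFin \o (\1_I : measurableTypeR R -> R)).
  apply/integrableP; split; first exact/measurable_EFinP/measurable_indic.
  under eq_integral do rewrite /= ger0_norm//.
  rewrite integral_indic// setIT.
  apply: le_lt_trans (lebesgue_itv_le (_ : 0 <= r ^+ 2) _ _) (ltry _) => //.
    exact: sqr_ge0.
  by move=> u/=; rewrite !in_itv/= => /andP[/ltW -> /ltW ->].
have i1 : m.-integrable setT (EFin \o (fun h => \1_I h.1 * wt h)).
  exact: integrable_mul_prod iI integrable_gauss_weight.
have i2 : m.-integrable setT (EFin \o (fun h => wt h * F h ^+ 2)).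
  apply/integrableP; split.
    by apply/measurable_EFinP; apply: measurable_funM => //; exact: measurable_funX.
  apply: le_lt_trans (ltry V); apply: le_trans hz.
  by apply: ge0_le_integral_nomeas => h _ //=; rewrite ger0_norm// mulr_ge0 ?sqr_ge0.
pose C : R := heat_dt_cst (n := n) / a * (2 * sqrt2n (n := n) * Num.sqrt (4 * pi * a) ^- n).
have D0 := heat_dt_cst_gt0 (R := R) (n := n); have s0 := sqrt2n_gt0 (R := R) (n := n).
have C0 : 0 <= C.
  rewrite mulr_ge0 ?(divr_ge0 (ltW D0) (ltW a0))// mulr_ge0 ?invr_ge0 ?exprn_ge0 ?sqrtr_ge0//.
  by rewrite mulr_ge0// ltW.
have H := integrableZl measurableT C (integrableD measurableT i1 i2).
apply: (le_integrable measurableT _ _ H).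
  by apply/measurable_EFinP; exact: measurable_funM.
move=> -[s y] _; rewrite /= lee_fin.
have w0 : 0 <= wt (s, y) by exact: wt0.
have RHS0 : 0 <= C * (\1_I s * wt (s, y) + wt (s, y) * F (s, y) ^+ 2).
  by rewrite mulr_ge0// addr_ge0// mulr_ge0// sqr_ge0.
rewrite [leRHS]ger0_norm// trunc_kernelE; case: ifPn => [st|_]; last by rewrite mul0r normr0.
have [sI|/(Fsupp (h := (s, y))) Fsy] := boolP (0 < s < r ^+ 2); last by rewrite [in leLHS]Fsy mulr0 normr0.
have -> : \1_I s = 1 :> R by rewrite indicE mem_set//= in_itv/=.
have ats : a <= t - s by rewrite lerBrDr addrC -lerBrDr.
have ts0 := lt_le_trans a0 ats.
have hk : `|heat_dt (t - s) (x - y)| <= C * wt (s, y).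
  apply: le_trans (heat_dt_bound _ ts0) _.
  have tr4 : 2 * (t - s) <= 4 * r ^+ 2.
    by case/andP: sI => s1 _; have := sqr_ge0 r; lra.
  apply: (@le_trans _ _ (heat_dt_cst (n := n) / a * (2 * sqrt2n (n := n) * wt (s, y) * Num.sqrt (4 * pi * a) ^- n))).
    apply: ler_pM; rewrite ?heat_kernel_ge0 ?divr_ge0 ?(ltW D0) ?(ltW ts0)//.
      by rewrite ler_wpM2l ?(ltW D0)// lef_pV2.
    apply: le_trans (heat_kernel_weight y r0 (mulr_gt0 (ltr0Sn _ 1) ts0) tr4 xr) _.
    rewrite ler_wpM2l ?mulr_ge0 ?(ltW s0)//.
    apply: le_trans (heat_kernel_le _ _) _; first by rewrite !mulr_gt0.
    by apply: sqrt_exp_le => //; lra.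
  by rewrite /C le_eqVlt; apply/orP; left; apply/eqP; ring.
rewrite normrM; apply: (le_trans (ler_wpM2r (normr_ge0 _) hk)).
rewrite mul1r -[leLHS]mulrA ler_wpM2l// -[X in _ <= X + _]mulr1 -mulrDr ler_wpM2l//.
exact: norm_le_1sqr.
Qed.

Definition far_op (a : R) (w : T) : R := \int[m]_h (trunc_kernel a w h * (F h - near_part h)).

Let mfar : measurable_fun setT (fun h => F h - near_part h).
Proof. by apply: measurable_funB; [exact: mF|exact: measurable_near_part]. Qed.

Let integrable_far (a : R) w : 0 < a -> (I `*` B) w ->
  m.-integrable setT (EFin \o (fun h => trunc_kernel a w h * (F h - near_part h))).
Proof.
move=> a0 wIB; have H := integrableB measurableT (integrable_trunc_kernel a0 wIB)
  (integrable_dt_op integrable_near_part (w.1 - a, w.2) a0).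
by congr (_.-integrable _ _): H; apply/funext => h; rewrite /= -EFinB mulrBr.
Qed.

Lemma M_op_split (a : R) w : 0 < a -> (I `*` B) w ->
  M_op a w = dt_trunc near_part a w + far_op a w.
Proof.
move=> a0 wIB; rewrite /dt_trunc /dt_op /far_op -RintegralD//.
- by apply: eq_Rintegral => h _; rewrite /trunc_kernel; ring.
- exact: (integrable_dt_op integrable_near_part).
- exact: integrable_far.
Qed.

(** For [x] in the ball and [y] outside its double, [4 r^2 <= 2 |x - y|^2 + 2 r^2], so
    [|x - y| >= r] and [heat_dt_far] applies. *)
Lemma far_kernel_le (t s : R) x y : 0 < t < r ^+ 2 -> B x -> s < t ->
  `|heat_dt (t - s) (x - y) * (F (s, y) - near_part (s, y))| <=
  far_cst (R := R) (n := n) / r ^+ 2 * (heat_kernel (4 * (t - s)) (x - y) * `|F (s, y)|).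
Proof.
move=> tI xB' st; have ts0 : 0 < t - s by rewrite subr_gt0.
have xr : sqn (x - xB) < r ^+ 2 by move: xB' => /eballE-/(_ r0).
have c0 : 0 <= far_cst (R := R) (n := n) / r ^+ 2.
  by rewrite divr_ge0 ?sqr_ge0// mulr_ge0 ?mulr_ge0 ?(ltW heat_dt_cst_gt0)// ltW// sqrt2n_gt0.
rewrite /near_part /= indicE; case: (boolP (y \in _)) => yB.
  by rewrite mul1r subrr mulr0 normr0 mulr_ge0// mulr_ge0// heat_kernel_ge0.
rewrite mul0r subr0 normrM mulrA ler_wpM2r//; apply: heat_dt_far => //.
have r20 : 0 < 2 * r by rewrite mulr_gt0.
move: yB; rewrite notin_setE => /eballE-/(_ r20)/negP; rewrite -leNgt exprMn => yr.
have := sqnD (y - x) (x - xB); rewrite addrA subrK -[y - x]opprB sqnN.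
move: yr xr; lra.
Qed.

Lemma far_integral_le (k : T -> R) (l : R) w : measurable_fun setT k ->
  (forall h, `|k h * (F h - near_part h)| <=
     far_cst (R := R) (n := n) / r ^+ 2 * (causal_kernel (window_kernel l) 4 w h * (1 * `|F h|))) ->
  (`|\int[m]_h (k h * (F h - near_part h))|%:E <=
   (far_cst (R := R) (n := n) / r ^+ 2)%:E * window_majorant l F w)%E.
Proof.
move=> mk kF; have c0 : 0 <= far_cst (R := R) (n := n) / r ^+ 2.
  by rewrite divr_ge0 ?sqr_ge0// mulr_ge0 ?mulr_ge0 ?(ltW heat_dt_cst_gt0)// ltW// sqrt2n_gt0.
apply: le_trans (abs_Rintegral_le m _) _; first exact: measurable_funM.
rewrite -ge0_integralZl//; last 2 first.
- apply/measurable_EFinP; apply: measurable_funM.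
    exact: measurableT_comp (measurable_causal_kernel 4 (measurable_window_kernel l)) (pair1_measurable w).
  by apply: measurable_funM => //; exact: measurableT_comp.
- move=> h _; rewrite lee_fin; apply: mulr_ge0; last by rewrite mul1r.
  exact: causal_kernel_ge0 (window_kernel_ge0 l).
by apply: ge0_le_integral_nomeas => h _ //; rewrite -EFinM lee_fin.
Qed.

Let causal_window_ge0 l w h : 0 <= far_cst (R := R) (n := n) / r ^+ 2 *
  (causal_kernel (window_kernel l) 4 w h * (1 * `|F h|)).
Proof.
apply: mulr_ge0.
  by rewrite divr_ge0 ?sqr_ge0// mulr_ge0 ?mulr_ge0 ?(ltW heat_dt_cst_gt0)// ltW// sqrt2n_gt0.
apply: mulr_ge0; last by rewrite mul1r.
exact: causal_kernel_ge0 (window_kernel_ge0 l).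
Qed.

Let near0 s y : F (s, y) = 0 -> F (s, y) - near_part (s, y) = 0.
Proof. by rewrite /near_part => ->; rewrite mulr0 subrr. Qed.

Lemma far_op_le (a : R) w : 0 < a -> (I `*` B) w ->
  (`|far_op a w|%:E <=
   (far_cst (R := R) (n := n) / r ^+ 2)%:E * window_majorant (r ^+ 2) F w)%E.
Proof.
move: w => [t x] a0 [/= tI xB']; move: tI; rewrite in_itv/= => tI.
apply: far_integral_le => // -[s y].
have [sI|/(Fsupp (h := (s, y))) Fsy] := boolP (0 < s < r ^+ 2); last first.
  by rewrite near0// mulr0 normr0; exact: causal_window_ge0.
rewrite trunc_kernelE; case: ifPn => [sta|_]; last by rewrite mul0r normr0; exact: causal_window_ge0.
have st : s < t by apply: le_lt_trans sta _; rewrite gtrBl.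
apply: le_trans (far_kernel_le y tI xB' st) _.
rewrite /causal_kernel/= st /window_kernel ifT ?mul1r//.
by case/andP: tI => _ tr; case/andP: sI => s0 _; rewrite lerBlDr (le_trans (ltW tr))// lerDr ltW.
Qed.

(** Two truncations see the same sources except some at distance at most [l] in time, and the far
    kernel is not singular there. *)
Lemma far_op_sub_le (a b l : R) w : 0 < a <= l -> 0 < b <= l -> (I `*` B) w ->
  (`|far_op a w - far_op b w|%:E <=
   (far_cst (R := R) (n := n) / r ^+ 2)%:E * window_majorant l F w)%E.
Proof.
move=> /andP[a0 al] /andP[b0 bl] wIB.
rewrite /far_op -RintegralB//; [|exact: integrable_far|exact: integrable_far].
rewrite (@eq_Rintegral _ _ _ m setT (fun h => (trunc_kernel a w h - trunc_kernel b w h) * (F h - near_part h))); last first.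
  by move=> h _; rewrite mulrBl.
apply: far_integral_le; first by apply: measurable_funB.
move: w wIB => [t x] [/= tI xB']; move: tI; rewrite in_itv/= => tI -[s y].
rewrite !trunc_kernelE.
have main (c : R) : 0 < c <= l -> s <= t - c -> t - l <= s ->
    `|heat_dt (t - s) (x - y) * (F (s, y) - near_part (s, y))| <=
    far_cst (R := R) (n := n) / r ^+ 2 * (causal_kernel (window_kernel l) 4 ((t, x) : T) ((s, y) : T) * (1 * `|F (s, y)|)).
  move=> /andP[c0 _] stc tls; have st : s < t by apply: le_lt_trans stc _; rewrite gtrBl.
  apply: le_trans (far_kernel_le y tI xB' st) _.
  by rewrite /causal_kernel/= st /window_kernel tls !mul1r.
case: ifPn => sa; case: ifPn => sb.
- by rewrite subrr mul0r normr0; exact: causal_window_ge0.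
- rewrite subr0; apply: (main a) => //; first by rewrite a0.
  by rewrite -ltNge in sb; apply: le_trans (ltW sb); rewrite lerB.
- rewrite sub0r mulNr normrN; apply: (main b) => //; first by rewrite b0.
  by rewrite -ltNge in sa; apply: le_trans (ltW sa); rewrite lerB.
- by rewrite subr0 mul0r normr0; exact: causal_window_ge0.
Qed.

Lemma M_heat_truncE (a t : R) x : 0 < a -> (I `*` B) ((t, x) : T) ->
  M_heat_trunc a f x t = M_op a (t, x).
Proof.
move=> a0 tx; have [/= + xB'] := tx; rewrite in_itv/= => /andP[t0 tr].
have [N [mN N0 HN]] := good_times mf K0 bmo n0.
rewrite /M_op; have [-> _] := @Rintegral_fubini _ _ _ _ R leb lam
  (fun h => trunc_kernel a (t, x) h * F h) (integrable_trunc_kernel a0 tx).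
(* The truncated integral excludes the time [t - a] while [trunc_kernel] includes it; this point
   joins the null set. *)
have mta : measurable ([set t - a] : set (measurableTypeR R)) by exact: measurable_set1.
have mN' : measurable (N `|` [set t - a]) by exact: measurableU.
have N'0 : leb (N `|` [set t - a]) = 0%E.
  by rewrite measureU0//; exact: lebesgue_measure_set1.
rewrite /M_heat_trunc Rintegral_mkcond.
apply: (Rintegral_null_eq mN' N'0) => s _ NNs.
have Ns : ~ N s by move=> H; apply: NNs; left.
have sta : s != t - a by apply/eqP => H; apply: NNs; right.
rewrite patchE; case: ifPn => [|sI].
  rewrite inE/= in_itv/= => /andP[s0 st'].
  have st : s < t by apply: lt_trans st' _; rewrite gtrBl.
  rewrite (derive1_heat_centered (f z s) x (HN s s0 Ns) st).
  apply: eq_Rintegral => y _; rewrite trunc_kernelE (ltW st') /centered /upper_ext/= s0.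
  by rewrite indicE mem_set ?mul1r//= in_itv/= s0 (lt_trans st).
apply/esym; transitivity (\int[lam]_(y in setT) (0 : R)); last by rewrite Rintegral_cst// mul0r.
apply: eq_Rintegral => y _; rewrite trunc_kernelE; case: ifPn => [sle|_]; last by rewrite mul0r.
rewrite (Fsupp (h := (s, y))) ?mulr0//=; apply/negP => /andP[s0 _].
by move: sI; rewrite notin_setE/= in_itv/= s0 lt_neqAle sta sle; apply.
Qed.


(* The first term comes from [near_part], the second one from its complement. *)
Definition M_cst : R := 2 * 2 + 2 * (far_cst (R := R) (n := n) ^+ 2 * (2 * sqrt2n (R := R) (n := n))).

Let c : R := far_cst (R := R) (n := n) / r ^+ 2.

Let c0 : 0 <= c.
Proof.
by rewrite divr_ge0 ?sqr_ge0// mulr_ge0 ?mulr_ge0 ?(ltW heat_dt_cst_gt0)// ltW// sqrt2n_gt0.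
Qed.

Let mIB : measurable (I `*` B : set T). Proof. exact: measurableX. Qed.

Lemma window_far (l : R) : 0 < l ->
  (\int[m]_(w in I `*` B) ((c ^+ 2)%:E * window_majorant l F w ^+ 2) <=
   (c ^+ 2 * (2 * sqrt2n (R := R) (n := n) * (l * l) * V))%:E)%E.
Proof.
move=> l0; rewrite ge0_integralZl//; last 3 first.
- by apply: measurable_funTS; apply: measurable_sqre; exact: measurable_window_majorant mF.
- by move=> w _; exact: sqre_ge0.
- by rewrite lee_fin sqr_ge0.
by rewrite [leRHS]EFinM; apply: lee_wpmul2l (window_box l0); rewrite lee_fin sqr_ge0.
Qed.

Let mwin (l : R) : measurable_fun (I `*` B) (fun w => (c ^+ 2)%:E * window_majorant l F w ^+ 2)%E.
Proof.
apply: measurable_funTS; apply: measurable_funeM.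
apply: measurable_sqre; exact: measurable_window_majorant mF.
Qed.

Let win0 (l : R) w : (0 <= (c ^+ 2)%:E * window_majorant l F w ^+ 2)%E.
Proof. by rewrite mule_ge0 ?sqre_ge0// lee_fin sqr_ge0. Qed.

Let sqrD_le (u v : R) : `|u + v| ^+ 2 <= 2 * u ^+ 2 + 2 * `|v| ^+ 2.
Proof. by rewrite !real_normK ?num_real//; have := sqr_ge0 (u - v); rewrite !expr2; lra. Qed.

Lemma M_op_L2 (a : R) : 0 < a ->
  (\int[m]_(w in I `*` B) (`|M_op a w| ^+ 2)%:E <= (M_cst * V)%:E)%E.
Proof.
move=> a0; pose u1 w := (dt_trunc near_part a w ^+ 2)%:E.
have mu1 : measurable_fun setT u1.
  apply/measurable_EFinP; apply: measurable_funX; 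
  exact: (measurable_dt_trunc integrable_near_part a0).
have H1 : (\int[m]_(w in I `*` B) u1 w <= (2 * V)%:E)%E.
  apply: (@le_trans _ _ (\int[m]_w u1 w)%E).
    by apply: ge0_subset_integral => // w _; rewrite lee_fin sqr_ge0.
  exact: le_trans (dt_trunc_L2 integrable_near_part integrable_near_part_sqr a0) integral_near_part_sqr.
have r20 : 0 < r ^+ 2 by rewrite exprn_gt0.
have := @ge0_integral_le_twice _ _ _ m (I `*` B) (fun w => (`|M_op a w| ^+ 2)%:E) u1
  (fun w => (c ^+ 2)%:E * window_majorant (r ^+ 2) F w ^+ 2)%E _ _ mIB (measurable_funTS mu1) (mwin _)
  _ _ (fun w _ => win0 _ w) _ H1 (window_far r20).
rewrite (_ : 2 * (2 * V) + _ = M_cst * V); last first.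
  rewrite /M_cst /c expr_div_n; have := lt0r_neq0 r0; move: (sqrt2n) (far_cst) V => ? ? ? ?; by field.
apply => w wIB; rewrite ?lee_fin ?sqr_ge0//.
rewrite M_op_split//; apply: (@le_trans _ _ (2 * dt_trunc near_part a w ^+ 2 + 2 * `|far_op a w| ^+ 2)%:E).
  by rewrite lee_fin sqrD_le.
rewrite EFinD (EFinM 2 (dt_trunc _ _ _ ^+ 2)) (EFinM 2 (`|_| ^+ 2)); apply: leeD => //; apply: lee_wpmul2l => //.
by apply: sqr_le_expe2 => //; [exact: window_majorant_ge0|exact: far_op_le].
Qed.

Lemma M_op_cauchy (e : R) : 0 < e -> exists2 del : R, 0 < del &
  forall a b, 0 < a < del -> 0 < b < del ->
  (\int[m]_(w in I `*` B) (`|M_op a w - M_op b w| ^+ 2)%:E <= e%:E)%E.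
Proof.
move=> e0; have e4 : 0 < e / 4 by rewrite divr_gt0.
have Ioo : (leb I < +oo)%E.
  by rewrite lebesgue_measure_itv/= lte_fin exprn_gt0// -EFinB ltry.
have Boo : (lam B < +oo)%E by exact: le_lt_trans (eball_measure_ub _ r0) (ltry _).
have [d d0 hd] := dt_trunc_cauchy integrable_near_part integrable_near_part_sqr mI mB Ioo Boo e4.
pose D : R := c ^+ 2 * (2 * sqrt2n (R := R) (n := n) * V).
have D0 : 0 <= D.
  by rewrite mulr_ge0 ?sqr_ge0// mulr_ge0// mulr_ge0// ltW// sqrt2n_gt0.
have D1 : 0 < D + 1 by rewrite ltr_wpDl.
(* With [l <= 1] the far contribution satisfies [D * l^2 <= D * l <= e / 4]. *)
pose l : R := Num.min 1 (e / 4 / (D + 1)).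
have l0 : 0 < l by rewrite lt_min ltr01 divr_gt0.
have l1 : l <= 1 by rewrite ge_min lexx.
have lD : D * (l * l) <= e / 4.
  have : l * (D + 1) <= e / 4 by rewrite -ler_pdivlMr// ge_min lexx orbT.
  have : D * l * l <= D * l * 1 by rewrite ler_wpM2l// mulr_ge0// ltW.
  rewrite mulr1 mulrDr mulr1 mulrA [l * D]mulrC; move: l0; move: (D * l * l) (D * l) (l) (e / 4) => ? ? ? ?; lra.
exists (Num.min d l); first by rewrite lt_min d0.
move=> a b /andP[a0 ad] /andP[b0 bd]; move: ad bd; rewrite !lt_min => /andP[ad al] /andP[bd bl].
have mdt q : 0 < q -> measurable_fun setT (dt_trunc near_part q).
  by move=> q0; exact: (measurable_dt_trunc integrable_near_part q0).
pose u1 w := (`|dt_trunc near_part a w - dt_trunc near_part b w| ^+ 2)%:E.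
have mu1 : measurable_fun setT u1.
  apply/measurable_EFinP; apply: measurable_funX; apply: measurableT_comp => //.
  by apply: measurable_funB; exact: mdt.
have H1 : (\int[m]_(w in I `*` B) u1 w <= (e / 4)%:E)%E by apply: hd; rewrite ?a0 ?b0.
have H2 := le_trans (window_far l0) (_ : _ <= (e / 4)%:E)%E.
have := @ge0_integral_le_twice _ _ _ m (I `*` B) (fun w => (`|M_op a w - M_op b w| ^+ 2)%:E) u1
  (fun w => (c ^+ 2)%:E * window_majorant l F w ^+ 2)%E _ _ mIB (measurable_funTS mu1) (mwin _)
  _ _ (fun w _ => win0 _ w) _ H1 (H2 _).
rewrite (_ : 2 * (e / 4) + _ = e); last by lra.
apply => [w wIB|w wIB|w wIB|]; rewrite ?lee_fin ?sqr_ge0//; last first.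
  by rewrite (_ : _ * _ = D * (l * l))// /D; ring.
rewrite !M_op_split// opprD addrACA.
apply: (@le_trans _ _ (2 * (dt_trunc near_part a w - dt_trunc near_part b w) ^+ 2 + 2 * `|far_op a w - far_op b w| ^+ 2)%:E).
  by rewrite lee_fin sqrD_le.
rewrite /u1 real_normK ?num_real// EFinD (EFinM 2 ((_ - _) ^+ 2)) (EFinM 2 (`|_| ^+ 2)); apply: leeD => //; apply: lee_wpmul2l => //.
apply: sqr_le_expe2 => //; first exact: window_majorant_ge0.
have al' : 0 < a <= l by rewrite a0 ltW// /l lt_min.
have bl' : 0 < b <= l by rewrite b0 ltW// /l lt_min.
exact: (far_op_sub_le al' bl' wIB).
Qed.

End maximal_regularity_truncation.

(** * Gluing of local limits *)

Section piecewise_countable.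
Context d (T : measurableType d) (R : realType).

Lemma measurable_fun_piecewise_nat (g : nat -> T -> R) (h : T -> R) :
  (forall j, measurable_fun setT (g j)) -> measurable_fun setT h ->
  measurable_fun setT (fun w => g (Num.truncn (h w)) w).
Proof.
move=> mg mh _ Y mY; rewrite setTI.
have mle (k : nat) : measurable [set w | (Num.truncn (h w) <= k)%N].
  rewrite (_ : [set _ | _] = h @^-1` `]-oo, k.+1%:R[%classic).
    by rewrite -[X in measurable X]setTI; exact: mh.
  by apply/seteqP; split => w /=; rewrite in_itv/= truncn_le_nat.
have meq (k : nat) : measurable [set w | Num.truncn (h w) = k].
  case: k => [|k].
    rewrite (_ : [set _ | _] = [set w | (Num.truncn (h w) <= 0)%N]); first exact: mle.
    by apply/seteqP; split => w /=; rewrite leqn0 => /eqP.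
  rewrite (_ : [set _ | _] = [set w | (Num.truncn (h w) <= k.+1)%N] `\` [set w | (Num.truncn (h w) <= k)%N]).
    exact: measurableD.
  apply/seteqP; split => w /=; first by move=> ->; rewrite leqnn ltnn.
  by move=> [H /negP]; rewrite -ltnNge => H'; apply/eqP; rewrite eqn_leq H.
rewrite (_ : _ @^-1` _ = \bigcup_j ([set w | Num.truncn (h w) = j] `&` g j @^-1` Y)).
  apply: bigcup_measurable => j _; apply: measurableI => //.
  by rewrite -[X in measurable X]setTI; exact: mg.
apply/seteqP; split => w /=; first by move=> H; exists (Num.truncn (h w)).
by move=> [j _ [<-]].
Qed.

End piecewise_countable.

Section right_limits.
Context {R : realType}.
Implicit Types X : R -> \bar R.
Local Open Scope ereal_scope.

Lemma cvg0_at_right X : (forall a, (0 < a)%R -> 0 <= X a) ->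
  (forall e : R, (0 < e)%R -> exists2 del : R, (0 < del)%R &
     forall a, (0 < a < del)%R -> X a <= e%:E) ->
  X a @[a --> 0^'+] --> 0.
Proof.
move=> X0 XP; apply/fine_cvgP; split.
  have [del del0 H] := XP _ ltr01.
  near=> a; rewrite ge0_fin_numE; last exact: X0.
  by apply: le_lt_trans (H a _) (ltry _); apply/andP; split.
apply/cvgrPdist_le => e e0; have [del del0 H] := XP _ e0.
near=> a; have a0 : (0 < a)%R by [].
have Xe : X a <= e%:E by apply: H; apply/andP; split.
rewrite sub0r normrN /=; move: (X0 a a0) Xe; case: (X a) => //= u; rewrite !lee_fin => u0 ue.
by rewrite ger0_norm.
Unshelve. all: by end_near. Qed.

Lemma cvg0_at_right_le X (e : R) : (0 < e)%R ->
  X a @[a --> 0^'+] --> 0 -> exists2 a : R, (0 < a)%R & X a <= e%:E.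
Proof.
move=> e0 /fine_cvgP[Xfin /cvgrPdist_le/(_ e e0) Xe].
have : \forall a \near (0%R : R)^'+, (0 < a)%R /\ X a <= e%:E.
  near=> a; split => //.
  have Xa : X a \is a fin_num by near: a.
  rewrite -(fineK Xa) lee_fin; apply: le_trans (ler_norm _) _.
  by rewrite -normrN -sub0r; near: a.
by move=> /filter_ex[a [a0 Ha]]; exists a.
Unshelve. all: by end_near. Qed.

End right_limits.

Section maximal_regularity.
Context {R : realType} {n : nat}.
Local Notation leb := (@lebesgue_measure R).
Local Notation lam := (lebesgue_rV (R := R) n).
Local Notation T := (measurableTypeR R * 'rV[R]_n)%type.
Local Notation m := (sigma_finite_product leb lam).
Variables (f : 'rV[R]_n -> R -> R) (K : R).
Hypothesis mf : measurable_upper f.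
Hypothesis K0 : 0 < K.
Hypothesis bmo : forall xB (r : R), 0 < r ->
  (\int[leb]_(t in `]0%R, (r ^+ 2)%R[)
      ((fine (lam (eball xB r)) ^- 2)%:E *
       \int[lam \x lam]_(z in eball xB r `*` eball xB r)
         (`|f z.1 t - f z.2 t| ^+ 2)%:E) <= K%:E)%E.
Hypothesis n0 : (0 < n)%N.

Definition parabolic_box xB (r : R) : set T := (`]0, (r ^+ 2)[%classic : set R) `*` eball xB r.

Let mbox xB (r : R) : 0 < r -> measurable (parabolic_box xB r).
Proof. by move=> r0; apply: measurableX; [exact: measurable_itv|exact: measurable_eball]. Qed.

Section fixed_box.
Variables (xB z : 'rV[R]_n) (r : R).
Hypothesis r0 : 0 < r.
Hypothesis hz : (\int[m]_h (gauss_weight r (h.2 - xB) * centered f r z h ^+ 2)%:E <=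
  (bmo_cst (n := n) * r ^+ n * K)%:E)%E.
Local Notation Q := (parabolic_box xB r).

Lemma M_op_limit : exists2 g : T -> R, measurable_fun setT g &
  forall e : R, 0 < e -> exists2 del : R, 0 < del & forall a, 0 < a < del ->
    (\int[m]_w (`|\1_Q w * M_op f z r a w - g w| ^+ 2)%:E <= e%:E)%E.
Proof.
apply: L2_complete => [a|e e0].
  apply: measurable_funM; last exact: measurable_M_op mf _ _ _.
  exact: measurable_indic (mbox xB r0).
have [del del0 H] := M_op_cauchy mf K0 r0 hz e0; exists del => // a b ad bd.
apply: le_trans (H a b ad bd); rewrite [leRHS]integral_mkcond.
apply: ge0_le_integral_nomeas => w _; first by rewrite lee_fin exprn_ge0.
rewrite patchE indicE -/Q; case: (w \in Q); first by rewrite !mul1r.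
by rewrite !mul0r subrr normr0 expr0n.
Qed.

Lemma M_heat_trunc_distance (a : R) (g : 'rV[R]_n -> R -> R) : 0 < a -> measurable_upper g ->
  (\int[leb]_(t in `]0%R, (r ^+ 2)%R[) \int[lam]_(x in eball xB r)
     (`|M_heat_trunc a f x t - g x t| ^+ 2)%:E =
   \int[m]_(w in Q) (`|M_op f z r a w - upper_ext g w| ^+ 2)%:E)%E.
Proof.
move=> a0 mg; rewrite /parabolic_box -(box_iterated (F := fun w => (`|M_op f z r a w - upper_ext g w| ^+ 2)%:E)).
- apply: eq_integral => t; rewrite inE/= => tI; apply: eq_integral => x; rewrite inE => xB'.
  rewrite (M_heat_truncE mf K0 bmo n0 r0 hz a0)//; move: tI; rewrite in_itv/= => /andP[t0 _].
  by rewrite /upper_ext/= t0.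
- exact: measurable_itv.
- exact: measurable_eball.
- apply/measurable_EFinP; apply: measurable_funX; apply: measurableT_comp => //.
  by apply: measurable_funB; [exact: measurable_M_op mf _ _ _|exact: measurable_upper_ext].
- by move=> w; rewrite lee_fin exprn_ge0.
Qed.

End fixed_box.

(** Any admissible limit is within [e / 2] of some truncation on the box, in squared norm, and
    truncations are bounded uniformly; hence the factor 2, and no dependence on the
    representative. *)
Lemma M_heat_box_le (g : 'rV[R]_n -> R -> R) xB (r : R) : is_M_heat f g -> 0 < r ->
  (\int[leb]_(t in `]0%R, (r ^+ 2)%R[) \int[lam]_(x in eball xB r) (`|g x t| ^+ 2)%:E <=
   (2 * M_cst (R := R) (n := n) * bmo_cst (n := n) * r ^+ n * K)%:E)%E.
Proof.
move=> [mg gP] r0; have [z _ hz] := weighted_oscillation mf K0 bmo xB n0 r0.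
set V := bmo_cst * r ^+ n * K in hz.
have mG := measurable_upper_ext mg.
have mQ := mbox xB r0.
rewrite (_ : (\int[leb]_(t in _) _)%E = (\int[m]_(w in parabolic_box xB r) (`|upper_ext g w| ^+ 2)%:E)%E); last first.
  rewrite /parabolic_box -(box_iterated (F := fun w => (`|upper_ext g w| ^+ 2)%:E))//.
  - apply: eq_integral => t; rewrite inE/= in_itv/= => /andP[t0 _]; apply: eq_integral => x _.
    by rewrite /upper_ext/= t0.
  - exact: measurable_eball.
  - apply/measurable_EFinP; apply: measurable_funX; exact: measurableT_comp.
apply/lee_addgt0Pr => e e0; have e2 : 0 < e / 2 by rewrite divr_gt0.
have [a a0] := cvg0_at_right_le e2 (gP xB r r0).
rewrite (M_heat_trunc_distance r0 hz a0 mg) => H1.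
have mMa := measurable_M_op mf z r a.
have := @ge0_integral_le_twice _ _ _ m (parabolic_box xB r) (fun w => (`|upper_ext g w| ^+ 2)%:E)
  (fun w => (`|M_op f z r a w - upper_ext g w| ^+ 2)%:E) (fun w => (`|M_op f z r a w| ^+ 2)%:E)
  _ _ mQ _ _ _ _ _ _ H1 (M_op_L2 mf r0 hz a0).
rewrite -EFinD (_ : 2 * (e / 2) + _ = 2 * M_cst (R := R) (n := n) * bmo_cst (n := n) * r ^+ n * K + e); last first.
  by rewrite /V; field.
apply => [||w _|w _|w _|w _]; rewrite ?lee_fin ?exprn_ge0//.
- apply: measurable_funTS; apply/measurable_EFinP; apply: measurable_funX; apply: measurableT_comp => //.
  exact: measurable_funB.
- by apply: measurable_funTS; apply/measurable_EFinP; apply: measurable_funX; exact: measurableT_comp.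
rewrite !real_normK ?num_real//; have := sqr_ge0 (2 * M_op f z r a w - upper_ext g w).
by move: (M_op f z r a w) (upper_ext g w) => u v; rewrite !expr2; lra.
Qed.

(** Each point takes its value from one box about 0 that contains it, chosen by an integer-valued
    function, which avoids proving that the limits on different boxes agree. A given box meets
    finitely many pieces, whose errors are added. *)
Lemma M_heat_exists : exists g : 'rV[R]_n -> R -> R, is_M_heat f g.
Proof.
have rj j : 0 < j.+1%:R :> R by rewrite ltr0n.
have /choice[z hz] : forall j : nat, exists z : 'rV[R]_n,
    (\int[m]_h (gauss_weight j.+1%:R (h.2 - 0) * centered f j.+1%:R z h ^+ 2)%:E <=
     (bmo_cst (n := n) * j.+1%:R ^+ n * K)%:E)%E.
  by move=> j; have [z _ hz] := weighted_oscillation mf K0 bmo 0 n0 (rj j); exists z.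
have /choice[G GP] : forall j : nat, exists g : T -> R, measurable_fun setT g /\
    forall e : R, 0 < e -> exists2 del : R, 0 < del & forall a, 0 < a < del ->
      (\int[m]_w (`|\1_(parabolic_box 0 j.+1%:R) w * M_op f (z j) j.+1%:R a w - g w| ^+ 2)%:E <= e%:E)%E.
  by move=> j; have [g mg gP] := M_op_limit (rj j) (hz j); exists g.
(* With [j] the integer part of this height, a point at positive time satisfies [t < j + 1] and
   [|x|^2 < j + 1], so it lies in the box of radius [j + 1]. *)
pose ht (w : T) : R := sqn w.2 + w.1.
have mht : measurable_fun setT ht.
  by apply: measurable_funD => //; apply: measurable_sqn; exact: measurable_snd.
pose g w := G (Num.truncn (ht w)) w.
have mg : measurable_fun setT g.
  by apply: measurable_fun_piecewise_nat => // j; have [] := GP j.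
have mgu : measurable_upper (fun x t => g (t, x)).
  apply: measurable_funTS; apply: measurableT_comp mg _.
  by apply: measurable_fun_pair; [exact: measurable_snd|exact: measurable_fst].
exists (fun x t => g (t, x)); split=> // xB r r0.
have [zB _ hzB] := weighted_oscillation mf K0 bmo xB n0 r0.
apply: cvg0_at_right => [a a0|e e0].
  by apply: integral_ge0 => t _; apply: integral_ge0 => x _; rewrite lee_fin exprn_ge0.
(* On the box [t < r^2] and [|x|^2 <= 2 r^2 + 2 |xB|^2], which bounds the height. *)
pose J := (Num.truncn (3 * r ^+ 2 + 2 * sqn xB)).+1.
have eJ : 0 < e / J%:R by rewrite divr_gt0// ltr0n.
have /choice[del delP] : forall j : nat, exists del : R, 0 < del /\ forall a, 0 < a < del ->
    (\int[m]_w (`|\1_(parabolic_box 0 j.+1%:R) w * M_op f (z j) j.+1%:R a w - G j w| ^+ 2)%:E <= (e / J%:R)%:E)%E.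
  by move=> j; have [_ /(_ _ eJ)[del del0 H]] := GP j; exists del.
exists (\big[Num.min/1]_(j < J) del j).
  by apply: lt_bigmin => // j _; have [] := delP j.
move=> a /andP[a0 adel]; have adelj (j : 'I_J) : 0 < a < del j.
  by rewrite a0 (lt_le_trans adel)//; exact: bigmin_le.
have mterm (j : nat) : measurable_fun setT (fun w =>
    (`|\1_(parabolic_box 0 j.+1%:R) w * M_op f (z j) j.+1%:R a w - G j w| ^+ 2)%:E).
  apply/measurable_EFinP; apply: measurable_funX; apply: measurableT_comp => //.
  apply: measurable_funB; last by have [] := GP j.
  by apply: measurable_funM; [exact: measurable_indic (mbox 0 (rj j))|exact: measurable_M_op].
rewrite (M_heat_trunc_distance r0 hzB a0 mgu) integral_mkcond.
apply: (@le_trans _ _ (\sum_(j < J) \int[m]_w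
    (`|\1_(parabolic_box 0 j.+1%:R) w * M_op f (z j) j.+1%:R a w - G j w| ^+ 2)%:E)%E); last first.
  apply: (@le_trans _ _ (\sum_(j < J) (e / J%:R)%:E)%E).
    by apply: lee_sum => j _; have [_] := delP j; exact.
  by rewrite sumEFin sumr_const card_ord lee_fin -[leLHS]mulr_natr divfK ?lt0r_neq0// ltr0n.
rewrite -ge0_integral_sum//.
apply: ge0_le_integral_nomeas => -[t x] _.
  by rewrite patchE; case: ifP => // _; rewrite lee_fin exprn_ge0.
rewrite patchE; case: ifPn => [|_]; last first.
  by rewrite (_ : point = 0%E)// sume_ge0// => j _; rewrite lee_fin exprn_ge0.
rewrite inE => tx; have [/= + /eballE-/(_ r0) xr] := tx; rewrite in_itv/= => /andP[t0 tr].
rewrite /upper_ext/= t0 -(M_heat_truncE mf K0 bmo n0 r0 hzB a0 tx) /g.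
set j := Num.truncn (ht (t, x)).
have x0 : 0 <= sqn x by rewrite sqn_ge0.
have jJ : (j < J)%N.
  rewrite ltnS le_truncn// /ht/=.
  by have := sqnD (x - xB) xB; rewrite subrK; move: xr tr; lra.
have htj : ht (t, x) < j.+1%:R by rewrite -truncn_le_nat.
have j1 : j.+1%:R <= j.+1%:R ^+ 2 :> R.
  by rewrite expr2 ler_peMl ?ler0n// ler1n.
have txj : parabolic_box 0 j.+1%:R (t, x).
  split => /=; first by rewrite in_itv/= t0; move: htj; rewrite /ht/=; lra.
  by apply/eballE => //; rewrite subr0; move: htj; rewrite /ht/=; lra.
rewrite (M_heat_truncE mf K0 bmo n0 (rj j) (hz j) a0 txj).
rewrite (bigD1 (Ordinal jJ))//= indicE mem_set// mul1r leeDl//.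
by apply: sume_ge0 => i _; rewrite lee_fin exprn_ge0.
Qed.

End maximal_regularity.

(** * From the estimates on boxes to the norm *)

Section bmo_norm.
Context {R : realType} {n : nat}.
Local Notation leb := (@lebesgue_measure R).
Local Notation lam := (lebesgue_rV (R := R) n).
Local Open Scope ereal_scope.

Lemma L2BMO_normE (f : 'rV[R]_n -> R -> R) : L2BMO_norm f < +oo ->
  exists s : R, [/\ (0 <= s)%R, L2BMO_norm f = (Num.sqrt s)%:E &
    forall K xB (r : R), (s <= K)%R -> (0 < r)%R ->
      \int[leb]_(t in `]0%R, (r ^+ 2)%R[)
        ((fine (lam (eball xB r)) ^- 2)%:E *
         \int[lam \x lam]_(z in eball xB r `*` eball xB r)
           (`|f z.1 t - f z.2 t| ^+ 2)%:E) <= K%:E].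
Proof.
rewrite /L2BMO_norm; set S := sup_eball _ => Soo.
have ball_le xB (r : R) : (0 < r)%R ->
    \int[leb]_(t in `]0%R, (r ^+ 2)%R[)
      ((fine (lam (eball xB r)) ^- 2)%:E *
       \int[lam \x lam]_(z in eball xB r `*` eball xB r)
         (`|f z.1 t - f z.2 t| ^+ 2)%:E) <= S.
  by move=> r0; apply: ereal_sup_ubound; exists (xB, r).
have S0 : 0 <= S.
  apply: le_trans (ball_le 0%R 1%R ltr01); apply: integral_ge0 => t _.
  rewrite mule_ge0//; first by rewrite lee_fin invr_ge0 exprn_ge0// fine_ge0.
  by apply: integral_ge0 => z _; rewrite lee_fin exprn_ge0.
move: S S0 Soo ball_le => [s| |]//= s0 _ ball_le; exists s; split => // K xB r sK r0.
by apply: le_trans (ball_le xB r r0) _; rewrite lee_fin.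
Qed.

(** The estimates on boxes assume [K > 0] while the norm may vanish; they are used for all [K > s],
    and [K] is then sent to [s]. *)
Lemma sqrte_scaled_le (X : \bar R) (r c C s : R) : (0 < r)%R -> (0 < C)%R -> (c <= C)%R -> (0 <= s)%R ->
  (forall K, (s < K)%R -> X <= (c * r ^+ n * K)%:E) ->
  sqrte ((r ^- n)%:E * X) <= (Num.sqrt C)%:E * (Num.sqrt s)%:E.
Proof.
move=> r0 C0 cC s0 XK; have rn : (0 < r ^+ n)%R by rewrite exprn_gt0.
have X0 : X <= (C * r ^+ n * s)%:E.
  apply/lee_addgt0Pr => e e0; set d := (e / (C * r ^+ n))%R.
  have Crn : (0 < C * r ^+ n)%R by rewrite mulr_gt0.
  have d0 : (0 < d)%R by rewrite divr_gt0.
  apply: le_trans (XK (s + d)%R _) _; first by rewrite ltrDl.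
  rewrite -EFinD lee_fin; apply: (@le_trans _ _ (C * r ^+ n * (s + d))%R).
    by rewrite ler_wpM2r ?addr_ge0 ?(ltW d0)// ler_wpM2r// ltW.
  by rewrite mulrDr lerD2l /d mulrC divfK// lt0r_neq0.
rewrite -EFinM -sqrtrM ?(ltW C0)//.
rewrite -[leRHS]/(sqrte (C * s)%:E) lee_sqrt ?lee_fin ?mulr_ge0// ?(ltW C0)//.
apply: (@le_trans _ _ ((r ^- n)%:E * (C * r ^+ n * s)%:E)).
  by rewrite lee_wpmul2l// lee_fin invr_ge0 ltW.
by rewrite -EFinM lee_fin le_eqVlt; apply/orP; left; apply/eqP; field; rewrite lt0r_neq0.
Qed.

End bmo_norm.

Theorem corollary2p1 (R : realType) (n : nat) (hn : (1 <= n)%N) :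
  exists C : R, 0 < C /\
    forall f : 'rV[R]_n -> R -> R, L2BMO f ->
      [/\ exists Mf : 'rV[R]_n -> R -> R, is_M_heat f Mf,
          forall Mf : 'rV[R]_n -> R -> R, is_M_heat f Mf ->
            (sup_eball (fun xB r =>
               sqrte ((r ^- n)%:E *
                 \int[lebesgue_measure]_(t in `]0%R, (r ^+ 2)%R[)
                   \int[lebesgue_rV n]_(x in eball xB r)
                     (`|Mf x t| ^+ 2)%:E))
             <= C%:E * L2BMO_norm f)%E
        & (sup_eball (fun xB r =>
             sqrte ((r ^- n)%:E *
               \int[lebesgue_measure]_(t in `]0%R, (r ^+ 2)%R[)
                 \int[lebesgue_rV n]_(x in eball xB r)
                   (T_heat_sqnorm f x t * t^-1%:E)))
           <= C%:E * L2BMO_norm f)%E].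
Proof.
pose c1 : R := 2 * M_cst (R := R) (n := n) * bmo_cst (n := n).
pose c2 : R := gradient_cst (R := R) (n := n).
(* A positive number above both constants, with no need to know their signs. *)
pose C : R := `|c1| + `|c2| + 1.
have C0 : 0 < C by rewrite ltr_wpDl// addr_ge0.
have c1C : c1 <= C by have := ler_norm c1; have := normr_ge0 c2; rewrite /C; lra.
have c2C : c2 <= C by have := ler_norm c2; have := normr_ge0 c1; rewrite /C; lra.
exists (Num.sqrt C); split; first by rewrite sqrtr_gt0.
move=> f [mf /L2BMO_normE[s [s0 -> bmo]]].
have Kgt0 K : s < K -> 0 < K by exact: le_lt_trans.
have bmoK K : s < K -> forall xB (r : R), _ := fun sK xB r => bmo K xB r (ltW sK).
have s1 : s < s + 1 by rewrite ltrDl.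
split.
- exact: (M_heat_exists mf (Kgt0 _ s1) (bmoK _ s1) hn).
- move=> Mf MfP; apply: ge_ereal_sup => _ [[xB r] /= r0 <-].
  apply: (sqrte_scaled_le r0 C0 c1C s0) => K sK.
  exact: (M_heat_box_le mf (Kgt0 _ sK) (bmoK _ sK) hn xB MfP r0).
- apply: ge_ereal_sup => _ [[xB r] /= r0 <-].
  apply: (sqrte_scaled_le r0 C0 c2C s0) => K sK.
  exact: (T_heat_box mf (Kgt0 _ sK) (bmoK _ sK) hn xB r0).
Qed.
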